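(* For every fixed $k\in\mathbb N$ the following problem is decidable: given finite alphabets $A,B$ and a timed automaton with $\varepsilon$-transitions recognising (with Büchi acceptance) a timed $\omega$-language $W\subseteq (A\times B\times\mathbb R_{\ge0})^\omega$ over the alphabet $A\times B$, decide whether there exists $m\in\mathbb N$ such that Player II has a winning $k,m$-controller in the timed synthesis game $G(A,B,W)$.
   Context: Timed words: sequences $(a_1,t_1)(a_2,t_2)\cdots$ with $0\le t_1\le t_2\le\cdots$ reals. Clock constraints over clocks $X$: Boolean combinations of $x\sim z$, $x-y\sim z$ ($z\in\mathbb Z$, $\sim\in\{<,\le,=,\ge,>\}$). A timed automaton with $\varepsilon$-transitions $(\Sigma,L,X,I,F,\Delta)$ has rules $(p,a,\varphi,Y,q)$, $a\in\Sigma\cup\{\varepsilon\}$, taken after time elapse when the valuation satisfies $\varphi$, resetting $Y$; runs start in $I$ with all clocks $0$; its timed $\omega$-language consists of the infinite timed words over $\Sigma$ obtained by deleting $\varepsilon$-letters from words of runs visiting $F$ infinitely often (keeping only infinite results). For clocks $X$ and $m\in\mathbb N$, valuations are $(X,m)$-region equivalent if they satisfy the same constraints over $X$ with constants of absolute value $\le m$; classes are regions. Game $G(A,B,W)$: in rounds $i=1,2,\dots$ Player I picks $a_i\in A$, $t_i\ge t_{i-1}$ ($t_0=0$), Player II answers $b_i\in B$; Player I wins iff $(a_1,b_1,t_1)(a_2,b_2,t_2)\cdots\in W$. A $k,m$-controller is $(A,B,L,\ell_0,\delta)$ with finite memory $L$, $\ell_0\in L$, $k$ clocks $X$, $\delta:L\times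 A\times \mathrm{Regions}(X,m)\to L\times B\times 2^X$; from $(\ell_n,\mu_n)$ (initially $\ell_0$ and all clocks $0$), on $(a_{n+1},t_{n+1})$ with $\nu=\mu_n+(t_{n+1}-t_n)$ and $\delta(\ell_n,a_{n+1},[\nu])=(\ell',b,Y)$ it answers $b$ and moves to $\ell'$ and $\nu$ with $Y$ reset to $0$. It is winning if no consistent infinite play lies in $W$. *)

(* Defs.v *)
From Stdlib Require Import Reals ZArith List Arith.
Import ListNotations.
Open Scope R_scope.

Inductive code : Type :=
| Zero : code
| Succ : code
| Proj : nat -> code
| Comp : code -> list code -> code
| Prim : code -> code -> code
| Mu : code -> code.

Inductive eval : code -> list nat -> nat -> Prop :=
| eZero a : eval Zero a 0
| eSucc a : eval Succ a (S (hd 0%nat a))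
| eProj i a : eval (Proj i) a (nth i a 0%nat)
| eComp f gs a bs r : evals gs a bs -> eval f bs r -> eval (Comp f gs) a r
| ePrim0 f g a r : eval f a r -> eval (Prim f g) (0%nat :: a) r
| ePrimS f g n a r r' :
    eval (Prim f g) (n :: a) r -> eval g (n :: r :: a) r' ->
    eval (Prim f g) (S n :: a) r'
| eMu f a n :
    eval f (n :: a) 0%nat ->
    (forall j, (j < n)%nat -> exists v, eval f (j :: a) (S v)) ->
    eval (Mu f) a n
with evals : list code -> list nat -> list nat -> Prop :=
| esNil a : evals nil a nil
| esCons g gs a b bs : eval g a b -> evals gs a bs -> evals (g :: gs) a (b :: bs).

Definition decidable_pred {X : Type} (enc : X -> nat) (P : X -> Prop) : Prop :=
  exists c : code, forall x : X,
    (P x -> eval c [enc x] 1%nat) /\ (~ P x -> eval c [enc x] 0%nat).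

Inductive cmp : Type := CLt | CLe | CEq | CGe | CGt.

Definition cmpR (o : cmp) (a b : R) : Prop :=
  match o with
  | CLt => a < b | CLe => a <= b | CEq => a = b | CGe => a >= b | CGt => a > b
  end.

(* Boolean combinations of  x ~ z  and  x - y ~ z  (clocks are nat indices) *)
Inductive cc : Type :=
| CTrue : cc
| CAtom : nat -> cmp -> Z -> cc
| CDiff : nat -> nat -> cmp -> Z -> cc
| CNot : cc -> cc
| CAnd : cc -> cc -> cc
| COr : cc -> cc -> cc.

Definition valuation := nat -> R.

Fixpoint sat (v : valuation) (c : cc) : Prop :=
  match c with
  | CTrue => True
  | CAtom x o z => cmpR o (v x) (IZR z)
  | CDiff x y o z => cmpR o (v x - v y) (IZR z)
  | CNot c1 => ~ sat v c1
  | CAnd c1 c2 => sat v c1 /\ sat v c2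
  | COr c1 c2 => sat v c1 \/ sat v c2
  end.

Fixpoint clocks_below (k : nat) (c : cc) : Prop :=
  match c with
  | CTrue => True
  | CAtom x _ _ => (x < k)%nat
  | CDiff x y _ _ => (x < k)%nat /\ (y < k)%nat
  | CNot c1 => clocks_below k c1
  | CAnd c1 c2 | COr c1 c2 => clocks_below k c1 /\ clocks_below k c2
  end.

Fixpoint consts_below (m : nat) (c : cc) : Prop :=
  match c with
  | CTrue => True
  | CAtom _ _ z | CDiff _ _ _ z => (Z.abs z <= Z.of_nat m)%Z
  | CNot c1 => consts_below m c1
  | CAnd c1 c2 | COr c1 c2 => consts_below m c1 /\ consts_below m c2
  end.

Definition region_equiv (k m : nat) (v v' : valuation) : Prop :=
  forall c : cc, clocks_below k c -> consts_below m c -> (sat v c <-> sat v' c).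

Definition delay (v : valuation) (d : R) : valuation := fun x => v x + d.

Definition reset (Y : list nat) (v : valuation) : valuation :=
  fun x => if in_dec Nat.eq_dec x Y then 0 else v x.

Definition zero_val : valuation := fun _ => 0.

Definition prev (t : nat -> R) (n : nat) : R :=
  match n with O => 0 | S j => t j end.

(* A rule (p, a, phi, Y, q); the label None is epsilon, Some (a,b) is the
   letter (a,b) of A x B.  Locations, clocks and letters are nat indices. *)
Record rule : Type := mkRule {
  r_src : nat; r_lab : option (nat * nat); r_guard : cc;
  r_reset : list nat; r_tgt : nat }.

(* An instance: alphabet sizes |A| = na, |B| = nb (A = {0..na-1},
   B = {0..nb-1}), initial locations, final locations, rules. *)
Record TA : Type := mkTA {
  ta_na : nat; ta_nb : nat; ta_init : list nat; ta_final : list nat;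
  ta_rules : list rule }.

(* An infinite run: transition i is rule r i, fired at time tm i;
   loc i / val i are location and valuation before transition i. *)
Definition is_run (T : TA) (r : nat -> rule) (tm : nat -> R)
    (loc : nat -> nat) (val : nat -> valuation) : Prop :=
  In (loc 0%nat) (ta_init T) /\
  (forall x, val 0%nat x = 0) /\
  0 <= tm 0%nat /\
  (forall i, tm i <= tm (S i)) /\
  (forall i,
     In (r i) (ta_rules T) /\
     r_src (r i) = loc i /\
     sat (delay (val i) (tm i - prev tm i)) (r_guard (r i)) /\
     loc (S i) = r_tgt (r i) /\
     (forall x, val (S i) x = reset (r_reset (r i)) (delay (val i) (tm i - prev tm i)) x)).

Definition buchi (T : TA) (loc : nat -> nat) : Prop :=
  forall N, exists i, (N <= i)%nat /\ In (loc i) (ta_final T).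

(* The timed omega-language of T: infinite timed words obtained from
   accepting runs by deleting the epsilon letters. *)
Definition in_lang (T : TA) (w : nat -> (nat * nat) * R) : Prop :=
  exists (r : nat -> rule) (tm : nat -> R) (loc : nat -> nat)
         (val : nat -> valuation) (g : nat -> nat),
    is_run T r tm loc val /\ buchi T loc /\
    (forall n, (g n < g (S n))%nat) /\
    (forall n, r_lab (r (g n)) = Some (fst (w n)) /\ tm (g n) = snd (w n)) /\
    (forall i, r_lab (r i) <> None -> exists n, g n = i).

(* Memory L = {0,...,c_size-1}, initial memory c_init, and the transition
   function delta : L x A x Regions(X,m) -> L x B x 2^X, represented as a
   function of valuations that is constant on (X,m)-regions. *)
Record controller : Type := mkCtrl {
  c_size : nat; c_init : nat;
  c_delta : nat -> nat -> valuation -> (nat * nat) * list nat }.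

Definition valid_controller (k m na nb : nat) (C : controller) : Prop :=
  (c_init C < c_size C)%nat /\
  (forall l a v, (l < c_size C)%nat -> (a < na)%nat ->
     (fst (fst (c_delta C l a v)) < c_size C)%nat /\
     (snd (fst (c_delta C l a v)) < nb)%nat /\
     (forall y, In y (snd (c_delta C l a v)) -> (y < k)%nat)) /\
  (forall l a v v', (l < c_size C)%nat -> (a < na)%nat ->
     region_equiv k m v v' -> c_delta C l a v = c_delta C l a v').

Fixpoint cstate (C : controller) (a : nat -> nat) (t : nat -> R) (n : nat)
  : nat * valuation :=
  match n with
  | O => (c_init C, zero_val)
  | S n' =>
      let lm := cstate C a t n' in
      let nu := delay (snd lm) (t n' - prev t n') in
      let d := c_delta C (fst lm) (a n') nu in
      (fst (fst d), reset (snd d) nu)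
  end.

(* answer b_{n+1} of the controller in round n+1 (0-based n) *)
Definition canswer (C : controller) (a : nat -> nat) (t : nat -> R) (n : nat) : nat :=
  let lm := cstate C a t n in
  let nu := delay (snd lm) (t n - prev t n) in
  snd (fst (c_delta C (fst lm) (a n) nu)).

Definition winning (T : TA) (C : controller) : Prop :=
  forall (a : nat -> nat) (t : nat -> R),
    (forall n, (a n < ta_na T)%nat) ->
    0 <= t 0%nat -> (forall n, t n <= t (S n)) ->
    ~ in_lang T (fun n => ((a n, canswer C a t n), t n)).

Definition has_km_controller (k : nat) (T : TA) : Prop :=
  exists (m : nat) (C : controller),
    valid_controller k m (ta_na T) (ta_nb T) C /\ winning T C.

Definition npair (x y : nat) : nat := ((x + y) * S (x + y)) / 2 + y.

Fixpoint enc_list (l : list nat) : nat :=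
  match l with nil => 0 | x :: l' => S (npair x (enc_list l')) end.

Definition enc_Z (z : Z) : nat :=
  if Z.leb 0 z then 2 * Z.to_nat z else 2 * Z.to_nat (- z) - 1.

Definition enc_cmp (o : cmp) : nat :=
  match o with CLt => 0 | CLe => 1 | CEq => 2 | CGe => 3 | CGt => 4 end.

Fixpoint enc_cc (c : cc) : nat :=
  match c with
  | CTrue => npair 0 0
  | CAtom x o z => npair 1 (npair x (npair (enc_cmp o) (enc_Z z)))
  | CDiff x y o z => npair 2 (npair x (npair y (npair (enc_cmp o) (enc_Z z))))
  | CNot c1 => npair 3 (enc_cc c1)
  | CAnd c1 c2 => npair 4 (npair (enc_cc c1) (enc_cc c2))
  | COr c1 c2 => npair 5 (npair (enc_cc c1) (enc_cc c2))
  end.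

Definition enc_lab (o : option (nat * nat)) : nat :=
  match o with None => 0 | Some (a, b) => S (npair a b) end.

Definition enc_rule (r : rule) : nat :=
  npair (r_src r) (npair (enc_lab (r_lab r))
    (npair (enc_cc (r_guard r)) (npair (enc_list (r_reset r)) (r_tgt r)))).

Definition enc_TA (T : TA) : nat :=
  npair (ta_na T) (npair (ta_nb T) (npair (enc_list (ta_init T))
    (npair (enc_list (ta_final T)) (enc_list (map enc_rule (ta_rules T)))))).

(* Main.v *)
(* Player II's clocks are replaced by timers. An active timer that reaches 1 causes a tick, at which
   Player II restarts it (counting in her memory) or switches it off; letters may reset and activate
   timers. A (k,m)-controller plays this tick game, switching a timer off after m + 1 ticks.
   Conversely a finite-memory strategy that restarts no timer infinitely often between resets
   yields a (k,m')-controller: the ticks between two letters, and their order, can be read off the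
   region at the second letter because diagonal constraints are available. So the unknown m
   disappears, at the price of one more condition on restarts, watched by monitor states.

   On regions, represented by valuations on a grid, Player II now has to ensure that every run of a
   finite nondeterministic system contains finitely many marked steps. From a finite-memory winning
   strategy one obtains one whose number of marked steps is bounded by a computable K: determinize
   by letting positions of the play merge when the profiles of the suffixes from them agree, take the
   lexicographically least progress measure over all histories with the same set of tokens, and play
   as at that history; this strategy depends only on the token state. Hence Player II has a
   controller for some m iff there is a set of rank functions with values at most K that is closed under
   the moves, which is a bounded arithmetical statement about the code of the automaton. *)

Require Import Defs.
From Stdlib Require Import Reals ZArith List Arith Lia Lra Classical ClassicalEpsilon Cantor.
From mathcomp Require all_boot zify.
Import ListNotations.

(** * Codes of pairs, vectors and finite sets *)

Open Scope nat_scope.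

(** Accepting runs and timers restarted for ever must be excluded at once. A monitor guesses that
    the last reset of its timer has passed, which turns both into one condition on the runs of a
    single nondeterministic system. A final location may be visited between events, where Player II
    cannot react, so a flag remembers it and the mark is made at the next event. Runs with finitely
    many letters need no separate treatment: if restarts are finite in number, so are the ticks, the
    events and the marks, and only infinite words count anyway. The bound [K] counts the pairs of a
    token state and a state. A path with more marked steps repeats the source of one of them and can
    be pumped, and this graph does not involve the memory of the given strategy, so [K] is
    independent of it and of [m]. Ranks go up to [K + 1], which promises nothing. The same [K]
    bounds the restarts between resets, whence a controller with constant [K + 3]. Clock indices,
    constants and reachable locations are at most the code [w] of the automaton, so the bounds of
    all quantifiers in [Solv] are computed from [w] and the fixed [k]. *)

Lemma npair_cantor x y : npair x y = Cantor.to_nat (x, y).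
Proof.
  unfold npair. pose proof (Cantor.to_nat_spec x y) as H.
  rewrite (Nat.add_comm x y).
  assert (E : (y + x) * S (y + x) = (Cantor.to_nat (x, y) - y) * 2) by lia.
  rewrite E, Nat.div_mul by lia.
  assert (y * 2 <= Cantor.to_nat (x, y) * 2) by nia. lia.
Qed.

Definition pf z := fst (Cantor.of_nat z).
Definition ps z := snd (Cantor.of_nat z).

Lemma pf_npair x y : pf (npair x y) = x.
Proof. unfold pf. rewrite npair_cantor, Cantor.cancel_of_to. reflexivity. Qed.
Lemma ps_npair x y : ps (npair x y) = y.
Proof. unfold ps. rewrite npair_cantor, Cantor.cancel_of_to. reflexivity. Qed.
Lemma npair_pfps z : npair (pf z) (ps z) = z.
Proof.
  unfold pf, ps. rewrite npair_cantor, <- surjective_pairing. apply Cantor.cancel_to_of.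
Qed.

Lemma npair_le x y x' y' : x <= x' -> y <= y' -> npair x y <= npair x' y'.
Proof.
  intros H1 H2. unfold npair. apply Nat.add_le_mono; auto.
  apply Nat.Div0.div_le_mono, Nat.mul_le_mono; lia.
Qed.

Lemma npair_ge_r x y : y <= npair x y.
Proof. unfold npair. lia. Qed.
Lemma npair_ge_sum x y : x + y <= npair x y.
Proof.
  rewrite npair_cantor. pose proof (Cantor.to_nat_spec x y). nia.
Qed.
Lemma pf_le z : pf z <= z.
Proof. rewrite <- (npair_pfps z) at 2. pose proof (npair_ge_sum (pf z) (ps z)). lia. Qed.
Lemma ps_le z : ps z <= z.
Proof. rewrite <- (npair_pfps z) at 2. pose proof (npair_ge_sum (pf z) (ps z)). lia. Qed.
Lemma ps_lt z : 0 < pf z -> ps z < z.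
Proof. intros H. rewrite <- (npair_pfps z) at 2. pose proof (npair_ge_sum (pf z) (ps z)). lia. Qed.

Definition digit b g x := (g / b ^ x) mod b.

Fixpoint vec (f : nat -> nat) N b :=
  match N with 0 => 0 | S N' => vec f N' b + (f N' mod b) * b ^ N' end.

Lemma vec_lt f N b : 0 < b -> vec f N b < b ^ N.
Proof.
  intros Hb. induction N as [|N IH]; simpl; [lia|].
  pose proof (Nat.mod_upper_bound (f N) b ltac:(lia)). nia.
Qed.

Lemma digit_lt b g x : 0 < b -> digit b g x < b.
Proof. intros. apply Nat.mod_upper_bound. lia. Qed.

Lemma digit_high b g x N : 0 < b -> g < b ^ N -> N <= x -> digit b g x = 0.
Proof.
  intros Hb Hg HN. unfold digit. rewrite Nat.div_small.
  - apply Nat.mod_0_l. lia.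
  - apply Nat.lt_le_trans with (b ^ N); auto. apply Nat.pow_le_mono_r; lia.
Qed.

Lemma digit_vec f N b x : 0 < b -> x < N -> digit b (vec f N b) x = f x mod b.
Proof.
  intros Hb. induction N as [|N IH]; intros Hx; [lia|]. simpl.
  pose proof (vec_lt f N b Hb) as HV. unfold digit in *.
  destruct (Nat.eq_dec x N) as [->|Hne].
  - rewrite Nat.div_add by (apply Nat.pow_nonzero; lia).
    rewrite Nat.div_small by auto. simpl. apply Nat.Div0.mod_mod.
  - rewrite <- IH by lia.
    (* After division by [b ^ x] the new top digit contributes a multiple of [b], which vanishes in
       the remainder. *)
    replace (b ^ N) with (b ^ (N - S x) * b * b ^ x).
    2:{ replace N with (N - S x + S x) at 2 by lia. rewrite Nat.pow_add_r. simpl. lia. }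
    rewrite Nat.mul_assoc, Nat.div_add by (apply Nat.pow_nonzero; lia).
    rewrite Nat.mul_assoc, Nat.Div0.mod_add. reflexivity.
Qed.

Definition bit A x := digit 2 A x = 1.

(** A classical truth value, which computes nothing by itself. Computability is always a separate
    claim: some code evaluates to these values on all arguments. *)
Definition chi (P : Prop) : nat := if excluded_middle_informative P then 1 else 0.

Lemma chi_true (P : Prop) : P -> chi P = 1.
Proof. unfold chi. destruct excluded_middle_informative; tauto. Qed.
Lemma chi_false (P : Prop) : ~ P -> chi P = 0.
Proof. unfold chi. destruct excluded_middle_informative; tauto. Qed.
Lemma chi_iff (P P' : Prop) : (P <-> P') -> chi P = chi P'.
Proof. unfold chi. intros. repeat destruct excluded_middle_informative; tauto. Qed.

Definition setc (P : nat -> Prop) N := vec (fun x => chi (P x)) N 2.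

Lemma setc_lt P N : setc P N < 2 ^ N.
Proof. apply vec_lt. lia. Qed.

Lemma bit_setc P N x : bit (setc P N) x <-> x < N /\ P x.
Proof.
  unfold bit, setc. destruct (lt_dec x N) as [H|H].
  - rewrite digit_vec by lia. unfold chi.
    destruct excluded_middle_informative; simpl; intuition lia.
  - rewrite (digit_high _ _ _ N); try lia. apply vec_lt; lia.
Qed.

Lemma vec_ext f f' N b : (forall x, x < N -> f x = f' x) -> vec f N b = vec f' N b.
Proof.
  induction N as [|N IH]; simpl; auto. intros H. rewrite IH, H; auto.
Qed.

Lemma setc_ext P P' N : (forall x, x < N -> (P x <-> P' x)) -> setc P N = setc P' N.
Proof. intros H. apply vec_ext. intros x Hx. apply chi_iff. auto. Qed.

(** * Computable functions and decidable predicates *)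

(** [nth] in a form that reduces to [hd 0] of iterated [tl]. A bounded quantifier puts its variable
    in front of the arguments; in this form the shifted indices agree by conversion, on which
    [pr_var] relies. *)
Fixpoint get (j : nat) (a : list nat) : nat :=
  match j with 0 => hd 0 a | S j' => get j' (tl a) end.

Lemma get_nth j a : get j a = nth j a 0.
Proof.
  revert a. induction j as [|j IH]; intros a; simpl; [destruct a; auto|].
  rewrite IH. destruct a; simpl; auto. destruct j; auto.
Qed.

(* Functions of lists of fixed length [n]: a code can only refer to finitely many arguments. *)
Definition PR (n : nat) (f : list nat -> nat) : Prop :=
  exists c, forall a, length a = n -> eval c a (f a).
Definition Dec (n : nat) (P : list nat -> Prop) : Prop := PR n (fun a => chi (P a)).

Lemma PR_ext n f g : (forall a, length a = n -> f a = g a) -> PR n f -> PR n g.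
Proof. intros H [c Hc]. exists c. intros a Ha. rewrite <- H; auto. Qed.
Lemma Dec_ext n P P' : (forall a, P a <-> P' a) -> Dec n P -> Dec n P'.
Proof. intros H. apply PR_ext. intros. apply chi_iff, H. Qed.

Lemma PR_get n j : PR n (fun a => get j a).
Proof. exists (Proj j). intros. rewrite get_nth. constructor. Qed.

Lemma PR_comp n m f (gs : list (list nat -> nat)) :
  PR m f -> Forall (PR n) gs -> length gs = m -> PR n (fun a => f (map (fun g => g a) gs)).
Proof.
  intros [c Hc] Hgs Hm.
  assert (H : exists cs, forall a, length a = n -> evals cs a (map (fun g => g a) gs)).
  { clear Hm. induction Hgs as [|g gs [cg Hg] _ [cs Hcs]].
    - exists nil. intros. constructor.
    - exists (cg :: cs). intros. simpl. constructor; auto. }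
  destruct H as [cs Hcs]. exists (Comp c cs). intros a Ha. econstructor; eauto.
  apply Hc. rewrite length_map. auto.
Qed.

Lemma PR_const n v : PR n (fun _ => v).
Proof.
  induction v as [|v [c Hc]].
  - exists Zero. intros. constructor.
  - exists (Comp Succ [c]). intros a Ha. apply eComp with [v].
    + repeat constructor; auto.
    + apply (eSucc [v]).
Qed.

Lemma PR_prim n f g (h : list nat -> nat) : PR n f -> PR (S (S n)) g ->
  (forall a, h (0 :: a) = f a) -> (forall i a, h (S i :: a) = g (i :: h (i :: a) :: a)) ->
  PR (S n) h.
Proof.
  intros [cf Hf] [cg Hg] H0 HS. exists (Prim cf cg). intros [|i a] Ha; [discriminate|].
  injection Ha as Ha. induction i as [|i IH].
  - rewrite H0. constructor; auto.
  - rewrite HS. econstructor; [exact IH|]. apply Hg. simpl. lia.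
Qed.

Definition F1 f := PR 1 (fun a => f (get 0 a)).
Definition F2 f := PR 2 (fun a => f (get 0 a) (get 1 a)).
Definition F3 f := PR 3 (fun a => f (get 0 a) (get 1 a) (get 2 a)).
Definition F4 f := PR 4 (fun a => f (get 0 a) (get 1 a) (get 2 a) (get 3 a)).
Definition D1 (P : nat -> Prop) := F1 (fun x => chi (P x)).
Definition D2 (P : nat -> nat -> Prop) := F2 (fun x y => chi (P x y)).
Definition D3 (P : nat -> nat -> nat -> Prop) := F3 (fun x y z => chi (P x y z)).
Definition D4 (P : nat -> nat -> nat -> nat -> Prop) := F4 (fun x y z t => chi (P x y z t)).
Definition D5 (P : nat -> nat -> nat -> nat -> nat -> Prop) :=
  Dec 5 (fun a => P (get 0 a) (get 1 a) (get 2 a) (get 3 a) (get 4 a)).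

Lemma PR_c1 f n g : F1 f -> PR n g -> PR n (fun a => f (g a)).
Proof.
  intros H H1. eapply PR_ext; [|apply (PR_comp n 1 _ [g] H); auto]. reflexivity.
Qed.
Lemma PR_c2 f n g1 g2 : F2 f -> PR n g1 -> PR n g2 -> PR n (fun a => f (g1 a) (g2 a)).
Proof.
  intros H H1 H2. eapply PR_ext; [|apply (PR_comp n 2 _ [g1; g2] H); auto]. reflexivity.
Qed.
Lemma PR_c3 f n g1 g2 g3 :
  F3 f -> PR n g1 -> PR n g2 -> PR n g3 -> PR n (fun a => f (g1 a) (g2 a) (g3 a)).
Proof.
  intros H H1 H2 H3. eapply PR_ext; [|apply (PR_comp n 3 _ [g1; g2; g3] H); auto]. reflexivity.
Qed.
Lemma PR_c4 f n g1 g2 g3 g4 : F4 f -> PR n g1 -> PR n g2 -> PR n g3 -> PR n g4 ->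
  PR n (fun a => f (g1 a) (g2 a) (g3 a) (g4 a)).
Proof.
  intros H H1 H2 H3 H4. eapply PR_ext; [|apply (PR_comp n 4 _ [g1; g2; g3; g4] H); auto]. reflexivity.
Qed.
Lemma Dec_c2 P n g1 g2 : D2 P -> PR n g1 -> PR n g2 -> Dec n (fun a => P (g1 a) (g2 a)).
Proof. exact (PR_c2 (fun x y => chi (P x y)) n g1 g2). Qed.
Lemma Dec_c3 P n g1 g2 g3 : D3 P -> PR n g1 -> PR n g2 -> PR n g3 ->
  Dec n (fun a => P (g1 a) (g2 a) (g3 a)).
Proof. exact (PR_c3 (fun x y z => chi (P x y z)) n g1 g2 g3). Qed.
Lemma Dec_c4 P n g1 g2 g3 g4 : D4 P -> PR n g1 -> PR n g2 -> PR n g3 -> PR n g4 ->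
  Dec n (fun a => P (g1 a) (g2 a) (g3 a) (g4 a)).
Proof. exact (PR_c4 (fun x y z t => chi (P x y z t)) n g1 g2 g3 g4). Qed.
Lemma Dec_c5 P n g1 g2 g3 g4 g5 : D5 P -> PR n g1 -> PR n g2 -> PR n g3 -> PR n g4 -> PR n g5 ->
  Dec n (fun a => P (g1 a) (g2 a) (g3 a) (g4 a) (g5 a)).
Proof.
  intros H H1 H2 H3 H4 H5. unfold Dec.
  eapply PR_ext; [|apply (PR_comp n 5 _ [g1; g2; g3; g4; g5] H); repeat constructor; auto]. reflexivity.
Qed.

Lemma F1_S : F1 S.
Proof. exists (Comp Succ [Proj 0]). intros a _. rewrite get_nth. eapply eComp; [repeat constructor|]. apply (eSucc [_]). Qed.

Lemma PR_S n g : PR n g -> PR n (fun a => S (g a)).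
Proof. apply PR_c1, F1_S. Qed.

Lemma F2_add : F2 Nat.add.
Proof.
  apply (PR_prim 1 (fun a => get 0 a) (fun a => S (get 1 a))); auto using PR_get, PR_S.
Qed.
Lemma PR_add n f g : PR n f -> PR n g -> PR n (fun a => f a + g a).
Proof. apply PR_c2, F2_add. Qed.
Lemma F2_mul : F2 Nat.mul.
Proof.
  apply (PR_prim 1 (fun a => 0) (fun a => get 2 a + get 1 a)); auto using PR_get, PR_const, PR_add.
Qed.
Lemma PR_mul n f g : PR n f -> PR n g -> PR n (fun a => f a * g a).
Proof. apply PR_c2, F2_mul. Qed.
Lemma PR_pow n f g : PR n f -> PR n g -> PR n (fun a => f a ^ g a).
Proof.
  intros Hf Hg. apply (PR_c2 (fun x y => y ^ x)); auto.
  apply (PR_prim 1 (fun a => 1) (fun a => get 2 a * get 1 a)); auto using PR_get, PR_const, PR_mul.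
Qed.
Lemma PR_pred n f : PR n f -> PR n (fun a => Nat.pred (f a)).
Proof.
  intros Hf. apply (PR_c1 Nat.pred); auto.
  apply (PR_prim 0 (fun a => 0) (fun a => get 0 a)); auto using PR_get, PR_const.
Qed.
Lemma PR_sub n f g : PR n f -> PR n g -> PR n (fun a => f a - g a).
Proof.
  intros Hf Hg. apply (PR_c2 (fun x y => y - x)); auto.
  apply (PR_prim 1 (fun a => get 0 a) (fun a => Nat.pred (get 1 a))); auto using PR_get, PR_pred.
  - intros. simpl. apply Nat.sub_0_r.
  - intros. simpl. lia.
Qed.

Lemma Dec_lt n f g : PR n f -> PR n g -> Dec n (fun a => f a < g a).
Proof.
  intros Hf Hg. unfold Dec. apply PR_ext with (fun a => 1 - (1 - (g a - f a))).
  - intros a _. unfold chi. destruct excluded_middle_informative; lia.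
  - auto using PR_sub, PR_const.
Qed.
Lemma Dec_not n P : Dec n P -> Dec n (fun a => ~ P a).
Proof.
  intros H. unfold Dec in *. apply PR_ext with (fun a => 1 - chi (P a)).
  - intros a _. unfold chi. repeat destruct excluded_middle_informative; tauto.
  - auto using PR_sub, PR_const.
Qed.
Lemma Dec_and n P P' : Dec n P -> Dec n P' -> Dec n (fun a => P a /\ P' a).
Proof.
  intros H H'. unfold Dec in *. apply PR_ext with (fun a => chi (P a) * chi (P' a)).
  - intros a _. unfold chi. repeat destruct excluded_middle_informative; tauto.
  - auto using PR_mul.
Qed.
Lemma Dec_or n P P' : Dec n P -> Dec n P' -> Dec n (fun a => P a \/ P' a).
Proof.
  intros H H'. apply Dec_ext with (fun a => ~ (~ P a /\ ~ P' a)); [intros; tauto|].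
  auto using Dec_not, Dec_and.
Qed.
Lemma Dec_imp n P P' : Dec n P -> Dec n P' -> Dec n (fun a => P a -> P' a).
Proof.
  intros H H'. apply Dec_ext with (fun a => ~ (P a /\ ~ P' a)); [intros; tauto|].
  auto using Dec_not, Dec_and.
Qed.
Lemma Dec_iff n P P' : Dec n P -> Dec n P' -> Dec n (fun a => P a <-> P' a).
Proof. intros H H'. apply Dec_and; apply Dec_imp; auto. Qed.
Lemma Dec_le n f g : PR n f -> PR n g -> Dec n (fun a => f a <= g a).
Proof.
  intros. apply Dec_ext with (fun a => ~ g a < f a); [intros; lia|]. auto using Dec_not, Dec_lt.
Qed.
Lemma Dec_eq n f g : PR n f -> PR n g -> Dec n (fun a => f a = g a).
Proof.
  intros. apply Dec_ext with (fun a => f a <= g a /\ g a <= f a); [intros; lia|].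
  auto using Dec_and, Dec_le.
Qed.
Lemma Dec_True n : Dec n (fun _ => True).
Proof. apply Dec_ext with (fun _ => 0 = 0); [tauto|]. auto using Dec_eq, PR_const. Qed.

Lemma map_get_shift d n a : length a = d + n -> map (fun j => get (d + j) a) (seq 0 n) = skipn d a.
Proof.
  intros Ha. apply nth_ext with 0 0.
  - rewrite length_map, length_seq, length_skipn. lia.
  - intros j Hj. rewrite length_map, length_seq in Hj.
    rewrite (nth_indep _ 0 ((fun j => get (d + j) a) 0)) by (rewrite length_map, length_seq; auto).
    rewrite (map_nth (fun j => get (d + j) a)), seq_nth by auto.
    rewrite get_nth, nth_skipn. reflexivity.
Qed.

(** The step function of [Prim] receives the counter, the previous value and the parameters.
    Dropping the previous value lets a predicate of counter and parameters be used there. *)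
Lemma PR_skip n f : PR (S n) f -> PR (S (S n)) (fun a => f (hd 0 a :: tl (tl a))).
Proof.
  intros H.
  eapply PR_ext; [|apply (PR_comp (S (S n)) (S n) f
    (get 0 :: map (fun j a => get (2 + j) a) (seq 0 n)) H)].
  - intros a Ha. cbn [map]. rewrite map_map, (map_get_shift 2 n a) by auto.
    destruct a as [|? [|? ?]]; auto.
  - constructor; [apply (PR_get _ 0)|]. apply Forall_map, Forall_forall. intros. apply PR_get.
  - simpl. rewrite length_map, length_seq. auto.
Qed.

Lemma PR_consarg n f B : PR (S n) f -> PR n B -> PR n (fun a => f (B a :: a)).
Proof.
  intros H HB. eapply PR_ext; [|apply (PR_comp n (S n) f (B :: map (fun j a => get (0 + j) a) (seq 0 n)) H)].
  - intros a Ha. cbn [map]. rewrite map_map, (map_get_shift 0 n a Ha). reflexivity.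
  - constructor; auto. apply Forall_map, Forall_forall. intros. apply PR_get.
  - simpl. rewrite length_map, length_seq. auto.
Qed.

(** Primitive recursion on the bound: the indicator for [S i] is the one for [i] times the indicator
    of [P i]. The bound is first an extra argument, for which [B] is then substituted. *)
Lemma Dec_all n (P : nat -> list nat -> Prop) B :
  PR n B -> Dec (S n) (fun a => P (hd 0 a) (tl a)) -> Dec n (fun a => forall i, i < B a -> P i a).
Proof.
  intros HB HP.
  apply (PR_consarg n (fun a => chi (forall i, i < hd 0 a -> P i (tl a))) B); auto.
  apply (PR_prim n (fun a => 1)
    (fun a => get 1 a * (fun a => chi (P (hd 0 a) (tl a))) (hd 0 a :: tl (tl a)))).
  - apply PR_const.
  - apply PR_mul; [apply PR_get|]. exact (PR_skip n _ HP).
  - intros a. apply chi_true. simpl. lia.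
  - intros i a. simpl. destruct (excluded_middle_informative (forall j, j < i -> P j a)) as [H|H].
    + rewrite (chi_true _ H), Nat.mul_1_l. apply chi_iff. split.
      * intros H1. apply H1. lia.
      * intros H1 j Hj. destruct (Nat.eq_dec j i) as [->|]; auto. apply H. lia.
    + rewrite (chi_false _ H). apply chi_false. intros H1. apply H. intros. apply H1. lia.
Qed.

Lemma Dec_ex n (P : nat -> list nat -> Prop) B :
  PR n B -> Dec (S n) (fun a => P (hd 0 a) (tl a)) -> Dec n (fun a => exists i, i < B a /\ P i a).
Proof.
  intros HB HP. apply Dec_ext with (fun a => ~ forall i, i < B a -> ~ P i a).
  - intros a. split.
    + intros H. apply NNPP. intros H1. apply H. intros i Hi HPi. apply H1. eauto.
    + intros [i [Hi HPi]] H. apply (H i); auto.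
  - apply Dec_not, (Dec_all n (fun i a => ~ P i a)); auto using Dec_not.
Qed.

(** Unbounded search for the value: the indicator of the negated graph is 0 at [f a] and 1 before
    it, which is the format that [Mu] demands. No bound on [f] has to be supplied. *)
Lemma PR_graph n (P : nat -> list nat -> Prop) f :
  (forall a y, P y a <-> y = f a) -> Dec (S n) (fun a => P (hd 0 a) (tl a)) -> PR n f.
Proof.
  intros HP H. apply Dec_not in H. destruct H as [c Hc]. exists (Mu c). intros a Ha.
  assert (Ha' : forall i, length (i :: a) = S n) by (intros; simpl; lia).
  apply eMu.
  - specialize (Hc (f a :: a) (Ha' _)). cbn [hd tl] in Hc. rewrite chi_false in Hc; auto.
    intros H. apply H, HP. reflexivity.
  - intros j Hj. exists 0. specialize (Hc (j :: a) (Ha' _)). cbn [hd tl] in Hc.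
    rewrite chi_true in Hc; auto. rewrite HP. lia.
Qed.

Ltac pr_var :=
  match goal with
  | |- PR ?n (fun a => hd 0 _) =>
    first [ exact (PR_get n 0) | exact (PR_get n 1) | exact (PR_get n 2) | exact (PR_get n 3)
          | exact (PR_get n 4) | exact (PR_get n 5) | exact (PR_get n 6) | exact (PR_get n 7)
          | exact (PR_get n 8) | exact (PR_get n 9) | exact (PR_get n 10) | exact (PR_get n 11)
          | exact (PR_get n 12) | exact (PR_get n 13) | exact (PR_get n 14) | exact (PR_get n 15)
          | exact (PR_get n 16) | exact (PR_get n 17) | exact (PR_get n 18) | exact (PR_get n 19) ]
  end.
(** A hook, extended below whenever further functions or predicates are known to be computable; [pr]
    then treats them as atoms. *)
Ltac pr_user := fail.
Ltac pr_step :=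
  cbv beta;
  match goal with
  | |- PR ?n (hd 0) => exact (PR_get n 0)
  | |- PR _ (fun a => hd 0 _) => pr_var
  | |- PR _ (fun a => ?c) => apply PR_const
  | |- PR _ (fun a => S _) => apply PR_S
  | |- PR _ (fun a => _ + _) => apply PR_add
  | |- PR _ (fun a => _ * _) => apply PR_mul
  | |- PR _ (fun a => _ ^ _) => apply PR_pow
  | |- PR _ (fun a => _ - _) => apply PR_sub
  | |- Dec _ (fun a => True) => apply Dec_True
  | |- Dec _ (fun a => _ < _) => apply Dec_lt
  | |- Dec _ (fun a => _ <= _) => apply Dec_le
  | |- Dec _ (fun a => _ = _) => apply Dec_eq
  | |- Dec _ (fun a => ~ _) => apply Dec_not
  | |- Dec _ (fun a => _ /\ _) => apply Dec_and
  | |- Dec _ (fun a => _ \/ _) => apply Dec_or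
  | |- Dec _ (fun a => _ <-> _) => apply Dec_iff
  | |- Dec _ (fun a => forall i, i < _ -> _) => apply Dec_all
  | |- Dec _ (fun a => exists i, i < _ /\ _) => apply Dec_ex
  | _ => pr_user
  | |- Dec _ (fun a => _ -> _) => apply Dec_imp
  end.
Ltac pr :=
  cbv delta [F1 F2 F3 F4 D1 D2 D3 D4 D5]; cbv beta;
  repeat (change (PR ?n (fun a => chi (@?P a))) with (Dec n P)); cbn [get]; repeat pr_step.

Lemma F2_div : F2 Nat.div.
Proof.
  (* The first disjunct is the convention that division by 0 gives 0. *)
  apply (PR_graph 2 (fun y a => (hd 0 (tl a) = 0 /\ y = 0) \/
     (0 < hd 0 (tl a) /\ hd 0 (tl a) * y <= hd 0 a /\ hd 0 a < hd 0 (tl a) * S y))).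
  - intros a y. cbn [get]. destruct (hd 0 (tl a)) as [|d]; [simpl; lia|].
    split.
    + intros [H|[_ [H1 H2]]]; [lia|].
      apply (Nat.div_unique _ _ y (hd 0 a - S d * y)); lia.
    + intros ->. right. split; [lia|]. split; [apply Nat.Div0.mul_div_le|apply Nat.mul_succ_div_gt; lia].
  - pr.
Qed.
Lemma F2_mod : F2 Nat.modulo.
Proof.
  apply PR_ext with (fun a => get 0 a - get 1 a * (get 0 a / get 1 a)).
  - intros a _. generalize (get 0 a) (get 1 a). intros x y.
    pose proof (Nat.div_mod_eq x y). lia.
  - apply PR_sub; [apply PR_get|]. apply PR_mul; [apply PR_get|].
    apply (PR_c2 Nat.div); [apply F2_div| |]; apply PR_get.
Qed.
Ltac pr_div := match goal with
  | |- PR _ (fun a => _ / _) => apply (PR_c2 Nat.div _ _ _ F2_div)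
  | |- PR _ (fun a => _ mod _) => apply (PR_c2 Nat.modulo _ _ _ F2_mod)
  end.
Ltac pr_user ::= pr_div.
Lemma F2_npair : F2 npair.
Proof. unfold npair. pr. Qed.
Lemma F3_digit : F3 digit.
Proof. unfold digit. pr. Qed.
Lemma D2_bit : D2 bit.
Proof. unfold bit, digit. pr. Qed.
Lemma F1_pf : F1 pf.
Proof.
  apply (PR_graph 1 (fun y a => exists z, z < S (hd 0 a) /\ (y + z) * S (y + z) / 2 + z = hd 0 a)).
  - intros a y. cbn [get]. split.
    + intros [z [_ Hz]]. fold (npair y z) in Hz. rewrite <- Hz. symmetry. apply pf_npair.
    + intros ->. exists (ps (hd 0 a)). split; [pose proof (ps_le (hd 0 a)); lia|].
      apply npair_pfps.
  - pr.
Qed.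
Lemma F1_ps : F1 ps.
Proof.
  apply (PR_graph 1 (fun y a => exists z, z < S (hd 0 a) /\ (z + y) * S (z + y) / 2 + y = hd 0 a)).
  - intros a y. cbn [get]. split.
    + intros [z [_ Hz]]. fold (npair z y) in Hz. rewrite <- Hz. symmetry. apply ps_npair.
    + intros ->. exists (pf (hd 0 a)). split; [pose proof (pf_le (hd 0 a)); lia|].
      apply npair_pfps.
  - pr.
Qed.

Ltac pr_code := first [ pr_div | match goal with
  | |- PR _ (fun a => npair _ _) => apply (PR_c2 npair _ _ _ F2_npair)
  | |- PR _ (fun a => pf _) => apply (PR_c1 pf _ _ F1_pf)
  | |- PR _ (fun a => ps _) => apply (PR_c1 ps _ _ F1_ps)
  | |- PR _ (fun a => digit _ _ _) => apply (PR_c3 digit _ _ _ _ F3_digit)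
  | |- Dec _ (fun a => bit _ _) => apply (Dec_c2 bit _ _ _ D2_bit)
  end ].
Ltac pr_user ::= pr_code.

Fixpoint ltail (j L : nat) : nat :=
  match j with 0 => L | S j' => ps (ltail j' L - 1) end.
(** Membership in the list coded by [L]. The position is bounded by [L] itself, which is at least
    the length of the list. *)
Definition inlc (x L : nat) : Prop := exists j, j < S L /\ (0 < ltail j L /\ pf (ltail j L - 1) = x).

Lemma F2_ltail : F2 ltail.
Proof.
  apply (PR_prim 1 (fun a => get 0 a) (fun a => ps (get 1 a - 1))); auto; pr.
Qed.
Lemma ltail_enc j l : ltail j (enc_list l) = enc_list (skipn j l).
Proof.
  induction j as [|j IH]; auto. cbn [ltail]. rewrite IH.
  destruct (skipn j l) as [|x l'] eqn:E.
  - replace (skipn (S j) l) with (@nil nat).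
    + cbn [enc_list]. change (0 - 1) with 0. reflexivity.
    + symmetry. apply skipn_all_iff. apply skipn_all_iff in E. lia.
  - assert (Hs : skipn (S j) l = l').
    { change (S j) with (1 + j). rewrite <- skipn_skipn, E. reflexivity. }
    rewrite Hs. cbn [enc_list]. rewrite Nat.sub_succ, Nat.sub_0_r. apply ps_npair.
Qed.
Lemma length_le_enc l : length l <= enc_list l.
Proof.
  induction l as [|x l IH]; [auto|]. cbn [length enc_list].
  pose proof (npair_ge_r x (enc_list l)). lia.
Qed.
Lemma inlc_enc x l : inlc x (enc_list l) <-> In x l.
Proof.
  unfold inlc. split.
  - intros [j [_ [H1 H2]]]. rewrite ltail_enc in *.
    destruct (skipn j l) as [|y l'] eqn:E; [simpl in H1; lia|].
    cbn [enc_list] in H2. rewrite Nat.sub_succ, Nat.sub_0_r, pf_npair in H2. subst y.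
    rewrite <- (firstn_skipn j l), E. apply in_or_app. right. left. auto.
  - intros H. apply in_split in H. destruct H as [l1 [l2 ->]].
    exists (length l1). split.
    + pose proof (length_le_enc (l1 ++ x :: l2)). rewrite length_app in H. simpl in H. simpl. lia.
    + rewrite ltail_enc, skipn_app, skipn_all, Nat.sub_diag. cbn [skipn app enc_list].
      rewrite Nat.sub_succ, Nat.sub_0_r, pf_npair. split; [lia|auto].
Qed.
Lemma in_le_enc x l : In x l -> x < enc_list l.
Proof.
  induction l as [|y l IH]; [contradiction|]. cbn [enc_list].
  pose proof (npair_ge_sum y (enc_list l)). intros [->|H1]; [lia|]. specialize (IH H1). lia.
Qed.

Ltac pr_user ::= first [ pr_code | match goal with
  | |- PR _ (fun a => ltail _ _) => apply (PR_c2 ltail _ _ _ F2_ltail)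
  end ].
Lemma D2_inlc : D2 inlc.
Proof. unfold inlc. pr. Qed.

(* [MB n] is the number of profiles over [n] states, [Kb n] the number of pairs of a token state
   and a state. *)
Definition MB n := 2 ^ (n * 2 * n).
Definition Kb n := S (MB n) ^ (S (MB n) * MB n) * n.

(** * Bounded ranks for games with a co-Büchi condition on nondeterministic runs *)

Module Synthesis.
Import all_boot zify.
Local Set Implicit Arguments.
Local Unset Strict Implicit.
Local Unset Printing Implicit Defensive.

Definition asb (P : Prop) : bool := if excluded_middle_informative P then true else false.

Lemma asbP P : reflect P (asb P).
Proof. by rewrite /asb; case: excluded_middle_informative => h; constructor. Qed.

Definition inf_often (P : nat -> Prop) := forall N, exists2 n, N <= n & P n.

Lemma not_inf_often P : ~ inf_often P -> exists N, forall n, N <= n -> ~ P n.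
Proof.
move=> h; apply: NNPP => h2; apply: h => N; apply: NNPP => h3; apply: h2.
by exists N => n Nn Pn; apply: h3; exists n.
Qed.

Lemma inf_often_pigeon (F : finType) (P : nat -> F -> Prop) :
  inf_often (fun n => exists f, P n f) -> exists f, inf_often (P^~ f).
Proof.
move=> h; apply: NNPP => h2.
have {h2}h3 f : exists N, forall n, N <= n -> ~ P n f.
  by apply: not_inf_often => h3; apply: h2; exists f.
pose N f := proj1_sig (constructive_indefinite_description _ (h3 f)).
have HN f n : N f <= n -> ~ P n f.
  exact: (proj2_sig (constructive_indefinite_description _ (h3 f))).
have [n nN [f Pf]] := h (\max_f N f).
apply: (HN f n _ Pf); apply: leq_trans nN; exact: leq_bigmax.
Qed.

Lemma inf_often_sub (P P' : nat -> Prop) :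
  (forall n, P n -> P' n) -> inf_often P -> inf_often P'.
Proof. by move=> PP' h N; have [n ? /PP' ?] := h N; exists n. Qed.

Lemma eventually_never_below (P : nat -> nat -> Prop) r :
  (forall r', r' < r -> ~ inf_often (P^~ r')) ->
  exists N, forall n r', N <= n -> r' < r -> ~ P n r'.
Proof.
elim: r => [|r IH] hlow; first by exists 0.
have [|N1 h1] := IH; first by move=> r' h; apply: hlow; lia.
have [N2 h2] := not_inf_often (hlow r (ltnSn r)).
exists (maxn N1 N2) => n r'; rewrite geq_max => /andP[l1 l2].
by rewrite ltnS leq_eqVlt => /orP[/eqP->|]; [apply: h2 | apply: h1].
Qed.

Lemma dep_choice (X : Type) (G : X -> Prop) (Rel : X -> X -> Prop) x0 :
  G x0 -> (forall x, G x -> exists2 y, G y & Rel x y) ->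
  exists f : nat -> X, [/\ f 0 = x0, forall n, G (f n) & forall n, Rel (f n) (f n.+1)].
Proof.
move=> G0 h.
have h' (x : {x | G x}) : exists y : {x | G x}, Rel (sval x) (sval y).
  by case: x => x Gx /=; have [y Gy Rxy] := h x Gx; exists (exist _ y Gy).
pose nx x := proj1_sig (constructive_indefinite_description _ (h' x)).
pose f n := iter n nx (exist _ x0 G0).
exists (fun n => sval (f n)); split => // n; first by case: (f n).
exact: (proj2_sig (constructive_indefinite_description _ (h' (f n)))).
Qed.

Lemma classical_min (P : nat -> Prop) n :
  P n -> exists m, P m /\ forall j, j < m -> ~ P j.
Proof.
elim/ltn_ind: n => n IH Pn.
case: (classic (exists2 j, j < n & P j)) => [[j jn Pj]|h]; first exact: IH jn Pj.
by exists n; split=> // j jn Pj; apply: h; exists j.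
Qed.

(** * Counting marked edges in a finite graph *)

Section GraphRank.
Variables (V : finType) (L : Type) (edge : V -> L -> V -> Prop) (mk : L -> bool).

Inductive pc : V -> nat -> Prop :=
| pc0 v : pc v 0
| pcS v l v' c : edge v l v' -> pc v' c -> pc v (mk l + c).

Definition infp v := exists (f : nat -> V) (g : nat -> L),
  [/\ f 0 = v, forall i, edge (f i) (g i) (f i.+1) & inf_often (fun i => mk (g i))].

Lemma pc_fun v c (l0 : L) : pc v c -> exists n (f : nat -> V) (g : nat -> L),
  [/\ f 0 = v, forall i, i < n -> edge (f i) (g i) (f i.+1)
    & \sum_(i < n) mk (g i) = c].
Proof.
elim=> {v c} [v|v l v' c e _ [n [f [g [f0 fe sm]]]]].
  by exists 0, (fun _ => v), (fun _ => l0); split=> //; rewrite big_ord0.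
exists n.+1, (fun i => if i is j.+1 then f j else v), (fun i => if i is j.+1 then g j else l).
split=> //; first by case=> [_|i]; [rewrite f0 | exact: fe].
by rewrite big_ord_recl /= sm.
Qed.

(** Pigeonhole on the sources of the marked edges: two of them coincide, and the loop between them,
    which begins with a marked edge, is repeated for ever. *)
Lemma pc_inf v c : #|V| < c -> pc v c -> infp v.
Proof.
move=> hc h.
have [l0 _] : exists l : L, True.
  by case: h hc => // ? l *; exists l.
have [n [f [g [f0 fe sm]]]] := pc_fun l0 h.
pose I := [seq i <- iota 0 n | mk (g i)].
have szI : size I = c.
  rewrite /I size_filter -sm -sum1_count big_mkcond /= -{1}(subn0 n) -/(index_iota 0 n) big_mkord.
  by apply: eq_bigr => i _; case: (mk _).
have : ~~ uniq (map f I).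
  apply/negP => /card_uniqP eqs; have := max_card (mem (map f I)).
  by rewrite eqs size_map szI leqNgt hc.
case/(uniqPn v) => i [j [ij]]; rewrite size_map => js.
have isz := ltn_trans ij js.
rewrite !(nth_map 0) //; set a := nth 0 I i; set b := nth 0 I j => fab.
have sI : sorted ltn I by apply: sorted_filter; [exact: ltn_trans | exact: iota_ltn_sorted].
have ab : a < b by rewrite (sorted_ltn_nth ltn_trans).
have bn : b < n by have := mem_nth 0 js; rewrite mem_filter mem_iota => /andP[_ /andP[]].
have ma : mk (g a) by have := mem_nth 0 isz; rewrite mem_filter => /andP[].
have ba : 0 < b - a by rewrite subn_gt0.
(* Positions below [b] are read as they are; later ones run periodically through the loop from [a]
   to [b - 1]. *)
pose idx m := if m < b then m else a + (m - a) %% (b - a).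
have idxb m : idx m < b.
  rewrite /idx; case: ifP => // _; rewrite -ltn_subRL; exact: ltn_pmod.
have idxS m : f (idx m.+1) = f (idx m).+1.
  rewrite /idx; case: (ltnP m.+1 b) => h1; first by rewrite (ltnW h1).
  case: (ltnP m b) => h2.
    have -> : m.+1 = b by apply/eqP; rewrite eqn_leq h1 h2.
    by rewrite modnn addn0.
  have am : a <= m by apply: leq_trans (ltnW ab) h2.
  rewrite subSn // modnS.
  case: ifP => [dv|_]; last by rewrite addnS.
  have -> : (a + (m - a) %% (b - a)).+1 = b; last by rewrite addn0.
  have : (m - a) %% (b - a) = (b - a).-1.
    have := divn_eq (m - a) (b - a); set qq := _ %/ _; set rr := _ %% _ => E.
    move: dv; rewrite E -addnS dvdn_addr ?dvdn_mull // => dv.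
    have rlt : rr < b - a by rewrite ltn_pmod.
    by have := dvdn_leq (ltn0Sn _) dv; lia.
  by move->; rewrite -addnS prednK // subnKC // ltnW.
exists (f \o idx), (g \o idx); split=> /=.
- by rewrite /idx (leq_ltn_trans _ ab).
- by move=> m; rewrite idxS; apply: fe; apply: ltn_trans (idxb _) bn.
(* This number is [a + (2 * N + b) * (b - a)]: at least [N], and congruent to [a] modulo the period,
   so it is read as [a], whose edge is marked. *)
- move=> N; exists (b + (b - a) * N + (N * (b-a) + (a + b*(b-a) - b))) => //.
    by rewrite -addnA -addnCA; apply: leq_trans (leq_addr _ _); rewrite leq_pmull.
  suff -> : idx (b + (b - a) * N + (N * (b - a) + (a + b * (b - a) - b))) = a by [].
  have bb : b <= b * (b - a) by rewrite leq_pmulr.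
  rewrite /idx ltnNge -addnA leq_addr /=.
  have -> : b + ((b - a) * N + (N * (b - a) + (a + b * (b - a) - b))) - a
     = (N + N + b) * (b - a).
    rewrite [(b-a) * N]mulnC addnCA [b + _]addnCA subnKC; last first.
      by apply: leq_trans bb _; rewrite leq_addl.
    by rewrite !mulnDl -!addnA [_ + (a + _)]addnCA [_ + (a + _)]addnCA addKn.
  by rewrite modnMl addn0.
Qed.

(** The rank is the supremum of the number of marks on finite paths, cut off at [#|V|.+1], which
    plays the role of infinity: by [pc_inf], more than [#|V|] marks already give an infinite path
    with infinitely many. The last clause, monotonicity in the outgoing edges, will take care of
    silent steps. *)
Lemma graph_rank : exists rk : V -> nat,
  [/\ forall v, rk v <= #|V|.+1,
      forall v l v', edge v l v' -> rk v <= #|V| -> rk v' + mk l <= rk v,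
      forall v, ~ infp v -> rk v <= #|V|
    & forall v v', (forall l w, edge v' l w -> edge v l w) -> rk v' <= rk v].
Proof.
(* At least [c] marks rather than exactly [c], so that a path with more marks than the cap witnesses
   the cap itself. *)
pose P v c := exists2 c', c <= c' & pc v c'.
have P0 v : exists c, asb (P v c) && (c <= #|V|.+1).
  by exists 0; rewrite andbT; apply/asbP; exists 0 => //; constructor.
have ub v c : asb (P v c) && (c <= #|V|.+1) -> c <= #|V|.+1 by case/andP.
pose rk v := ex_maxn (P0 v) (ub v).
have rkP v : P v (rk v) /\ rk v <= #|V|.+1.
  by rewrite /rk; case: ex_maxnP => i /andP[/asbP].
have rkM v c : P v c -> c <= #|V|.+1 -> c <= rk v.
  move=> Pc cl; rewrite /rk; case: ex_maxnP => i _; apply; rewrite cl andbT; exact/asbP.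
exists rk; split.
- by move=> v; case: (rkP v).
- move=> v l v' e rl; have [[c' h1 h2] h3] := rkP v'.
  have Pv : P v (mk l + rk v') by exists (mk l + c'); [rewrite leq_add2l | apply: pcS e h2].
  rewrite addnC; apply: (rkM) => //.
  rewrite leqNgt; apply/negP => h4.
  have : #|V|.+1 <= rk v.
    by apply: rkM => //; case: Pv => c'' h5 h6; exists c'' => //; apply: leq_trans h5; apply: ltnW.
  by rewrite leqNgt ltnS rl.
- move=> v h; rewrite leqNgt; apply/negP => h1; apply: h.
  have [[c' h2 h3] _] := rkP v; apply: pc_inf h3; exact: leq_trans h2.
- move=> v v' h; have [[c' h1 h2] h3] := rkP v'; apply: rkM => //; exists c' => //.
  by case: h2 h => [w _|w l w' c e h2 h]; [constructor | apply: pcS (h _ _ e) h2].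
Qed.

End GraphRank.

(** * Profiles of factors and the deterministic token automaton *)

Section Tokens.
Variables (Q A : finType) (tr : A -> Q -> bool -> Q -> Prop) (init : Q -> Prop).

Notation M := {ffun Q * bool * Q -> bool}.

(** Elements of [M] are profiles: sets of triples of a start state, whether a marked step occurs,
    and an end state. They form a finite monoid, [mone] belonging to the empty word and [mmul] to
    concatenation. *)
Definition mone : M := [ffun p => (p.1.1 == p.2) && ~~ p.1.2].
Definition mmul (x y : M) : M :=
  [ffun p => [exists z : Q * bool * bool,
    [&& x (p.1.1, z.1.2, z.1.1), y (z.1.1, z.2, p.2) & p.1.2 == z.1.2 || z.2]]].
Definition prf (a : A) : M := [ffun p => asb (tr a p.1.1 p.1.2 p.2)].

Lemma mmulP (x y : M) q b q' : reflect
  (exists p b1 b2, [/\ x (q, b1, p), y (p, b2, q') & b = b1 || b2]) (mmul x y (q, b, q')).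
Proof.
rewrite ffunE /=; apply: (iffP existsP).
  by case=> [[[p b1] b2]] /= /and3P[h1 h2 /eqP h3]; exists p, b1, b2.
by case=> p [b1 [b2 [h1 h2 ->]]]; exists (p, b1, b2); rewrite /= h1 h2 eqxx.
Qed.

Lemma mmulA x y z : mmul x (mmul y z) = mmul (mmul x y) z.
Proof.
apply/ffunP => -[[q b] q']; apply/mmulP/mmulP.
  case=> p [b1 [b2 [h1 /mmulP[p' [b3 [b4 [h2 h3 ->]]]] ->]]].
  by exists p', (b1 || b3), b4; split=> //; [apply/mmulP; exists p, b1, b3 | rewrite orbA].
case=> p [b1 [b2 [/mmulP[p' [b3 [b4 [h2 h3 ->]]]] h1 ->]]].
by exists p', b3, (b4 || b2); split=> //; [apply/mmulP; exists p, b4, b2 | rewrite orbA].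
Qed.

Lemma mmul1 x : mmul x mone = x.
Proof.
apply/ffunP => -[[q b] q']; apply/mmulP/idP.
  case=> p [b1 [b2 [h1]]]; rewrite ffunE /= => /andP[/eqP<- /negbTE->] ->.
  by rewrite orbF.
by move=> h; exists q', b, false; split=> //; rewrite ?orbF // ffunE /= eqxx.
Qed.

Fixpoint phl (al : nat -> A) (i l : nat) : M :=
  if l is l'.+1 then mmul (phl al i l') (prf (al (i + l'))) else mone.
Definition ph al i j := phl al i (j - i).

Lemma ph_id al i : ph al i i = mone. Proof. by rewrite /ph subnn. Qed.

Lemma phS al i j : i <= j -> ph al i j.+1 = mmul (ph al i j) (prf (al j)).
Proof. by move=> ij; rewrite /ph subSn //= subnKC. Qed.

Lemma ph_cat al i j l : i <= j -> j <= l -> mmul (ph al i j) (ph al j l) = ph al i l.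
Proof.
move=> ij; elim: l => [|l IH]; first by move=> j0; have -> : j = 0; rewrite ?ph_id ?mmul1 //; lia.
rewrite leq_eqVlt => /orP[/eqP<-|jl]; first by rewrite ph_id mmul1.
by rewrite !phS ?mmulA ?IH //; lia.
Qed.

Lemma ph_ext al be i j : (forall l, l < j -> al l = be l) -> ph al i j = ph be i j.
Proof.
elim: j => [|j IH] h; first by rewrite /ph.
case: (leqP i j) => ij; last by rewrite /ph (_ : j.+1 - i = 0) //; lia.
by rewrite !phS // IH ?h // => l lj; apply: h; lia.
Qed.

(* Positions of a word with equal suffix profiles stay so for ever; [pos al n x] is the oldest
   position whose suffix has profile [x], and it is [n.+1] if there is none. *)
Definition pos al n x := find (fun i => ph al i n == x) (iota 0 n.+1).

Lemma pos_ph al n x : pos al n x <= n -> ph al (pos al n x) n = x.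
Proof.
rewrite -ltnS => h.
have hs : has (fun i => ph al i n == x) (iota 0 n.+1) by rewrite has_find size_iota.
by have := nth_find 0 hs; rewrite nth_iota // add0n => /eqP.
Qed.

Lemma pos_le al n x i : i <= n -> ph al i n = x -> pos al n x <= i.
Proof.
move=> i_n h; rewrite leqNgt; apply/negP => h1.
by have := before_find 0 h1; rewrite nth_iota ?add0n ?h ?eqxx.
Qed.

Definition tok al n i := pos al n (ph al i n) == i.

Definition Tok := {ffun option M * M -> option M}.

(* The finite information about the tokens that determines its own update: their order and the
   profiles between them, the row [None] standing for position 0. *)
Definition tau al n : Tok := [ffun p =>
  let px := if p.1 is Some x then pos al n x else 0 in
  if px <= pos al n p.2 <= n then Some (ph al px (pos al n p.2)) else None].

Definition alive (t : Tok) x : bool := t (None, x).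
Definition tle (t : Tok) x y : bool := t (Some x, y).
(** The number of older tokens. Slots serve as priorities of the deterministic automaton, older
    tokens being more important. *)
Definition slot (t : Tok) x := #|[set y | tle t y x && (y != x)]|.
(** [x] is the oldest among the tokens that reading [a] sends to the same profile, hence the one
    that survives the merge. *)
Definition best (t : Tok) a x :=
  alive t x && [forall y, (alive t y && (mmul y (prf a) == mmul x (prf a))) ==> tle t x y].

Lemma aliveE al n x : alive (tau al n) x = (pos al n x <= n).
Proof. by rewrite /alive ffunE /=; case: ifP. Qed.

Lemma tleE al n x y : tle (tau al n) x y = (pos al n x <= pos al n y <= n).
Proof. by rewrite /tle ffunE /=; case: ifP. Qed.

Lemma bestP al n x : reflect
  (pos al n x <= n /\ forall i, i <= n -> ph al i n.+1 = mmul x (prf (al n)) -> pos al n x <= i)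
  (best (tau al n) (al n) x).
Proof.
rewrite /best aliveE; apply: (iffP andP) => -[h1 h2]; split=> //.
  move=> i i_n e; have /implyP := forallP h2 (ph al i n).
  have pi : pos al n (ph al i n) <= i by apply: pos_le.
  rewrite aliveE tleE (leq_trans pi) // -phS // e eqxx => /(_ isT) /andP[h3 _].
  exact: leq_trans h3 pi.
apply/forallP => y; apply/implyP; rewrite aliveE tleE => /andP[h3 /eqP h4].
by rewrite h3 andbT; apply: h2 => //; rewrite phS // pos_ph.
Qed.

Lemma pos_best al n x : best (tau al n) (al n) x ->
  pos al n.+1 (mmul x (prf (al n))) = pos al n x.
Proof.
case/bestP => h1 h2; apply/eqP; rewrite eqn_leq.
have h3 : pos al n.+1 (mmul x (prf (al n))) <= pos al n x.
  by apply: pos_le; [lia | rewrite phS // pos_ph].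
by rewrite h3 h2 ?pos_ph //; lia.
Qed.

(** A token that exists after a letter existed before it and won its merge: an older position with
    the same profile, before or after the letter, would still be in the class and replace it. *)
Lemma pos_old al n i : i <= n -> pos al n.+1 (ph al i n.+1) = i ->
  best (tau al n) (al n) (ph al i n) /\ pos al n (ph al i n) = i.
Proof.
move=> i_n h.
have pi : pos al n (ph al i n) <= i by apply: pos_le.
have pe : pos al n (ph al i n) = i.
  apply/eqP; rewrite eqn_leq pi -{1}h; apply: pos_le; first by lia.
  by rewrite !phS ?pos_ph //; lia.
split=> //; apply/bestP; rewrite pe; split=> // j jn.
rewrite -phS // => e; have := @pos_le al n.+1 (ph al i n.+1) j; rewrite h; apply=> //; lia.
Qed.

(** Where the token with profile [y] after reading [a] comes from: [Some (Some x)] means the token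
    that had profile [x], [Some None] the position just created, and [None] that there is no such
    token. *)
Definition src (t : Tok) a y : option (option M) :=
  if [pick x | best t a x && (mmul x (prf a) == y)] is Some x then Some (Some x)
  else if y == mone then Some None else None.

Lemma srcP al n y : match src (tau al n) (al n) y with
  | Some (Some x) => [/\ best (tau al n) (al n) x, pos al n x <= n, mmul x (prf (al n)) = y
                       & pos al n.+1 y = pos al n x]
  | Some None => y = mone /\ pos al n.+1 y = n.+1
  | None => n.+1 < pos al n.+1 y end.
Proof.
rewrite /src; case: pickP => [x /andP[h1 /eqP h2]|h].
  by split=> //; [case/bestP: h1 | rewrite -h2 pos_best].
have nle : n < pos al n.+1 y.
  rewrite ltnNge; apply/negP => pn; set i := pos _ _ _ in pn.
  have pin : ph al i n.+1 = y by apply: pos_ph; lia.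
  have [|h1 h2] := @pos_old al n i pn; first by rewrite pin.
  by have := h (ph al i n); rewrite h1 /= -phS // pin eqxx.
case: eqP => [e|ne].
  split=> //; apply/eqP; rewrite eqn_leq nle andbT; apply: pos_le => //.
  by rewrite ph_id.
rewrite ltn_neqAle nle andbT; apply/eqP => e; apply: ne.
have := @pos_ph al n.+1 y; rewrite -e ph_id => <- //.
Qed.

Definition upd (t : Tok) a : Tok := [ffun p =>
  match src t a p.2 with
  | None => None
  | Some (Some x2) => match p.1 with
     | None => t (None, x2)
     | Some y1 => if src t a y1 is Some (Some x1) then t (Some x1, x2) else None end
  | Some None => match p.1 with
     | None => if t (None, mone) is Some s then Some (mmul s (prf a)) else None
     | Some y1 => match src t a y1 with
         | Some (Some _) => Some y1 | Some None => Some mone | None => None end end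
  end].

(** A new entry either is an old one or ends at the new position. In the latter case the profile
    since an older token is the very label of that token, so nothing outside the state is needed. *)
Lemma tau_S al n : tau al n.+1 = upd (tau al n) (al n).
Proof.
apply/ffunP => -[ox y]; rewrite [RHS]ffunE ffunE /=.
have := srcP al n y; case: (src _ _ y) => [[x2|]|].
- case=> b2 l2 e2 p2; rewrite p2; case: ox => [y1|].
    have := srcP al n y1; case: (src _ _ y1) => [[x1|]|].
    + case=> b1 l1 e1 p1; rewrite p1 ffunE /= l2 !andbT (leq_trans l2) //.
      by rewrite andbT.
    + by case=> _ ->; rewrite (_ : _ <= _ = false) //; lia.
    + by move=> h; rewrite (_ : _ <= pos al n x2 = false) //; lia.
  by rewrite ffunE /= l2 (leq_trans l2).
- case=> -> ->; rewrite leqnn andbT; case: ox => [y1|].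
    have := srcP al n y1; case: (src _ _ y1) => [[x1|]|].
    + case=> b1 l1 e1 p1; rewrite p1 (leq_trans l1) // phS // pos_ph // e1 //.
    + by case=> -> ->; rewrite leqnn ph_id.
    + by move=> h; rewrite leqNgt h.
  (* Position [n] has the empty suffix, so there is a token with profile [mone], and the profile up
     to it is that of the whole word read so far. *)
  have pm : pos al n mone <= n by apply: pos_le => //; rewrite ph_id.
  by rewrite ffunE /= pm phS // -(@ph_cat al 0 (pos al n mone) n) // (pos_ph pm) mmul1.
- by move=> h; rewrite [X in _ && X]leqNgt h andbF.
Qed.

Lemma tau0 al be : tau al 0 = tau be 0.
Proof.
have e x : pos al 0 x = pos be 0 x by rewrite /pos /=.
apply/ffunP => -[ox y]; rewrite !ffunE /=.
have -> : (if ox is Some x then pos al 0 x else 0) = (if ox is Some x then pos be 0 x else 0).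
  by case: ox => // x; rewrite e.
rewrite e; case: ifP => // /andP[h1 h2].
have -> : pos be 0 y = 0 by lia.
by rewrite (@ph_ext al be).
Qed.

Definition rkp al n i := count (tok al n) (iota 0 i).

Lemma rkpS al n i : rkp al n i.+1 = rkp al n i + tok al n i.
Proof. by rewrite /rkp -[i.+1]addn1 iotaD count_cat /= addn0. Qed.

Lemma rkp_mono al n i j : i <= j -> rkp al n i <= rkp al n j.
Proof. by move=> ij; rewrite -(subnKC ij) /rkp iotaD count_cat leq_addr. Qed.

Lemma rkp_lt al n i j : i < j -> tok al n i -> rkp al n i < rkp al n j.
Proof. by move=> ij ti; apply: leq_trans (rkp_mono al n ij); rewrite rkpS ti addn1. Qed.

Lemma tok_pos al n x : pos al n x <= n -> tok al n (pos al n x).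
Proof. by move=> h; rewrite /tok pos_ph. Qed.

Lemma slotE al n x : pos al n x <= n -> slot (tau al n) x = rkp al n (pos al n x).
Proof.
move=> px; rewrite /slot /rkp -size_filter cardE -(size_map (pos al n)).
apply: perm_size; apply: uniq_perm.
- rewrite map_inj_in_uniq ?enum_uniq // => y z.
  rewrite !mem_enum !inE !tleE => /andP[/andP[h1 h2] _] /andP[/andP[h3 h4] _] e.
  by rewrite -(@pos_ph al n y) ?(leq_trans h1) // e pos_ph // (leq_trans h3).
- by rewrite filter_uniq // iota_uniq.
- move=> i; rewrite mem_filter mem_iota /= add0n; apply/mapP/andP.
    case=> y; rewrite mem_enum inE tleE => /andP[/andP[h1 h2] h3] ->.
    split; first by apply: tok_pos; lia.
    rewrite ltn_neqAle h1 andbT; apply/eqP => e; case/eqP: h3.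
    by rewrite -(pos_ph px) -e pos_ph //; lia.
  case=> ti il; exists (ph al i n); last by rewrite (eqP ti).
  rewrite mem_enum inE tleE (eqP ti) ltnW // px /=.
  by apply/eqP => e; move: il; rewrite -e (eqP ti) ltnn.
Qed.

(* [evt t a r e s]: reading [a], some younger token merges into the token of slot [r];
   [s] is the profile up to that token and [e] the profile between the two tokens. *)
Definition evt (t : Tok) a r (e s : M) := exists x,
  [/\ best t a x, slot t x = r, t (None, x) = Some s
    & (exists y, [/\ alive t y, y != x, mmul y (prf a) = mmul x (prf a) & t (Some x, y) = Some e])
      \/ (mmul x (prf a) = mone /\ e = mone)].
Definition hasev t a r := exists e s, evt t a r e s.

(** Acceptance for a word cut into [s] and infinitely many blocks [e]: a run from an initial state
    reaches [q], and each block can be crossed from [q] to [q] with a mark. *)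
Definition Acc (s e : M) :=
  exists q0 b q, [/\ init q0, mmul s e (q0, b, q) & e (q, true, q)].
Definition accev t a r := exists e s, evt t a r e s /\ Acc s e.

Lemma evt_pos al n r e s : evt (tau al n) (al n) r e s -> exists i j,
  [/\ i <= n, tok al n i, rkp al n i = r & s = ph al 0 i] /\
  [/\ i < j <= n.+1, e = ph al i j, ph al i n.+1 = ph al j n.+1,
      ~~ tok al n.+1 j & j <= n -> tok al n j].
Proof.
case=> x [hb sl]; have /bestP[px bx] := hb.
rewrite ffunE /= px /= => -[<-] h; rewrite slotE // in sl.
case: h => [[y [ay yx ey]]|[e1 ->]].
  rewrite ffunE /=; rewrite aliveE in ay; rewrite ay andbT; case: ifP => // le [<-].
  have ne : pos al n x != pos al n y.
    by apply: contra yx => /eqP ee; rewrite -(pos_ph ay) -ee pos_ph.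
  have eS : ph al (pos al n x) n.+1 = ph al (pos al n y) n.+1 by rewrite !phS // !pos_ph.
  exists (pos al n x), (pos al n y); split; split=> //; rewrite ?tok_pos //; first by lia.
  by apply/eqP => h; have := @pos_le al n.+1 _ (pos al n x) ltac:(lia) eS; rewrite h; lia.
have eS : ph al (pos al n x) n.+1 = mone by rewrite phS // pos_ph.
exists (pos al n x), n.+1; split; split=> //; rewrite ?tok_pos ?ph_id //; try lia.
apply/eqP; rewrite ph_id => h.
by have := @pos_le al n.+1 _ (pos al n x) ltac:(lia) eS; rewrite h; lia.
Qed.

Lemma tok_merge al n i j : j <= n.+1 -> i < j -> tok al n i ->
  (j <= n -> tok al n j) -> tok al n.+1 i -> ph al j n.+1 = ph al i n.+1 ->
  hasev (tau al n) (al n) (rkp al n i).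
Proof.
move=> jn ij ti tj tSi e.
have i_n : i <= n by lia.
have [hb pe] := pos_old i_n (eqP tSi).
have pn : pos al n (ph al i n) <= n by rewrite pe.
case: (leqP j n) => jn'.
  exists (ph al i j), (ph al 0 i), (ph al i n); split=> //.
  - by rewrite slotE // pe.
  - by rewrite ffunE /= pe i_n.
  - left; exists (ph al j n); have pj := eqP (tj jn').
    split; rewrite ?aliveE ?pj //.
    + by apply/eqP => ee; move: pj; rewrite ee pe; lia.
    + by rewrite -!phS.
    + by rewrite ffunE /= pe pj (ltnW ij) jn'.
have jE : j = n.+1 by lia.
exists mone, (ph al 0 i), (ph al i n); split=> //.
- by rewrite slotE // pe.
- by rewrite ffunE /= pe i_n.
- by right; split=> //; rewrite -phS // -e jE ph_id.
Qed.

Lemma tok_anti al n i : i <= n -> tok al n.+1 i -> tok al n i.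
Proof. by move=> i_n /eqP h; have [_ h2] := pos_old i_n h; apply/eqP. Qed.

Lemma tok_anti_ge al n m i : i <= n -> n <= m -> tok al m i -> tok al n i.
Proof.
move=> i_n /subnKC <-; elim: (m - n) => [|d IH]; first by rewrite addn0.
by rewrite addnS => h; apply/IH/tok_anti => //; lia.
Qed.

(** A token dies only by merging into an older one, and this causes an event at the slot of the
    older one, which is strictly lower. *)
Lemma tok_surv al n i r : i <= n -> tok al n i -> rkp al n i <= r ->
  (forall r', r' < r -> ~ hasev (tau al n) (al n) r') -> tok al n.+1 i.
Proof.
move=> i_n ti rr noev; apply: contraT => nt.
have pl : pos al n.+1 (ph al i n.+1) <= i by apply: pos_le => //; lia.
set i' := pos al n.+1 (ph al i n.+1) in pl.
have li : i' < i by rewrite ltn_neqAle pl andbT; apply: contra nt.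
have pi' : ph al i' n.+1 = ph al i n.+1 by apply: pos_ph; lia.
have ti' : tok al n.+1 i' by rewrite /tok pi'.
have tn : tok al n i' by apply: tok_anti ti'; lia.
case: (noev (rkp al n i')); first by apply: leq_trans rr; apply: rkp_lt.
by apply: (@tok_merge al n i' i) => //; lia.
Qed.

Lemma rkp_const al n i r : i <= n -> tok al n i -> rkp al n i <= r ->
  (forall r', r' < r -> ~ hasev (tau al n) (al n) r') -> rkp al n.+1 i = rkp al n i.
Proof.
move=> i_n ti rr noev; apply: eq_in_count => j; rewrite mem_iota add0n /= => ji.
apply/idP/idP => h; first by apply: tok_anti h; lia.
apply: (@tok_surv _ _ _ r) => //; first by lia.
by apply: leq_trans rr; apply: rkp_mono; lia.
Qed.

Lemma rkp_bound al n i : i <= n.+1 -> rkp al n i <= #|{: M}|.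
Proof.
move=> i_n; rewrite /rkp -size_filter -(size_map (fun j => ph al j n)).
set s := map _ _; have us : uniq s.
  rewrite map_inj_in_uniq ?filter_uniq ?iota_uniq // => j l.
  rewrite !mem_filter => /andP[/eqP h1 _] /andP[/eqP h2 _] e.
  by rewrite -h1 e h2.
by rewrite -(card_uniqP us) max_card.
Qed.

(** * Limit behaviour of tokens along an infinite word *)

Section Limit.
Variable al : nat -> A.
Notation ev n r := (hasev (tau al n) (al n) r).

(** Without events from some time on, every later position would remain a token. But tokens have
    distinct profiles, so there are at most as many of them as profiles. *)
Lemma some_slot_inf : exists r, inf_often (fun n => ev n r).
Proof.
have [|r h] := @inf_often_pigeon 'I_(#|{: M}|.+1) (fun n r => ev n r); last by exists r.
move=> N; apply: NNPP => h.
have noev n r : N <= n -> ~ ev n r.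
  move=> Nn hr; apply: h; exists n => //.
  have hl : r < #|{: M}|.+1.
    case: hr => e [s] /evt_pos [i [j [[i_n _ <- _] _]]]; rewrite ltnS; apply: rkp_bound; lia.
  by exists (Ordinal hl).
have all_tok d : forall j, N < j <= N + d -> tok al (N + d) j.
  elim: d => [|d IH] j; first by lia.
  rewrite addnS => /andP[h1]; rewrite leq_eqVlt => /orP[/eqP->|h2]; last first.
    apply: (@tok_surv _ _ _ (rkp al (N+d) j)) => //; first by apply: IH; lia.
    by move=> r' _; apply: noev; lia.
  apply: contraT => nt.
  have pl : pos al (N + d).+1 (ph al (N + d).+1 (N + d).+1) <= (N + d).+1 by apply: pos_le.
  set i := pos _ _ _ in pl.
  have li : i < (N+d).+1 by rewrite ltn_neqAle pl andbT.
  have pi : ph al i (N+d).+1 = ph al (N+d).+1 (N+d).+1 by apply: pos_ph.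
  have ti : tok al (N+d).+1 i by rewrite /tok pi.
  case: (@noev (N+d) (rkp al (N+d) i)); first by lia.
  apply: (@tok_merge al (N+d) i (N+d).+1) => //; try by lia.
  by apply: tok_anti ti.
pose d := #|{: M}|.+1.
have := @rkp_bound al (N + d) (N + d).+1 (leqnn _).
rewrite /rkp -add1n addnA iotaD count_cat => hb.
have : size (iota (0 + (1 + N)) d) <= #|{: M}|.
  have : all (tok al (N+d)) (iota (0 + (1+N)) d).
    by apply/allP => j; rewrite mem_iota => hj; apply: all_tok; lia.
  by rewrite all_count => /eqP <-; apply: leq_trans hb; rewrite leq_addl.
by rewrite size_iota /d ltnn.
Qed.

Definition merged i j := i < j /\ exists2 n, j <= n & ph al i n = ph al j n.

(** Once the lower slots are quiet, the token at slot [r] is one fixed position [i]. By pigeonhole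
    infinitely many of its events share one [e], and the merging positions are unbounded because a
    position ceases to be a token only once. *)
Lemma events_at_slot r (P : M -> M -> Prop) :
  (forall r', r' < r -> ~ inf_often (fun n => ev n r')) ->
  inf_often (fun n => exists e s, evt (tau al n) (al n) r e s /\ P e s) ->
  exists i e, [/\ P e (ph al 0 i), inf_often (fun n => evt (tau al n) (al n) r e (ph al 0 i))
    & inf_often (fun j => merged i j /\ ph al i j = e)].
Proof.
move=> hlow hinf.
have [N noev] := @eventually_never_below (fun n r => ev n r) r hlow.
have [N1 NN1 [e0 [s0 [/evt_pos[i [_ [[iN1 ti ri _] _]]] _]]]] := hinf N.
have stay n : N1 <= n -> tok al n i /\ rkp al n i = r.
  move/subnKC <-; elim: (n - N1) => [|d [IH1 IH2]]; first by rewrite addn0.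
  have ne r' : r' < r -> ~ ev (N1 + d) r' by apply: noev; lia.
  rewrite addnS; split; first by apply: (@tok_surv _ _ _ r) => //; [lia | rewrite IH2].
  by rewrite (@rkp_const _ _ _ r) //; [lia | rewrite IH2].
have evi n e s : N1 <= n -> evt (tau al n) (al n) r e s -> s = ph al 0 i /\ exists j,
    [/\ i < j <= n.+1, e = ph al i j, ph al i n.+1 = ph al j n.+1,
      ~~ tok al n.+1 j & j <= n -> tok al n j].
  move=> nn /evt_pos [i' [j [[h1 h2 h3 h4] h5]]].
  have [h6 h7] := stay n nn.
  have ii : i' = i.
    case: (ltngtP i i') => // l; first by have := rkp_lt l h6; rewrite h7 h3 ltnn.
    by have := rkp_lt l h2; rewrite h7 h3 ltnn.
  by rewrite -ii; split=> //; exists j.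
have [e] : exists e, inf_often (fun n => evt (tau al n) (al n) r e (ph al 0 i) /\ P e (ph al 0 i)).
  apply: inf_often_pigeon => n0; have [n h1 [e [s [h2 h3]]]] := hinf (maxn n0 N1).
  exists n; first by lia.
  have [es _] := evi n e s ltac:(lia) h2.
  by rewrite -es; exists e.
move=> he; exists i, e; split.
- by have [n _ []] := he 0.
- by apply: inf_often_sub he => n [].
move=> B.
(* From [N2] on none of the finitely many positions below [B] ceases to be a token, so a later event
   concerns a position that is at least [B]. *)
have [N2 h2] : exists N2, forall n j, N2 <= n -> j < B -> tok al n j -> tok al n.+1 j.
  elim: B => [|B [N2 h2]]; first by exists 0.
  case: (classic (exists2 n, N2 + B <= n & ~~ tok al n.+1 B)) => [[n h3 h4]|h3].
    exists n.+1 => m j h5; rewrite ltnS leq_eqVlt => /orP[/eqP->|jB] tm; last by apply: h2 => //; lia.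
    case/negP: h4; apply: tok_anti_ge tm; lia.
  exists (N2 + B) => m j h5; rewrite ltnS leq_eqVlt => /orP[/eqP->|jB] tm; last by apply: h2 => //; lia.
  by apply: contraT => h6; case: h3; exists m.
have [n hn [h3 _]] := he (maxn B (maxn N1 N2)).
have [_ [j [h4 h5 h6 h7 h8]]] := evi n _ _ ltac:(lia) h3.
exists j.
  rewrite leqNgt; apply/negP => jB; case/negP: h7; apply: h2 => //; first by lia.
  by apply: h8; lia.
by split=> //; split; [lia | exists n.+1; [lia|]].
Qed.

Lemma merged_ph i j n l : ph al i n = ph al j n -> i <= n -> j <= n -> n <= l -> ph al i l = ph al j l.
Proof. by move=> e h1 h2 h3; rewrite -(@ph_cat al i n l) // e ph_cat. Qed.

Lemma run_ph (q : nat -> Q) (b : nat -> bool) i j :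
  (forall n, tr (al n) (q n) (b n) (q n.+1)) -> i <= j ->
  ph al i j (q i, has b (iota i (j - i)), q j).
Proof.
move=> h /subnKC <-; rewrite addKn; elim: (j - i) => [|d IH].
  by rewrite addn0 ph_id ffunE /= eqxx.
rewrite addnS phS ?leq_addr //; apply/mmulP.
exists (q (i + d)), (has b (iota i d)), (b (i + d)); split=> //.
  by rewrite ffunE /=; apply/asbP.
by rewrite -[d.+1]addn1 iotaD has_cat /= orbF.
Qed.

(* If an infinite set of positions merges with [i] at distance [e], the profile between two of
   them that are far enough apart is again [e]. *)
Lemma det_accepts (q : nat -> Q) (b : nat -> bool) :
  init (q 0) -> (forall n, tr (al n) (q n) (b n) (q n.+1)) -> inf_often b ->
  exists r, inf_often (fun n => accev (tau al n) (al n) r) /\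
            forall r', r' < r -> ~ inf_often (fun n => ev n r').
Proof.
move=> q0 run hb.
have [r0 hr0] := some_slot_inf.
have [r [hr hlow]] := @classical_min (fun r => inf_often (fun n => ev n r)) r0 hr0.
have hr' : inf_often (fun n => exists e s, evt (tau al n) (al n) r e s /\ True).
  by apply: inf_often_sub hr => n [e [s h]]; exists e, s.
have [i [e [_ he hj]]] := events_at_slot hlow hr'.
exists r; split=> //; apply: inf_often_sub he => n hn; exists e, (ph al 0 i); split=> //.
have [qs hq] : exists qs, inf_often (fun j => (merged i j /\ ph al i j = e) /\ q j = qs).
  by apply: inf_often_pigeon; apply: inf_often_sub hj => j h; exists (q j).
have [j1 _ [[[ij1 [n1 jn1 m1]] p1] qj1]] := hq 0.
have [n2 h2 b2] := hb n1.
have [j2 h3 [[[ij2 _] p2] qj2]] := hq n2.+1.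
have p12 : ph al j1 j2 = e by rewrite -p2; apply/esym; apply: merged_ph m1 _ _ _; lia.
exists (q 0), (has b (iota 0 j1)), qs; split=> //.
  have := @run_ph q b 0 j1 run (leq0n _); rewrite qj1 subn0 -(@ph_cat al 0 i j1) ?p1 //; lia.
have := @run_ph q b j1 j2 run; rewrite qj1 qj2 p12 => /(_ ltac:(lia)).
have -> // : has b (iota j1 (j2 - j1)) = true.
by apply/hasP; exists n2 => //; rewrite mem_iota; lia.
Qed.

(** Together with [det_accepts] this makes acceptance a parity condition on the token states, with
    two priorities per slot: accepting events at a slot count only if the lower slots are eventually
    quiet. The cuts are chosen one after the other among the positions merged with [i]. *)
Lemma det_sound r : inf_often (fun n => accev (tau al n) (al n) r) ->
  (forall r', r' < r -> ~ inf_often (fun n => ev n r')) ->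
  exists q0 b q (p : nat -> nat),
    [/\ init q0, ph al 0 (p 0) (q0, b, q), forall l, p l < p l.+1
      & forall l, ph al (p l) (p l.+1) (q, true, q)].
Proof.
move=> hacc hlow.
have [i [e [hA _ hj]]] := events_at_slot hlow (P := fun e s => Acc s e) hacc.
case: hA => q0 [b [q [i0 h1 h2]]].
have [j0 _ G0] := hj 0.
have [|p [p0 pG pR]] := @dep_choice nat (fun j => merged i j /\ ph al i j = e)
   (fun j j' => j < j' /\ ph al j j' = e) j0 G0.
  move=> j [[ij [n jn m]] pj]; have [j' hj' [[ij' m'] pj']] := hj n.+1.
  exists j' => //; split; first by lia.
  by rewrite -pj'; apply/esym; apply: merged_ph m _ _ _; lia.
exists q0, b, q, p; split=> //.
- by rewrite p0; case: G0 => [[ij _] pj]; rewrite -(@ph_cat al 0 i j0) ?pj //; lia.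
- by move=> l; case: (pR l).
- by move=> l; case: (pR l) => _ ->.
Qed.

End Limit.
End Tokens.

(** * A winning strategy that depends on the token state alone *)

Section Strategy.
Variables (Q E R S : finType) (tr : E * R -> Q -> bool -> Q -> Prop) (init : Q -> Prop).
Variables (e0 : E) (s0 : S) (step : S -> E -> S) (out : S -> E -> R).

Notation tau := (tau tr).
Notation upd := (upd tr).
Notation hasev := (hasev tr).
Notation accev := (accev tr init).
Notation T := (Tok Q).

Fixpoint st (g : nat -> E) n := if n is n'.+1 then step (st g n') (g n') else s0.
Definition word g n := (g n, out (st g n) (g n)).

Hypothesis win : forall g, ~ exists q0 b q (p : nat -> nat),
  [/\ init q0, ph tr (word g) 0 (p 0) (q0, b, q), forall l, p l < p l.+1
    & forall l, ph tr (word g) (p l) (p l.+1) (q, true, q)].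

Lemma tau_ext al be n : (forall l, l < n -> al l = be l) -> tau al n = tau be n.
Proof.
elim: n => [|n IH] h; first exact: tau0.
by rewrite !tau_S IH ?h // => l ln; apply: h; lia.
Qed.

Lemma st_ext g g' n : (forall l, l < n -> g l = g' l) -> st g n = st g' n.
Proof. by elim: n => //= n IH h; rewrite IH ?h // => l ln; apply: h; lia. Qed.

Lemma word_ext g g' n : (forall l, l < n -> g l = g' l) -> forall l, l < n -> word g l = word g' l.
Proof. by move=> h l ln; rewrite /word h // (@st_ext g g') // => i il; apply: h; lia. Qed.

Definition Reach (v : S * T) := exists g n, v = (st g n, tau (word g) n).

Definition nextv (v : S * T) e := (step v.1 e, upd v.2 (e, out v.1 e)).

Definition splice (g : nat -> E) n g2 i := if i < n then g i else g2 (i - n).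

Lemma splice_lt g n g2 l : l < n -> g l = splice g n g2 l.
Proof. by rewrite /splice => ->. Qed.

Lemma splice_node g n g2 i :
  (st (splice g n g2) (n + i), tau (word (splice g n g2)) (n + i)) =
  iteri i (fun j v => nextv v (g2 j)) (st g n, tau (word g) n).
Proof.
elim: i => [|i IH] /=.
  rewrite addn0 -(st_ext (@splice_lt g n g2)); congr (_, _).
  by apply: tau_ext => l ln; rewrite (word_ext (@splice_lt g n g2)).
rewrite -IH /nextv /= addnS /= tau_S.
have -> : splice g n g2 (n + i) = g2 i by rewrite /splice ltnNge leq_addr addKn.
by rewrite {2}/word /splice ltnNge leq_addr addKn.
Qed.

Lemma Reach_next v e : Reach v -> Reach (nextv v e).
Proof.
case=> g [n ->]; exists (splice g n (fun _ => e)), (n + 1).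
by rewrite splice_node.
Qed.

(** The product of memory and token state, restricted to steps without events below slot [r], with
    the accepting events at [r] as marks. A path with infinitely many marks would be a lost play, so
    each [r] has a rank function of its own, the component [rho r] of the progress measure. *)
Definition edge r (v : S * T) (l : E * bool) (v' : S * T) :=
  [/\ Reach v, v' = nextv v l.1, forall r', r' < r -> ~ hasev v.2 (l.1, out v.1 l.1) r'
    & l.2 = asb (accev v.2 (l.1, out v.1 l.1) r)].

Lemma no_infp r v : Reach v -> ~ infp (edge r) snd v.
Proof.
move=> [g [n vE]] [f [gl [f0 fe hm]]].
pose g' := splice g n (fun j => (gl j).1).
have fE i : f i = (st g' (n + i), tau (word g') (n + i)).
  rewrite splice_node -vE; elim: i => [|i IH]; first by rewrite f0.
  by case: (fe i) => _ -> _ _; rewrite IH.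
have wE i : word g' (n + i) = ((gl i).1, out (f i).1 (gl i).1).
  by rewrite /word fE /= /g' /splice ltnNge leq_addr addKn.
apply: (@win g'); apply: (@det_sound _ _ _ _ _ r).
  move=> N; have [i hi mi] := hm N; exists (n + i); first by lia.
  case: (fe i) => _ _ _; rewrite mi => /esym/asbP; rewrite wE.
  by rewrite [in X in accev X _ _ -> _]fE.
move=> r' rr hi; have [j hj hev] := hi n.
case: (fe (j - n)) => _ _ h _; apply: (h r' rr).
by move: hev; rewrite -{1 2}(subnKC hj) wE fE.
Qed.

Notation NV := #|{: S * T}|.

Definition rhoP r (rk : S * T -> nat) := (forall v, rk v <= NV.+1) /\
  forall v e, Reach v -> (forall r', r' < r -> ~ hasev v.2 (e, out v.1 e) r') ->
    rk (nextv v e) + asb (accev v.2 (e, out v.1 e) r) <= rk v.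

Lemma rho_ex r : exists rk, rhoP r rk.
Proof.
have [rk [h1 h2 h3 _]] := graph_rank (edge r) snd.
exists rk; split=> // v e rv nev; apply: (h2 v (e, asb (accev v.2 (e, out v.1 e) r))) => //.
by apply: h3; apply: no_infp.
Qed.

Definition rho r := proj1_sig (constructive_indefinite_description _ (rho_ex r)).
Lemma rhoE r : rhoP r (rho r).
Proof. exact: (proj2_sig (constructive_indefinite_description _ (rho_ex r))). Qed.

(* Lexicographic comparison of the tuples (rho 0, ..., rho r), coded in base [NV.+2]. *)
Fixpoint cd v r := if r is r'.+1 then cd v r' * NV.+2 + rho r v else rho 0 v.

(** Every component is at most [NV.+1], hence a digit in base [NV.+2]. So codes are compared
    lexicographically, and a least tuple has least prefixes. *)
Lemma cd_trunc v v' m r : r <= m -> cd v m <= cd v' m -> cd v r <= cd v' r.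
Proof.
move/subnKC <-; elim: (m - r) => [|d IH]; rewrite ?addn0 // addnS /= => h; apply: IH.
rewrite leqNgt; apply/negP => h2; move: h; apply/negP; rewrite -ltnNge.
have h3 := (rhoE (r + d).+1).1 v'.
apply: leq_trans (_ : (cd v' (r+d)).+1 * NV.+2 <= _).
  by rewrite mulSn; lia.
by apply: leq_trans (leq_addr _ _); rewrite leq_mul2r h2 orbT.
Qed.

Lemma cd_next v e r : Reach v -> (forall r', r' < r -> ~ hasev v.2 (e, out v.1 e) r') ->
  cd (nextv v e) r + asb (accev v.2 (e, out v.1 e) r) <= cd v r.
Proof.
move=> rv; elim: r => [|r IH] nev; first exact: (rhoE 0).2.
have := (rhoE r.+1).2 v e rv nev.
have := IH (fun r' h => nev r' (leqW h)).
rewrite [cd _ r.+1]/= [cd v r.+1]/= => h1 h2.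
rewrite -addnA; apply: leq_add => //; rewrite leq_mul2r.
by apply/orP; right; apply: leq_trans h1; rewrite leq_addr.
Qed.

Notation RM := #|{: {ffun Q * bool * Q -> bool}}|.

Definition TReach t := exists s, Reach (s, t).

(** The memory of the best history with token state [t]; [out2] answers as if that history had been
    played. Components up to [RM] suffice because accepting events have slots at most [RM]. *)
Lemma bs_ex t : exists s, TReach t -> Reach (s, t) /\
  forall s', Reach (s', t) -> cd (s, t) RM <= cd (s', t) RM.
Proof.
case: (classic (TReach t)) => [[s rs]|h]; last by exists s0.
have [|m [[s1 r1 e1] h]] := @classical_min (fun c => exists2 s, Reach (s, t) & cd (s, t) RM = c) (cd (s, t) RM).
  by exists s.
exists s1 => _; split=> // s' r'; rewrite e1 leqNgt; apply/negP => h2.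
by apply: (h _ h2); exists s'.
Qed.

Definition bs t := proj1_sig (constructive_indefinite_description _ (bs_ex t)).
Lemma bsE t : TReach t -> Reach (bs t, t) /\
  forall s', Reach (s', t) -> cd (bs t, t) RM <= cd (s', t) RM.
Proof. exact: (proj2_sig (constructive_indefinite_description _ (bs_ex t))). Qed.

Definition out2 t e := out (bs t) e.
Definition upd2 t e := upd t (e, out2 t e).

Lemma TReach_upd2 t e : TReach t -> TReach (upd2 t e).
Proof.
move=> h; have [r _] := bsE h; exists (step (bs t) e).
exact: (@Reach_next (bs t, t) e r).
Qed.

Definition t0 : T := tau (fun _ => (e0, out s0 e0)) 0.

Lemma TReach0 : TReach t0.
Proof. by exists s0, (fun _ => e0), 0; congr (_, _); apply: tau0. Qed.

Definition edge2 (v : T * Q) (l : E * bool) (v' : T * Q) :=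
  [/\ TReach v.1, v'.1 = upd2 v.1 l.1 & tr (l.1, out2 v.1 l.1) v.2 l.2 v'.2].

Lemma accev_slot al n r : accev (tau al n) (al n) r -> r <= RM.
Proof.
case=> e [s [/evt_pos[i [j [[i_n _ <- _] _]]] _]]; apply: rkp_bound; lia.
Qed.

(** Switching to the best memory never increases the measure, nor any prefix of it. Let [r] be the
    slot given by [det_accepts]: once the lower slots are quiet, the prefix up to [r] never grows
    and drops at each accepting event, so these cannot recur for ever. *)
Lemma no_infp2 q : init q -> ~ infp edge2 snd (t0, q).
Proof.
move=> iq [f [gl [f0 fe hm]]].
pose al n := ((gl n).1, out2 (f n).1 (gl n).1).
have tE n : tau al n = (f n).1.
  elim: n => [|n IH]; first by rewrite f0; apply: tau0.
  by rewrite tau_S IH; case: (fe n) => _ -> _.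
have [||r [hacc hlow]] := @det_accepts _ _ tr init al (fun n => (f n).2) (fun n => (gl n).2) _ _ hm.
- by rewrite f0.
- by move=> n; case: (fe n).
have rRM : r <= RM by have [n _ /accev_slot] := hacc 0.
have [N noev] := @eventually_never_below (fun n r => hasev (tau al n) (al n) r) r hlow.
pose ka n := cd (bs (f n).1, (f n).1) r.
have kaS n : N <= n -> ka n.+1 + asb (accev (tau al n) (al n) r) <= ka n.
  move=> Nn; case: (fe n) => tR tn _.
  have [rn _] := bsE tR.
  have := @cd_next (bs (f n).1, (f n).1) (gl n).1 r rn.
  have nv r' : r' < r -> ~ hasev (f n).1 (al n) r' by rewrite -tE; apply: noev.
  rewrite /= -/(out2 _ _) -/(al n) => /(_ nv) h; rewrite tE.
  apply: leq_trans h; rewrite leq_add2r /ka tn.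
  have := TReach_upd2 (gl n).1 tR => tR'.
  have [_ mn] := bsE tR'.
  apply: cd_trunc rRM _; apply: mn.
  exact: (@Reach_next (bs (f n).1, (f n).1) (gl n).1 rn).
have : forall c n, N <= n -> ka n <= c -> False; last by move/(_ (ka N) N (leqnn _) (leqnn _)).
elim=> [|c IH] n Nn kn; have [m hm1 acc] := hacc n.
all: have kd d : ka (n + d) <= ka n by
  elim: d => [|d IHd]; [rewrite addn0
    | rewrite addnS; apply: leq_trans IHd; apply: leq_trans (kaS _ _); [rewrite leq_addr | lia]].
all: have := kaS m (leq_trans Nn hm1); have -> : asb (accev (tau al m) (al m) r) by apply/asbP.
all: have := kd (m - n); rewrite subnKC // => k1 k2.
  by lia.
by apply: (IH m.+1); lia.
Qed.

(** Marks are counted anew, in the graph of pairs of a token state and a state, whose size does not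
    involve the memory [S]. This is the origin of the computable bound; a rank function of the set
    is the row of one reachable token state. *)
Theorem bounded_ranks : let K := #|{: T * Q}| in
  exists X : (Q -> nat) -> Prop,
    (exists2 b, X b & forall q, init q -> b q <= K) /\
    forall b, X b -> [/\ forall q, b q <= K.+1,
      forall q q', (forall a c q'', tr a q' c q'' -> tr a q c q'') -> b q' <= b q
    & forall e, exists s b', X b' /\ forall q c q',
        tr (e, out s e) q c q' -> b q <= K -> b' q' + c <= b q].
Proof.
move=> K; have [rk [h1 h2 h3 h4]] := graph_rank edge2 snd.
exists (fun b => exists2 t, TReach t & forall q, b q = rk (t, q)); split.
  exists (fun q => rk (t0, q)); first by exists t0; [exact: TReach0|].
  by move=> q iq; apply: h3; apply: no_infp2.
move=> b [t tR bE]; split.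
- by move=> q; rewrite bE.
- by move=> q q' h; rewrite !bE; apply: h4 => -[e c] [t' q''] [h5 h6 h7]; split=> //; apply: h.
- move=> e; exists (bs t), (fun q => rk (upd2 t e, q)); split.
    by exists (upd2 t e) => //; apply: TReach_upd2.
  move=> q c q' h; rewrite bE; apply: (h2 (t, q) (e, c) (upd2 t e, q')); split=> //.
Qed.

End Strategy.

(** * From sequences of blocks to paths of single edges *)

Section Flatten.
Variables (X L : Type) (edge : X -> L -> X -> Prop) (mk : L -> bool).

Inductive fpath : X -> nat -> bool -> X -> Prop :=
| fp0 x : fpath x 0 false x
| fpS x l y n b z : edge x l y -> fpath y n b z -> fpath x n.+1 (mk l || b) z.

Lemma fpath_cat x n b y m c z :
  fpath x n b y -> fpath y m c z -> fpath x (n + m) (b || c) z.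
Proof.
by elim=> {x n b y} [//|x l y n b w e _ IH] h; rewrite -orbA addSn; apply: fpS e (IH h).
Qed.

Lemma fpath_inv x n b z : fpath x n b z -> [/\ n = 0, b = false & x = z] \/
  exists l y n' b', [/\ n = n'.+1, b = mk l || b', edge x l y & fpath y n' b' z].
Proof. by case=> [y|y l y' m c w e h]; [left | right; exists l, y', m, c]. Qed.

Lemma flatten (z : nat -> X) x n b :
  fpath x n b (z 0) -> (forall l, exists m, fpath (z l) m true (z l.+1)) ->
  exists (f : nat -> X) (g : nat -> L),
    [/\ f 0 = x, forall i, edge (f i) (g i) (f i.+1) & inf_often (fun i => mk (g i))].
Proof.
move=> h0 hz.
(* The current vertex, the label just used, the index in [z] of the next target, and the length and
   the mark of the rest of the path to it. *)
pose St := (X * option L * nat * nat * bool)%type.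
pose sy (s : St) := s.1.1.1.1; pose sl (s : St) := s.1.1.2.
pose sn (s : St) := s.1.2; pose sb (s : St) := s.2; pose sa (s : St) := s.1.1.1.2.
pose G s := fpath (sy s) (sn s) (sb s) (z (sl s)).
pose Rel s s' := exists lab, [/\ sa s' = Some lab, edge (sy s) lab (sy s')
  & (sn s = (sn s').+1 /\ sb s = mk lab || sb s') \/
    [/\ sn s = 0, sb s = false & mk lab || sb s']].
have [||F [F0 FG FR]] := @dep_choice St G Rel (x, None, 0, n, b).
- exact: h0.
- case=> [[[[y a] l] m] c]; rewrite /G /Rel /sy /sn /sb /sl /sa /= => /fpath_inv [[-> -> ->]|[lab [y' [m' [c' [-> -> e hp]]]]]].
    have [m1 /fpath_inv [[]//|[lab [y' [m' [c' [_ e1 e2 hp]]]]]]] := hz l.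
    by exists (y', Some lab, l.+1, m', c') => //; exists lab; split=> //=; right.
  by exists (y', Some lab, l, m', c') => //; exists lab; split=> //=; left.
have [l0 _] : exists l : L, True by have [lab _] := FR 0; exists lab.
pose g i := odflt l0 (sa (F i.+1)).
exists (sy \o F), g; split=> [|i|].
- by rewrite /= F0.
- by have [lab [e1 e2 _]] := FR i; rewrite /g e1.
have mtrue c : forall i, sn (F i) <= c -> sb (F i) -> exists2 j, i <= j & mk (g j).
  elim: c => [|c IH] i hn hb; have [lab [e1 _ [[e2 e3]|[e2 e3 _]]]] := FR i.
  - by move: hn; rewrite e2.
  - by move: hb; rewrite e3.
  - case E: (mk lab); first by exists i; rewrite // /g e1.
    have [||j h1 h2] := IH i.+1; [lia | by move: hb; rewrite e3 E | exists j => //; lia].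
  - by move: hb; rewrite e3.
have mfalse c : forall i, sn (F i) <= c -> exists2 j, i <= j & mk (g j).
  elim: c => [|c IH] i hn; have [lab [e1 _ [[e2 e3]|[e2 e3 e4]]]] := FR i.
  - by move: hn; rewrite e2.
  - case E: (mk lab); first by exists i; rewrite // /g e1.
    have [||j h1 h2] := mtrue (sn (F i.+1)) i.+1; [lia | by move: e4; rewrite E | exists j => //; lia].
  - by have [|j h1 h2] := IH i.+1; [lia | exists j => //; lia].
  - case E: (mk lab); first by exists i; rewrite // /g e1.
    have [||j h1 h2] := mtrue (sn (F i.+1)) i.+1; [lia | by move: e4; rewrite E | exists j => //; lia].
by move=> N; apply: mfalse (leqnn _).
Qed.
End Flatten.

Lemma powE a b : Nat.pow a b = a ^ b.
Proof. by elim: b => //= b IH; rewrite IH expnS. Qed.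

Lemma card_MB n : #|{: {ffun 'I_n * bool * 'I_n -> bool}}| = MB n.
Proof. by rewrite card_ffun !card_prod card_bool card_ord /MB powE. Qed.

Lemma card_Kb n : #|{: Tok 'I_n * 'I_n}| = Kb n.
Proof. by rewrite card_prod card_ord card_ffun card_prod !card_option card_MB /Kb powE. Qed.

(** * Silent moves, and transfer to natural numbers *)

Section Export.
Local Open Scope coq_nat_scope.
Variables (NQ NE NR NS : nat).
Variables (sil : nat -> nat -> Prop) (ev : nat -> nat -> nat -> nat -> Prop).
Variables (cnt : nat -> nat -> nat -> bool) (ini : nat -> Prop) (allow : nat -> nat -> Prop).
Variables (stp out : nat -> nat -> nat) (s0 : nat).
Hypothesis NEpos : 0 < NE.
Hypothesis s0_lt : s0 < NS.
Hypothesis strat_ok : forall s e, s < NS -> e < NE ->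
  stp s e < NS /\ out s e < NR /\ allow e (out s e).
Hypothesis win : ~ exists (s q : nat -> nat) (lab : nat -> option nat),
  s 0 = s0 /\ ini (q 0) /\ (forall j, q j < NQ) /\
  (forall j, match lab j with
     | None => s (S j) = s j /\ sil (q j) (q (S j))
     | Some e => e < NE /\ s (S j) = stp (s j) e /\ ev e (out (s j) e) (q j) (q (S j)) end) /\
  (forall N, exists j, N <= j /\ exists e, lab j = Some e /\ cnt e (out (s j) e) (q j) = true).

Local Notation QQ := 'I_NQ.
Local Notation EE := 'I_NE.
Local Notation RR := 'I_NR.
Local Notation SS := 'I_NS.

Inductive sstar : QQ -> QQ -> Prop :=
| sstar0 q : sstar q q
| sstarS (q q1 q2 : QQ) : sil q q1 -> sstar q1 q2 -> sstar q q2.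

(** Only events are letters: a transition is a number of silent steps followed by one event. The
    mark is read at [q1], where the event occurs, so what happened during the silent steps is taken
    into account. *)
Definition trE (a : EE * RR) (q : QQ) (b : bool) (q' : QQ) :=
  exists q1 : QQ, [/\ sstar q q1, ev a.1 a.2 q1 q' & b = cnt a.1 a.2 q1].

Definition stepE (s : SS) (e : EE) : SS :=
  Ordinal (introT ltP (proj1 (strat_ok (elimT ltP (ltn_ord s)) (elimT ltP (ltn_ord e))))).
Definition outE (s : SS) (e : EE) : RR :=
  Ordinal (introT ltP (proj1 (proj2 (strat_ok (elimT ltP (ltn_ord s)) (elimT ltP (ltn_ord e)))))).
Definition s0E : SS := Ordinal (introT ltP s0_lt).
Definition e0E : EE := Ordinal (introT ltP NEpos).

Definition medge (al : nat -> EE * RR) (x : nat * QQ) (l : option bool) (y : nat * QQ) :=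
  match l with
  | None => y.1 = x.1 /\ sil x.2 y.2
  | Some b => [/\ y.1 = x.1.+1, ev (al x.1).1 (al x.1).2 x.2 y.2 & b = cnt (al x.1).1 (al x.1).2 x.2]
  end.
Definition mmk (l : option bool) := if l is Some b then b else false.

Lemma trE_fpath al i q b q' : trE (al i) q b q' ->
  exists m, fpath (medge al) mmk (i, q) m b (i.+1, q').
Proof.
case=> q1 [h1 h2 ->]; elim: h1 h2 => {q q1} [q|q q1 q2 h _ IH] h2.
  exists 1; rewrite -[cnt _ _ _]orbF -/(mmk (Some (cnt (al i).1 (al i).2 q))).
  by apply: fpS (fp0 _ _ _); split.
have [m hm] := IH h2; exists m.+1.
by apply: (@fpS _ _ (medge al) mmk (i, q) None (i, q1)).
Qed.

Lemma ph_fpath al i j q b q' : (i <= j)%N -> ph trE al i j (q, b, q') ->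
  exists m, fpath (medge al) mmk (i, q) m b (j, q').
Proof.
move/subnKC <-; elim: (j - i)%N q' b => [|d IH] q' b.
  by rewrite addn0 ph_id ffunE /= => /andP[/eqP-> /negbTE->]; exists 0; constructor.
rewrite addnS phS ?leq_addr // => /mmulP[p [b1 [b2 [h1]]]].
rewrite ffunE /= => /asbP h2 ->; have [m hm] := IH _ _ h1.
by have [m' hm'] := trE_fpath h2; exists (m + m')%N; apply: fpath_cat hm hm'.
Qed.

Lemma winE g : ~ exists q0 b q (p : nat -> nat),
  [/\ ini (nat_of_ord q0), ph trE (word s0E stepE outE g) 0 (p 0) (q0, b, q), (forall l, p l < p l.+1)%N
    & forall l, ph trE (word s0E stepE outE g) (p l) (p l.+1) (q, true, q)].
Proof.
case=> q0 [b [q [p [iq h1 h2 h3]]]]; apply: win.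
set al := word s0E stepE outE g in h1 h3.
have [m hm] := ph_fpath (leq0n _) h1.
have hl l : exists m, fpath (medge al) mmk (p l, q) m true (p l.+1, q).
  by apply: ph_fpath (h3 l); apply: ltnW.
have [f [gl [f0 fe fm]]] := @flatten _ _ (medge al) mmk (fun l => (p l, q)) _ _ _ hm hl.
pose sE i := st s0E stepE g (f i).1.
exists (fun i => nat_of_ord (sE i)), (fun i => nat_of_ord (f i).2),
  (fun i => if gl i is Some _ then Some (nat_of_ord (g (f i).1)) else None).
split; first by rewrite /sE f0.
split; first by rewrite f0.
split; first by move=> j; apply/ltP.
split.
  move=> j; have := fe j; rewrite /medge /sE; case: (gl j) => [c|]; last by case=> -> h.
  case=> -> h _; split; first exact/ltP.
  by split; [|exact: h].
move=> N; have [j Nj mj] := fm N; exists j; split; first exact/leP.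
exists (g (f j).1); have := fe j; move: mj; rewrite /mmk; case: (gl j) => // c -> [_ _ h].
by split=> //; rewrite /sE; rewrite [in RHS]h.
Qed.

(** Ranks do not grow along a silent step, because every transition from its target, preceded by
    that step, is a transition from its source; this is the monotonicity clause of [graph_rank]. *)
Theorem bounded_ranks_nat : exists X : (nat -> nat) -> Prop,
  (exists b, X b /\ forall q, q < NQ -> ini q -> b q <= Kb NQ) /\
  forall b, X b ->
    (forall q, q < NQ -> b q <= S (Kb NQ)) /\
    (forall q q', q < NQ -> q' < NQ -> sil q q' -> b q' <= b q) /\
    (forall e, e < NE -> exists r b', r < NR /\ allow e r /\ X b' /\
       forall q q', q < NQ -> q' < NQ -> ev e r q q' -> b q <= Kb NQ ->
         b' q' + (if cnt e r q then 1 else 0) <= b q).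
Proof.
have [X [[b0 Xb0 hb0] hX]] := bounded_ranks e0E winE.
rewrite card_Kb in hb0 hX.
exists (fun b => exists2 bE : QQ -> nat, X bE & forall q : QQ, b q = bE q); split.
  exists (fun q => if insub q is Some qq then b0 qq else 0); split.
    by exists b0 => // q; rewrite valK.
  move=> q /ltP hq; rewrite insubT /= => iq; apply/leP; exact: hb0.
move=> b [bE XbE hbE]; have [h1 h2 h3] := hX _ XbE.
split; [|split].
- by move=> q /ltP hq; apply/leP; rewrite -[q]/(nat_of_ord (Ordinal hq)) hbE h1.
- move=> q q' /ltP hq /ltP hq' hs; apply/leP.
  rewrite -[q]/(nat_of_ord (Ordinal hq)) -[q']/(nat_of_ord (Ordinal hq')) !hbE; apply: h2.
  move=> a c q'' [q1 [s1 s2 s3]]; exists q1; split=> //; exact: sstarS s1.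
- move=> e /ltP he; have [s [b' [Xb' hb']]] := h3 (Ordinal he).
  exists (nat_of_ord (outE s (Ordinal he))), (fun q => if insub q is Some qq then b' qq else 0).
  have ok := strat_ok (elimT ltP (ltn_ord s)) (elimT ltP (ltn_ord (Ordinal he))).
  split; [exact/ltP|split; [exact: (proj2 (proj2 ok))|split]].
    by exists b' => // q; rewrite valK.
  move=> q q' /ltP hq /ltP hq' he' /leP; rewrite -[q]/(nat_of_ord (Ordinal hq)) hbE => hb.
  rewrite insubT; apply/leP.
  have := hb' (Ordinal hq) (cnt e (outE s (Ordinal he)) q) (Ordinal hq').
  rewrite -[in X in X -> _]/(nat_of_ord (Ordinal hq)).
  have -> : (if cnt e (outE s (Ordinal he)) q then 1 else 0) = cnt e (outE s (Ordinal he)) q by case: cnt.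
  apply=> //; exists (Ordinal hq); split=> //; exact: sstar0.
Qed.
End Export.

End Synthesis.

(** * Region equivalence *)

Open Scope R_scope.

Definition ext (n : nat) (v : valuation) (x : nat) : R := if lt_dec x n then v x else 0.

(* Index [n] plays the role of the constant clock 0. *)
Definition eqv (n M : nat) (v v' : valuation) : Prop :=
  forall x y, (x <= n)%nat -> (y <= n)%nat -> forall z, (Z.abs z <= Z.of_nat M)%Z ->
    (ext n v x - ext n v y < IZR z <-> ext n v' x - ext n v' y < IZR z).

Lemma ext_lt n v x : (x < n)%nat -> ext n v x = v x.
Proof. intros. unfold ext. destruct lt_dec; [auto|lia]. Qed.
Lemma ext_n n v : ext n v n = 0.
Proof. unfold ext. destruct lt_dec; [lia|auto]. Qed.

Lemma eqv_refl n M v : eqv n M v v.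
Proof. red; tauto. Qed.
Lemma eqv_sym n M v v' : eqv n M v v' -> eqv n M v' v.
Proof. intros H x y Hx Hy z Hz. symmetry. auto. Qed.
Lemma eqv_trans n M v v' v'' : eqv n M v v' -> eqv n M v' v'' -> eqv n M v v''.
Proof. intros H1 H2 x y Hx Hy z Hz. rewrite (H1 x y), (H2 x y); tauto. Qed.
Lemma eqv_ext n M v v' : (forall x, (x < n)%nat -> v x = v' x) -> eqv n M v v'.
Proof.
  intros H x y _ _ z _. unfold ext. repeat destruct lt_dec; rewrite ?H by auto; tauto.
Qed.

Lemma eqv_diff n M v v' x y z : eqv n M v v' -> (x < n)%nat -> (y < n)%nat ->
  (Z.abs z <= Z.of_nat M)%Z ->
  (v x - v y < IZR z <-> v' x - v' y < IZR z) /\ (v x - v y > IZR z <-> v' x - v' y > IZR z).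
Proof.
  intros H Hx Hy Hz. split.
  - specialize (H x y ltac:(lia) ltac:(lia) z Hz). rewrite !ext_lt in H by auto. auto.
  - specialize (H y x ltac:(lia) ltac:(lia) (- z)%Z ltac:(lia)). rewrite !ext_lt, opp_IZR in H by auto.
    split; intros; [assert (v' y - v' x < - IZR z)|assert (v y - v x < - IZR z)]; try lra; apply H; lra.
Qed.

Lemma eqv_one n M v v' x z : eqv n M v v' -> (x < n)%nat -> (Z.abs z <= Z.of_nat M)%Z ->
  (v x < IZR z <-> v' x < IZR z) /\ (v x > IZR z <-> v' x > IZR z).
Proof.
  intros H Hx Hz. split.
  - specialize (H x n ltac:(lia) ltac:(lia) z Hz). rewrite ext_n, !ext_lt, ext_n, !Rminus_0_r in H by auto. auto.
  - specialize (H n x ltac:(lia) ltac:(lia) (- z)%Z ltac:(lia)). rewrite !ext_n, !ext_lt, opp_IZR in H by auto.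
    split; intros; [assert (0 - v' x < - IZR z)|assert (0 - v x < - IZR z)]; try lra; apply H; lra.
Qed.

Lemma cmpR_iff o a b c d : (a < c <-> b < d) -> (a > c <-> b > d) -> (cmpR o a c <-> cmpR o b d).
Proof.
  intros H1 H2. destruct o; simpl; auto; split; intros H;
    destruct (Rtotal_order a c) as [?|[?|?]]; destruct (Rtotal_order b d) as [?|[?|?]];
    try lra; exfalso; tauto || (assert (a < c) by tauto; lra) || (assert (a > c) by tauto; lra)
    || (assert (b < d) by tauto; lra) || (assert (b > d) by tauto; lra).
Qed.

Lemma eqv_sat n M v v' c : eqv n M v v' -> clocks_below n c -> consts_below M c ->
  (sat v c <-> sat v' c).
Proof.
  intros H. induction c; simpl; try tauto.
  - intros. destruct (eqv_one n M v v' n0 z H); auto. apply cmpR_iff; auto.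
  - intros [] ?. destruct (eqv_diff n M v v' n0 n1 z H); auto. apply cmpR_iff; auto.
Qed.

Lemma eqv_region n M v v' : eqv n M v v' -> region_equiv n M v v'.
Proof. intros H c H1 H2. apply (eqv_sat n M); auto. Qed.

Lemma region_eqv n M v v' : region_equiv n M v v' -> eqv n M v v'.
Proof.
  intros H x y Hx Hy z Hz. unfold ext. destruct (lt_dec x n), (lt_dec y n).
  - apply (H (CDiff x y CLt z)); simpl; auto.
  - rewrite !Rminus_0_r. apply (H (CAtom x CLt z)); simpl; auto.
  - pose proof (H (CAtom y CGt (- z)%Z)) as H1. simpl in H1. rewrite opp_IZR in H1.
    specialize (H1 l ltac:(lia)). split; intros; [assert (v' y > - IZR z)|assert (v y > - IZR z)]; try lra; apply H1; lra.
  - tauto.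
Qed.

Lemma ext_reset n Y v x : (x <= n)%nat ->
  ext n (reset Y v) x = ext n v (if in_dec Nat.eq_dec x Y then n else x).
Proof.
  intros Hx. unfold ext, reset. destruct in_dec.
  - repeat destruct lt_dec; auto; lia.
  - destruct lt_dec; auto.
Qed.

Lemma eqv_reset n M Y v v' : eqv n M v v' -> eqv n M (reset Y v) (reset Y v').
Proof.
  intros H x y Hx Hy z Hz. rewrite !ext_reset by auto.
  apply H; auto; destruct in_dec; auto.
Qed.

Lemma above_below (a : R) (U : list R) : (forall b, In b U -> a < b) ->
  exists c, a < c /\ forall b, In b U -> c < b.
Proof.
  induction U as [|u U IH]; intros H.
  - exists (a + 1). split; [lra|]. contradiction.
  - destruct IH as [c [Hc1 Hc2]]; [intros; apply H; right; auto|].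
    specialize (H u (or_introl eq_refl)).
    exists (Rmin c ((a + u) / 2)). split; [apply Rmin_glb_lt; lra|].
    pose proof (Rmin_l c ((a + u) / 2)). pose proof (Rmin_r c ((a + u) / 2)).
    intros b [->|Hb]; [lra|]. specialize (Hc2 b Hb). lra.
Qed.

Lemma separate (L U : list R) : (forall a b, In a L -> In b U -> a < b) ->
  exists c, (forall a, In a L -> a < c) /\ (forall b, In b U -> c < b).
Proof.
  induction L as [|a L IH]; intros H.
  - assert (exists c, forall b, In b U -> c < b) as [c Hc].
    { clear H. induction U as [|u U [c Hc]]; [exists 0; contradiction|].
      exists (Rmin c (u - 1)). pose proof (Rmin_l c (u - 1)). pose proof (Rmin_r c (u - 1)).
      intros b [->|Hb]; [lra|]. specialize (Hc b Hb). lra. }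
    exists c. split; [contradiction|auto].
  - destruct IH as [c [Hc1 Hc2]]; [intros; apply H; auto; right; auto|].
    destruct (Rlt_dec a c) as [Hac|Hac].
    + exists c. split; auto. intros b [->|]; auto.
    + destruct (above_below a U) as [c' [H1 H2]]; [intros; apply H; auto; left; auto|].
      exists c'. split; auto. intros b [->|Hb]; auto. specialize (Hc1 b Hb). lra.
Qed.

(** The extension step of a back-and-forth argument for dense orders without endpoints: [d'] takes
    among the second components the place of [d] among the first. *)
Lemma order_transfer (l : list (R * R)) (d : R) :
  (forall p q, In p l -> In q l -> (fst p < fst q <-> snd p < snd q)) ->
  exists d', forall p, In p l -> (d < fst p <-> d' < snd p) /\ (fst p < d <-> snd p < d').
Proof.
  intros H. destruct (classic (exists p, In p l /\ fst p = d)) as [[p [Hp <-]]|Hno].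
  - exists (snd p). intros q Hq. split; apply H; auto.
  - destruct (separate (map snd (filter (fun p => if Rlt_dec (fst p) d then true else false) l))
                       (map snd (filter (fun p => if Rlt_dec d (fst p) then true else false) l)))
      as [d' [H1 H2]].
    + intros a b Ha Hb. apply in_map_iff in Ha, Hb.
      destruct Ha as [p [<- Hp]], Hb as [q [<- Hq]].
      apply filter_In in Hp, Hq. destruct Hp as [Hp Hp'], Hq as [Hq Hq'].
      repeat destruct Rlt_dec; try discriminate. apply H; auto. lra.
    + exists d'. intros p Hp.
      assert (A1 : fst p < d -> snd p < d').
      { intros. apply H1, in_map, filter_In. split; auto. destruct Rlt_dec; auto. }
      assert (A2 : d < fst p -> d' < snd p).
      { intros. apply H2, in_map, filter_In. split; auto. destruct Rlt_dec; auto. }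
      destruct (Rtotal_order (fst p) d) as [Hl|[He|Hg]].
      * specialize (A1 Hl). split; split; intros; try lra; auto.
      * exfalso. eauto.
      * specialize (A2 Hg). split; split; intros; try lra; auto.
Qed.

Definition vnonneg n (v : valuation) := forall x, (x < n)%nat -> 0 <= v x.

Lemma eqv_vnonneg n M v v' : eqv n M v v' -> vnonneg n v -> vnonneg n v'.
Proof.
  intros H Hv x Hx. destruct (eqv_one n M v v' x 0%Z H Hx ltac:(lia)) as [H1 _].
  specialize (Hv x Hx). destruct (Rlt_dec (v' x) 0) as [Hn|]; [|lra].
  apply H1 in Hn. lra.
Qed.

(** Region equivalence is a time bisimulation. A delay matters only by its place among the points
    where a clock meets a constant, and the diagonal comparisons put these points in the same order
    for both valuations. *)
Lemma eqv_delay n M v v' d : eqv n M v v' -> vnonneg n v -> 0 <= d ->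
  exists d', 0 <= d' /\ eqv n M (delay v d) (delay v' d').
Proof.
  intros H Hv Hd. pose proof (eqv_vnonneg n M v v' H Hv) as Hv'.
  (* The pair [(0, 0)] keeps the new delay nonnegative. Negative constants need no points, since
     clocks never meet them. *)
  pose (l := (0, 0) :: flat_map (fun x => map (fun z => (INR z - v x, INR z - v' x)) (seq 0 (S M))) (seq 0 n)).
  assert (Hl : forall p, In p l -> p = (0, 0) \/
     exists x z, (x < n)%nat /\ (z <= M)%nat /\ p = (INR z - v x, INR z - v' x)).
  { intros p [<-|Hp]; auto. right. apply in_flat_map in Hp. destruct Hp as [x [Hx Hp]].
    apply in_map_iff in Hp. destruct Hp as [z [<- Hz]].
    apply in_seq in Hx, Hz. exists x, z. repeat split; try lia. }
  destruct (order_transfer l d) as [d' Hd'].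
  - intros p q Hp Hq. apply Hl in Hp, Hq.
    destruct Hp as [->|[x [z [Hx [Hz ->]]]]], Hq as [->|[y [z' [Hy [Hz' ->]]]]]; simpl; [tauto| | |].
    + destruct (eqv_one n M v v' y (Z.of_nat z') H Hy ltac:(lia)) as [E _]. rewrite <- INR_IZR_INZ in E.
      split; intros; [assert (v' y < INR z')|assert (v y < INR z')]; try lra; apply E; lra.
    + destruct (eqv_one n M v v' x (Z.of_nat z) H Hx ltac:(lia)) as [_ E]. rewrite <- INR_IZR_INZ in E.
      split; intros; [assert (v' x > INR z)|assert (v x > INR z)]; try lra; apply E; lra.
    + destruct (eqv_diff n M v v' y x (Z.of_nat z' - Z.of_nat z) H Hy Hx ltac:(lia)) as [E _].
      rewrite minus_IZR, <- !INR_IZR_INZ in E.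
      split; intros; [assert (v' y - v' x < INR z' - INR z)|assert (v y - v x < INR z' - INR z)]; try lra; apply E; lra.
  - assert (Hd0 : 0 <= d').
    { destruct (Hd' (0, 0) (or_introl eq_refl)) as [E _]. simpl in E.
      destruct (Rlt_dec d' 0) as [Hn|]; [|lra]. apply E in Hn. lra. }
    exists d'. split; auto.
    assert (key : forall x z, (x < n)%nat -> (Z.abs z <= Z.of_nat M)%Z ->
      (v x + d < IZR z <-> v' x + d' < IZR z) /\ (v x + d > IZR z <-> v' x + d' > IZR z)).
    { intros x z Hx Hz. specialize (Hv x Hx). specialize (Hv' x Hx).
      destruct (Z_lt_le_dec z 0) as [Hneg|Hpos].
      - assert (IZR z < 0) by (apply (IZR_lt z 0); auto). split; split; intros; lra.
      - destruct (Hd' (INR (Z.to_nat z) - v x, INR (Z.to_nat z) - v' x)) as [E1 E2].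
        + right. apply in_flat_map. exists x. split; [apply in_seq; lia|].
          apply in_map_iff. exists (Z.to_nat z). split; auto. apply in_seq. lia.
        + simpl in E1, E2. rewrite INR_IZR_INZ, Z2Nat.id in E1, E2 by auto.
          split; split; intros.
          * assert (d' < IZR z - v' x); [apply E1|]; lra.
          * assert (d < IZR z - v x); [apply E1|]; lra.
          * assert (IZR z - v' x < d'); [apply E2|]; lra.
          * assert (IZR z - v x < d); [apply E2|]; lra. }
    intros x y Hx Hy z Hz.
    unfold ext. destruct (lt_dec x n), (lt_dec y n); unfold delay.
    + destruct (eqv_diff n M v v' x y z H l0 l1 Hz) as [E _].
      split; intros; [assert (v' x - v' y < IZR z)|assert (v x - v y < IZR z)]; try lra; apply E; lra.
    + rewrite !Rminus_0_r. apply key; auto.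
    + destruct (key y (- z)%Z l0 ltac:(lia)) as [_ E]. rewrite opp_IZR in E.
      split; intros; [assert (v' y + d' > - IZR z)|assert (v y + d > - IZR z)]; try lra; apply E; lra.
    + tauto.
Qed.

(** * Grid representatives *)

Definition zu n (u : nat -> nat) x : Z := if lt_dec x n then Z.of_nat (u x) else 0%Z.

Definition gridrep n M (v : valuation) (u : nat -> nat) := forall x y, (x <= n)%nat -> (y <= n)%nat ->
  forall z, (Z.abs z <= Z.of_nat M)%Z ->
  (ext n v x - ext n v y < IZR z <-> (zu n u x - zu n u y < Z.of_nat (S n) * z)%Z).

Lemma filter_length_le {A} (f g : A -> bool) l :
  (forall x, In x l -> f x = true -> g x = true) -> (length (filter f l) <= length (filter g l))%nat.
Proof.
  induction l as [|a l IH]; intros H; simpl; auto.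
  specialize (IH (fun x Hx => H x (or_intror Hx))). specialize (H a (or_introl eq_refl)).
  destruct (f a), (g a); simpl; lia.
Qed.

Lemma filter_length_lt {A} (f g : A -> bool) l a :
  (forall x, In x l -> f x = true -> g x = true) -> In a l -> f a = false -> g a = true ->
  (length (filter f l) < length (filter g l))%nat.
Proof.
  intros H Ha Hf Hg. apply in_split in Ha. destruct Ha as [l1 [l2 ->]].
  rewrite !filter_app, !length_app. simpl. rewrite Hf, Hg. simpl.
  pose proof (filter_length_le f g l1 (fun x Hx => H x (in_or_app _ _ _ (or_introl Hx)))).
  pose proof (filter_length_le f g l2 (fun x Hx => H x (in_or_app l1 (a :: l2) x (or_intror (or_intror Hx))))).
  lia.
Qed.

(** Integer parts are kept and fractional parts replaced by their ranks. With the constant clock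
    there are [n + 1] of them, so ranks are below [n + 1], the number of grid steps per unit; the
    constant clock has rank 0. *)
Lemma gridrep_exists n M v : vnonneg n v -> exists u, gridrep n M v u.
Proof.
  intros Hv.
  pose (w := ext n v). pose (i := fun x => Int_part (w x)). pose (f := fun x => frac_part (w x)).
  pose (r := fun x => length (filter (fun y => if Rlt_dec (f y) (f x) then true else false) (seq 0 (S n)))).
  assert (Hf : forall x, 0 <= f x < 1) by (intros; unfold f; pose proof (base_fp (w x)); lra).
  assert (Hw : forall x, w x = IZR (i x) + f x) by (intros; unfold f, i, frac_part; lra).
  assert (r1 : forall x y, (x <= n)%nat -> f x < f y -> (r x < r y)%nat).
  { intros x y Hx Hxy. apply filter_length_lt with x.
    - intros t _. destruct (Rlt_dec (f t) (f x)), (Rlt_dec (f t) (f y)); auto; lra.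
    - apply in_seq. lia.
    - destruct Rlt_dec; auto; lra.
    - destruct Rlt_dec; auto; lra. }
  assert (r2 : forall x y, f x <= f y -> (r x <= r y)%nat).
  { intros x y Hxy. apply filter_length_le.
    intros t _. destruct (Rlt_dec (f t) (f x)), (Rlt_dec (f t) (f y)); auto; lra. }
  assert (r3 : forall x, (x <= n)%nat -> (r x <= n)%nat).
  { intros x Hx. assert (r x < length (filter (fun _ => true) (seq 0 (S n))))%nat.
    - apply filter_length_lt with x; auto; [apply in_seq; lia|]. destruct Rlt_dec; auto; lra.
    - assert (E : filter (fun _ : nat => true) (seq 0 (S n)) = seq 0 (S n)).
      { generalize (seq 0 (S n)). induction l; simpl; congruence. }
      rewrite E, length_seq in H. lia. }
  assert (i0 : forall x, (0 <= i x)%Z).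
  { intros x. assert (0 <= w x) by (unfold w, ext; destruct lt_dec; [auto|lra]).
    rewrite Hw in H. specialize (Hf x). assert (IZR (-1) < IZR (i x)) by (simpl; lra).
    apply lt_IZR in H0. lia. }
  assert (wn : w n = 0) by apply ext_n.
  assert (fn : f n = 0 /\ i n = 0%Z).
  { pose proof (Hw n) as E. rewrite wn in E. specialize (Hf n).
    assert (IZR (-1) < IZR (i n)) by (simpl; lra). assert (IZR (i n) < IZR 1) by (simpl; lra).
    apply lt_IZR in H, H0. assert (i n = 0%Z) as E0 by lia. rewrite E0 in E. simpl in E. split; [lra|auto]. }
  destruct fn as [fn in0].
  assert (rn : r n = 0%nat).
  { unfold r. rewrite fn. assert (G : forall l, filter (fun y => if Rlt_dec (f y) 0 then true else false) l = nil).
    { induction l; simpl; auto. destruct Rlt_dec; auto. specialize (Hf a). lra. }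
    rewrite G. auto. }
  exists (fun x => S n * Z.to_nat (i x) + r x)%nat.
  assert (Hz : forall x, (x <= n)%nat ->
    zu n (fun x => S n * Z.to_nat (i x) + r x)%nat x = (Z.of_nat (S n) * i x + Z.of_nat (r x))%Z).
  { intros x Hx. unfold zu. destruct lt_dec.
    - rewrite Nat2Z.inj_add, Nat2Z.inj_mul, Z2Nat.id by auto. auto.
    - assert (x = n) by lia. subst. rewrite in0, rn. lia. }
  intros x y Hx Hy z _. fold w. rewrite !Hz by auto.
  rewrite (Hw x), (Hw y). pose proof (Hf x) as Fx. pose proof (Hf y) as Fy.
  pose proof (r3 x Hx). pose proof (r3 y Hy).
  assert (IZR (i x - i y - z) = IZR (i x) - IZR (i y) - IZR z) as Ei by (rewrite !minus_IZR; auto).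
  destruct (Z_lt_le_dec (i x - i y - z) 0) as [H1|H1]; [|destruct (Z.eq_dec (i x - i y - z) 0) as [H2|H2]].
  - assert (IZR (i x - i y - z) <= IZR (-1)) by (apply IZR_le; lia). simpl in H2. split; intros; [nia|lra].
  - rewrite H2 in Ei. simpl in Ei. split; intros H3.
    + assert (f x < f y) by lra. specialize (r1 x y Hx H4). nia.
    + destruct (Rlt_dec (f x) (f y)); [lra|]. assert (f y <= f x) by lra. specialize (r2 y x H4). nia.
  - assert (IZR 1 <= IZR (i x - i y - z)) by (apply IZR_le; lia). simpl in H3. split; intros; [lra|nia].
Qed.

Definition bsum k (f : nat -> nat) := list_sum (map f (seq 0 k)).

Lemma bsum_le k f g : (forall x, (x < k)%nat -> (f x <= g x)%nat) -> (bsum k f <= bsum k g)%nat.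
Proof.
  unfold bsum. intros H. assert (H' : forall x, In x (seq 0 k) -> (f x <= g x)%nat).
  { intros x Hx. apply in_seq in Hx. apply H. lia. }
  revert H'. generalize (seq 0 k). induction l as [|a l IH]; simpl; intros H'; auto.
  specialize (IH (fun x Hx => H' x (or_intror Hx))). specialize (H' a (or_introl eq_refl)). lia.
Qed.

Lemma bsum_lt k f g x0 : (x0 < k)%nat -> (forall x, (x < k)%nat -> (f x <= g x)%nat) ->
  (f x0 < g x0)%nat -> (bsum k f < bsum k g)%nat.
Proof.
  unfold bsum. intros H0 H Hl. assert (H' : forall x, In x (seq 0 k) -> (f x <= g x)%nat).
  { intros x Hx. apply in_seq in Hx. apply H. lia. }
  assert (Hin : In x0 (seq 0 k)) by (apply in_seq; lia).
  revert H' Hin. generalize (seq 0 k). induction l as [|a l IH]; simpl; intros H' Hin; [contradiction|].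
  pose proof (H' a (or_introl eq_refl)).
  assert (G : forall l', (forall x, In x l' -> (f x <= g x)%nat) -> (list_sum (map f l') <= list_sum (map g l'))%nat).
  { induction l'; simpl; intros; auto. specialize (IHl' ltac:(auto)). specialize (H2 a0 (or_introl eq_refl)). lia. }
  destruct Hin as [->|Hin].
  - specialize (G l ltac:(auto)). lia.
  - specialize (IH ltac:(auto) Hin). lia.
Qed.

Lemma bsum_const k c : bsum k (fun _ => c) = (k * c)%nat.
Proof.
  unfold bsum. assert (G : forall l : list nat, list_sum (map (fun _ => c) l) = (length l * c)%nat).
  { induction l; simpl; auto. }
  rewrite G, length_seq. auto.
Qed.

(** Pigeonhole: [n] values cannot meet [n + 1] disjoint intervals. *)
Lemma empty_interval n (u : nat -> nat) G : exists j, (j <= n)%nat /\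
  forall x, (x < n)%nat -> ~ (j * G < u x <= S j * G)%nat.
Proof.
  apply NNPP. intros Hno.
  assert (H : forall j, exists x, (j <= n)%nat -> (x < n)%nat /\ (j * G < u x <= S j * G)%nat).
  { intros j. apply NNPP. intros H1. apply Hno. exists j. split.
    - apply NNPP. intros H2. apply H1. exists 0%nat. lia.
    - intros x Hx H2. apply H1. exists x. auto. }
  pose (g := fun j => proj1_sig (constructive_indefinite_description _ (H j))).
  assert (Hg : forall j, (j <= n)%nat -> (g j < n)%nat /\ (j * G < u (g j) <= S j * G)%nat).
  { intros j. exact (proj2_sig (constructive_indefinite_description _ (H j))). }
  assert (ND : NoDup (map g (seq 0 (S n)))).
  { apply NoDup_map_NoDup_ForallPairs; [|apply seq_NoDup].
    intros a b Ha Hb E. apply in_seq in Ha, Hb.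
    destruct (Hg a ltac:(lia)) as [_ H1]. destruct (Hg b ltac:(lia)) as [_ H2]. rewrite E in H1.
    destruct (Nat.lt_trichotomy a b) as [Hl|[He|Hl]]; auto; exfalso; nia. }
  assert (L : (length (map g (seq 0 (S n))) <= length (seq 0 n))%nat).
  { apply NoDup_incl_length; auto. intros x Hx. apply in_map_iff in Hx. destruct Hx as [j [<- Hj]].
    apply in_seq in Hj. apply in_seq. destruct (Hg j ltac:(lia)). lia. }
  rewrite length_map, !length_seq in L. lia.
Qed.

(** The total length of [S n] intervals, each longer than the largest constant in grid units. *)
Definition gbound n M := (S n * (S n * M + 2))%nat.

(** If some value exceeds the bound, all values above an empty interval are lowered by 1. The gap
    exceeds every constant also afterwards, so no comparison changes, while the sum of the values
    decreases. *)
Lemma gridrep_bounded n M v : vnonneg n v ->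
  exists u, gridrep n M v u /\ forall x, (x < n)%nat -> (u x <= gbound n M)%nat.
Proof.
  intros Hv. destruct (gridrep_exists n M v Hv) as [u Hu].
  remember (bsum n u) as s eqn:Es. revert u Hu Es.
  induction s as [s IH] using (well_founded_induction lt_wf). intros u Hu ->.
  destruct (classic (forall x, (x < n)%nat -> (u x <= gbound n M)%nat)) as [H|H]; [eauto|].
  apply not_all_ex_not in H. destruct H as [x0 H]. apply imply_to_and in H. destruct H as [Hx0 Hbig].
  pose (G := (S n * M + 2)%nat).
  destruct (empty_interval n u G) as [j [Hj Hemp]].
  pose (u' := fun x => if le_dec (u x) (j * G) then u x else (u x - 1)%nat).
  assert (Hu' : forall x, (x < n)%nat -> ((u x <= j * G)%nat /\ u' x = u x) \/ ((S j * G < u x)%nat /\ u' x = (u x - 1)%nat)).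
  { intros x Hx. unfold u'. destruct le_dec; [left; auto|right]. split; auto.
    specialize (Hemp x Hx). lia. }
  assert (HG : (S j * G = j * G + G)%nat) by lia.
  apply (IH (bsum n u')) with u'; auto.
  - apply bsum_lt with x0; auto.
    + intros y _. unfold u'. destruct le_dec; lia.
    + destruct (Hu' x0 Hx0) as [[H1 _]|[H1 ->]]; [|lia].
      exfalso. apply Hbig. unfold gbound. fold G. nia.
  - intros x y Hx Hy z Hz. rewrite (Hu x y Hx Hy z Hz).
    assert (Z1 : (- (Z.of_nat (S n) * Z.of_nat M) <= Z.of_nat (S n) * z <= Z.of_nat (S n) * Z.of_nat M)%Z) by nia.
    assert (EG : (Z.of_nat G = Z.of_nat (S n) * Z.of_nat M + 2)%Z) by (unfold G; lia).
    unfold zu. destruct (lt_dec x n) as [lx|], (lt_dec y n) as [ly|]; try tauto.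
    + destruct (Hu' x lx) as [[A1 ->]|[A1 ->]], (Hu' y ly) as [[B1 ->]|[B1 ->]]; try tauto; lia.
    + destruct (Hu' x lx) as [[A1 ->]|[A1 ->]]; try tauto; lia.
    + destruct (Hu' y ly) as [[A1 ->]|[A1 ->]]; try tauto; lia.
Qed.

Definition nv (D : nat) (u : nat -> nat) : valuation := fun x => INR (u x) / INR D.

Lemma gridrep_eqv n M v u : gridrep n M v u -> eqv n M v (nv (S n) u).
Proof.
  intros H x y Hx Hy z Hz. rewrite (H x y Hx Hy z Hz).
  assert (HD : 0 < INR (S n)) by (apply lt_0_INR; lia).
  assert (E : forall t, ext n (nv (S n) u) t = IZR (zu n u t) / INR (S n)).
  { intros t. unfold ext, zu, nv. destruct lt_dec.
    - rewrite INR_IZR_INZ. auto.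
    - unfold Rdiv. simpl. lra. }
  rewrite !E.
  replace (IZR (zu n u x) / INR (S n) - IZR (zu n u y) / INR (S n))
    with (IZR (zu n u x - zu n u y) / INR (S n)) by (rewrite minus_IZR; field; lra).
  split; intros H1.
  - apply IZR_lt in H1. rewrite mult_IZR, <- INR_IZR_INZ in H1.
    apply Rmult_lt_reg_r with (INR (S n)); auto. unfold Rdiv. rewrite Rmult_assoc, Rinv_l; lra.
  - apply Rmult_lt_compat_r with (r := INR (S n)) in H1; auto.
    unfold Rdiv in H1. rewrite Rmult_assoc, Rinv_l, Rmult_1_r in H1 by lra.
    rewrite INR_IZR_INZ, <- mult_IZR in H1. apply lt_IZR in H1. lia.
Qed.

(* The delay is added to the grid as an extra clock, which leaves room between the old values. *)
Lemma grid_delay n M v d : vnonneg n v -> 0 <= d ->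
  exists (h : nat -> nat) (dl : nat),
    (forall x, (x < n)%nat -> (h x <= gbound (S n) M)%nat) /\ (dl <= gbound (S n) M)%nat /\
    eqv n M v (nv (S (S n)) h) /\
    eqv n M (delay v d) (delay (nv (S (S n)) h) (INR dl / INR (S (S n)))).
Proof.
  intros Hv Hd.
  pose (v1 := fun x => if lt_dec x n then v x + d else d).
  destruct (gridrep_bounded (S n) M v1) as [u [Hu Hb]].
  { intros x Hx. unfold v1. destruct lt_dec; auto. specialize (Hv x l). lra. }
  apply gridrep_eqv in Hu.
  assert (HD : 0 < INR (S (S n))) by (apply lt_0_INR; lia).
  assert (Ev1 : forall x, (x < n)%nat -> v1 x = v x + d) by (intros; unfold v1; destruct lt_dec; [auto|lia]).
  assert (Evn : v1 n = d) by (unfold v1; destruct lt_dec; [lia|auto]).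
  assert (Hle : forall x, (x < n)%nat -> (u n <= u x)%nat).
  { intros x Hx. destruct (eqv_diff _ _ _ _ x n 0%Z Hu ltac:(lia) ltac:(lia) ltac:(lia)) as [E _].
    rewrite Ev1, Evn in E by auto. specialize (Hv x Hx).
    apply INR_le. apply Rnot_lt_le. intros Hlt.
    assert (nv (S (S n)) u x - nv (S (S n)) u n < 0).
    { unfold nv, Rdiv. apply Rmult_lt_compat_r with (r := / INR (S (S n))) in Hlt; [lra|].
      apply Rinv_0_lt_compat; auto. }
    apply E in H. lra. }
  assert (Eh : forall x, (x < n)%nat -> nv (S (S n)) (fun x => u x - u n)%nat x
      = nv (S (S n)) u x - nv (S (S n)) u n).
  { intros x Hx. unfold nv. rewrite minus_INR by auto. field. lra. }
  exists (fun x => u x - u n)%nat, (u n). split; [|split; [|split]].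
  - intros x Hx. specialize (Hb x ltac:(lia)). lia.
  - apply Hb. lia.
  - intros x y Hx Hy z Hz.
    unfold ext. destruct (lt_dec x n) as [lx|], (lt_dec y n) as [ly|]; rewrite ?Eh by auto.
    + destruct (eqv_diff _ _ _ _ x y z Hu ltac:(lia) ltac:(lia) Hz) as [E _].
      rewrite !Ev1 in E by auto.
      replace (v x + d - (v y + d)) with (v x - v y) in E by ring. rewrite E.
      split; intros; lra.
    + destruct (eqv_diff _ _ _ _ x n z Hu ltac:(lia) ltac:(lia) Hz) as [E _].
      rewrite Ev1, Evn in E by auto.
      replace (v x + d - d) with (v x - 0) in E by ring. rewrite E. split; intros; lra.
    + destruct (eqv_diff _ _ _ _ n y z Hu ltac:(lia) ltac:(lia) Hz) as [E _].
      rewrite Evn, Ev1 in E by auto.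
      replace (d - (v y + d)) with (0 - v y) in E by ring. rewrite E. split; intros; lra.
    + tauto.
  - assert (Eq : forall x, (x < n)%nat -> delay (nv (S (S n)) (fun x => u x - u n)%nat) (INR (u n) / INR (S (S n))) x
        = nv (S (S n)) u x).
    { intros x Hx. unfold delay. rewrite Eh by auto. unfold nv. lra. }
    intros x y Hx Hy z Hz. unfold ext.
    destruct (lt_dec x n) as [lx|], (lt_dec y n) as [ly|]; rewrite ?Eq by auto; unfold delay.
    + destruct (eqv_diff _ _ _ _ x y z Hu ltac:(lia) ltac:(lia) Hz) as [E _].
      rewrite !Ev1 in E by auto. exact E.
    + destruct (eqv_one _ _ _ _ x z Hu ltac:(lia) Hz) as [E _]. rewrite Ev1 in E by auto.
      rewrite !Rminus_0_r. exact E.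
    + destruct (eqv_one _ _ _ _ y (- z)%Z Hu ltac:(lia) ltac:(lia)) as [_ E].
      rewrite Ev1, opp_IZR in E by auto.
      split; intros; [assert (nv (S (S n)) u y > - IZR z)|assert (v y + d > - IZR z)]; try lra; apply E; lra.
    + tauto.
Qed.

(** * The tick game, in arithmetic *)

Open Scope nat_scope.

Section Nat.
Variable k : nat.

(** Pairing dominates its arguments, so every clock index and every constant of an automaton is at
    most its code [w]. [MM w] is also at least 1, as is needed to compare a timer with 1. *)
Definition nT w := S w.
Definition nC w := nT w + k.
Definition MM (w : nat) := S w.
Definition DD w := S (S (nC w)).
Definition GB w := S (S (S (nC w)) * (S (S (nC w)) * MM w + 2)).

(* Clocks below [nT w] belong to the automaton, the next [k] ones are the timers. Grid values are
   natural numbers with time unit [DD w]. [cvalue] is the value of clock [x] after delay [dl] and the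
   reset of the list [L] and of the timers in [B1] and [B2]; clock [nC w] is constantly 0. *)
Definition cvalue w h dl L B1 B2 x :=
  (1 - chi (nC w <= x \/ (inlc x L \/ (nT w <= x /\ (bit B1 (x - nT w) /\ bit B2 (x - nT w)))))) *
  (digit (GB w) h x + dl).

(** The integer constant of a comparison is [z2 - z1]; its two parts stand on opposite sides so that
    only sums of naturals occur. *)
Definition eqN w h dl L B1 B2 g := forall x, x < S (nC w) -> forall y, y < S (nC w) ->
  forall z1, z1 < S (MM w) -> forall z2, z2 < S (MM w) ->
  (cvalue w h dl L B1 B2 x + DD w * z1 < cvalue w h dl L B1 B2 y + DD w * z2 <->
   cvalue w g 0 0 0 0 x + DD w * z1 < cvalue w g 0 0 0 0 y + DD w * z2).

(** Positive and negative part of the integer coded by [e]: [enc_Z] gives even codes to nonnegative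
    integers and odd ones to negative integers. *)
Definition posp e := (1 - e mod 2) * (e / 2).
Definition negp e := (e mod 2) * ((e + 1) / 2).

Definition cmpN w o A B e :=
  (o = 0 /\ A + DD w * negp e < B + DD w * posp e) \/
  ((o = 1 /\ A + DD w * negp e <= B + DD w * posp e) \/
  ((o = 2 /\ A + DD w * negp e = B + DD w * posp e) \/
  ((o = 3 /\ B + DD w * posp e <= A + DD w * negp e) \/
  (o = 4 /\ B + DD w * posp e < A + DD w * negp e)))).

Definition gval w h dl x := digit (GB w) h x + dl.

(** One step of evaluation, with the values of the immediate subformulas read from [tt]. Guessing
    the whole table replaces recursion on formulas and keeps [gsat] a bounded formula. *)
Definition gloc w h dl tt c :=
  pf c = 0 \/
  ((pf c = 1 /\ cmpN w (pf (ps (ps c))) (gval w h dl (pf (ps c))) 0 (ps (ps (ps c)))) \/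
  ((pf c = 2 /\ cmpN w (pf (ps (ps (ps c)))) (gval w h dl (pf (ps c)))
      (gval w h dl (pf (ps (ps c)))) (ps (ps (ps (ps c))))) \/
  ((pf c = 3 /\ ~ bit tt (ps c)) \/
  ((pf c = 4 /\ (bit tt (pf (ps c)) /\ bit tt (ps (ps c)))) \/
  (pf c = 5 /\ (bit tt (pf (ps c)) \/ bit tt (ps (ps c)))))))).

(* [tt] is a truth table for all codes up to [c]. *)
Definition gsat w h dl c := exists tt, tt < 2 ^ S c /\
  ((forall c', c' < S c -> (bit tt c' <-> gloc w h dl tt c')) /\ bit tt c).

(* A configuration: location, whether a final location was seen since the last event, set of
   active timers, grid valuation. *)
Definition qloc q := pf q.
Definition qf q := pf (ps q).
Definition qA q := pf (ps (ps q)).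
Definition qg q := ps (ps (ps q)).
Definition qmk l f A g := npair l (npair f (npair A g)).

Definition rsrc r := pf r.
Definition rlab r := pf (ps r).
Definition rgd r := pf (ps (ps r)).
Definition rrs r := pf (ps (ps (ps r))).
Definition rtg r := ps (ps (ps (ps r))).

Definition wna w := pf w.
Definition wnb w := pf (ps w).
Definition wini w := pf (ps (ps w)).
Definition wfin w := pf (ps (ps (ps w))).
Definition wrul w := ps (ps (ps (ps w))).

(** The delay starts from another representative [h] of the same region, since the given grid point
    may leave no room for it; by [grid_delay] values below [GB w] suffice. Here a timer may have
    reached 1, whereas a letter requires all due ticks to have happened. *)
Definition silN w q q' := exists h, h < GB w ^ nC w /\ exists dl, dl < GB w /\
  (eqN w h 0 0 0 0 (qg q) /\
  ((forall x, x < k -> bit (qA q) x -> gval w h dl (nT w + x) <= DD w) /\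
  exists r, r < S w /\ (inlc r (wrul w) /\ (rsrc r = qloc q /\ (rlab r = 0 /\
    (gsat w h dl (rgd r) /\ (qloc q' = rtg r /\ (qA q' = qA q /\
    (((inlc (rtg r) (wfin w) /\ qf q' = 1) \/ (~ inlc (rtg r) (wfin w) /\ qf q' = qf q)) /\
     eqN w h dl (rrs r) 0 0 (qg q')))))))))).

(* Events: [npair 0 (npair a O)] is letter [a] when [O] is the set of active timers equal to 0, and
   [npair 1 Z] the tick of the set [Z] of active timers equal to 1. Answers are [npair b Y]; for a
   letter the timers in [Y] are reset, for a tick those in [Z] and [Y] are restarted. *)
Definition letN w e r q q' h dl :=
  (pf e = 0 /\ (pf (ps e) < wna w /\
  ((forall x, x < k -> bit (qA q) x -> gval w h dl (nT w + x) < DD w) /\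
  ((forall x, x < k -> (bit (ps (ps e)) x <-> bit (qA q) x /\ gval w h dl (nT w + x) = 0)) /\
  exists ru, ru < S w /\ (inlc ru (wrul w) /\ (rsrc ru = qloc q /\
    (rlab ru = S (npair (pf (ps e)) (pf r)) /\
    (gsat w h dl (rgd ru) /\ (qloc q' = rtg ru /\
    ((forall x, x < k -> (bit (qA q') x <-> bit (qA q) x \/ bit (ps r) x)) /\
    (qf q' = chi (inlc (rtg ru) (wfin w)) /\
     eqN w h dl (rrs ru) (ps r) (ps r) (qg q')))))))))))).

Definition tickN w e r q q' h dl :=
  (pf e = 1 /\ ((exists x, x < k /\ bit (ps e) x) /\
  ((forall x, x < k -> bit (qA q) x -> gval w h dl (nT w + x) <= DD w) /\
  ((forall x, x < k -> (bit (ps e) x <-> bit (qA q) x /\ gval w h dl (nT w + x) = DD w)) /\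
  (qloc q' = qloc q /\
  ((forall x, x < k -> (bit (qA q') x <-> bit (qA q) x /\ (bit (ps e) x -> bit (ps r) x))) /\
  (qf q' = 0 /\ eqN w h dl 0 (ps e) (ps r) (qg q')))))))).

Definition evN w e r q q' := exists h, h < GB w ^ nC w /\ exists dl, dl < GB w /\
  (eqN w h 0 0 0 0 (qg q) /\ (letN w e r q q' h dl \/ tickN w e r q q' h dl)).

Definition NQm w := S (npair w (npair 1 (npair (2 ^ k) (GB w ^ nC w)))).
Definition NQ w := S k + NQm w.
Definition NE w := S (npair 1 (npair w (2 ^ k))).
Definition NR w := S (npair w (2 ^ k)).

(* Rank indices: 0 is the waiting state, [S x] with [x < k] the monitor that counts the
   consecutive restarts of timer [x], and [S k + q] the configuration [q]. *)
Definition silP w p p' := S k <= p /\ (S k <= p' /\ silN w (p - S k) (p' - S k)).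
(** At any event the waiting state may pass to the monitor of a timer, and the monitor has no
    successor when a letter resets that timer. So some run marks infinitely many steps in the
    monitor exactly if the timer is restarted infinitely often by ticks and reset only finitely
    often by letters. *)
Definition evP w e r p p' :=
  (p = 0 /\ p' < S k) \/
  ((0 < p /\ (p < S k /\ (p' = p /\ (pf e = 0 -> ~ bit (ps r) (p - 1))))) \/
  (S k <= p /\ (S k <= p' /\ evN w e r (p - S k) (p' - S k)))).
Definition cntP e r p :=
  (0 < p /\ (p < S k /\ (pf e = 1 /\ (bit (ps e) (p - 1) /\ bit (ps r) (p - 1))))) \/
  (S k <= p /\ 0 < qf (p - S k)).
Definition iniP w p := p < S k \/ (S k <= p /\ (inlc (qloc (p - S k)) (wini w) /\
  (qf (p - S k) = 0 /\ ((forall x, x < k -> bit (qA (p - S k)) x) /\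
   eqN w 0 0 0 0 0 (qg (p - S k)))))).
Definition allowP w e r := pf e = 0 -> pf (ps e) < wna w -> pf r < wnb w.

Definition KK w := Kb (NQ w).
Definition NB w := (KK w + 2) ^ NQ w.
(** Digits run up to [KK w + 1]; this last value stands for a state of which nothing is promised,
    whence the guards [<= KK w] below. *)
Definition rkd w b p := digit (KK w + 2) b p.

Definition okev w X b e := exists r, r < NR w /\ (allowP w e r /\
  exists b', b' < NB w /\ (bit X b' /\
    forall p, p < NQ w -> forall p', p' < NQ w -> evP w e r p p' -> rkd w b p <= KK w ->
      rkd w b' p' + chi (cntP e r p) <= rkd w b p)).

Definition Solv w := exists X, X < 2 ^ NB w /\
  ((exists b, b < NB w /\ (bit X b /\ forall p, p < NQ w -> iniP w p -> rkd w b p <= KK w)) /\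
  forall b, b < NB w -> bit X b ->
    (forall p, p < NQ w -> forall p', p' < NQ w -> silP w p p' -> rkd w b p' <= rkd w b p) /\
    forall e, e < NE w -> okev w X b e).

(** * Computability of the arithmetical game *)

Lemma PR_chi n P : Dec n P -> PR n (fun a => chi (P a)).
Proof. auto. Qed.

Ltac base := first [ pr_code | match goal with
  | |- PR _ (fun a => chi _) => apply PR_chi
  | |- Dec _ (fun a => inlc _ _) => apply (Dec_c2 inlc _ _ _ D2_inlc)
  end ].
Ltac pr_user ::= base.

Lemma F1_nT : F1 nT. Proof. unfold nT. pr. Qed.
Lemma F1_nC : F1 nC. Proof. unfold nC, nT. pr. Qed.
Lemma F1_MM : F1 MM. Proof. unfold MM. pr. Qed.
Lemma F1_DD : F1 DD. Proof. unfold DD, nC, nT. pr. Qed.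
Lemma F1_GB : F1 GB. Proof. unfold GB, nC, nT, MM. pr. Qed.
Ltac base1 := first [ base | match goal with
  | |- PR _ (fun a => nT _) => apply (PR_c1 nT _ _ F1_nT)
  | |- PR _ (fun a => nC _) => apply (PR_c1 nC _ _ F1_nC)
  | |- PR _ (fun a => MM _) => apply (PR_c1 MM _ _ F1_MM)
  | |- PR _ (fun a => DD _) => apply (PR_c1 DD _ _ F1_DD)
  | |- PR _ (fun a => GB _) => apply (PR_c1 GB _ _ F1_GB) end ].
Ltac pr_user ::= base1.

Lemma PR_cvalue n g1 g2 g3 g4 g5 g6 g7 : PR n g1 -> PR n g2 -> PR n g3 -> PR n g4 -> PR n g5 ->
  PR n g6 -> PR n g7 -> PR n (fun a => cvalue (g1 a) (g2 a) (g3 a) (g4 a) (g5 a) (g6 a) (g7 a)).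
Proof.
  intros. assert (H7 : PR 7 (fun a => cvalue (get 0 a) (get 1 a) (get 2 a) (get 3 a) (get 4 a) (get 5 a) (get 6 a))).
  { unfold cvalue. pr. }
  eapply PR_ext; [|apply (PR_comp n 7 _ [g1; g2; g3; g4; g5; g6; g7] H7); repeat constructor; auto]. reflexivity.
Qed.

Lemma Dec_eqN n g1 g2 g3 g4 g5 g6 g7 : PR n g1 -> PR n g2 -> PR n g3 -> PR n g4 -> PR n g5 ->
  PR n g6 -> PR n g7 -> Dec n (fun a => eqN (g1 a) (g2 a) (g3 a) (g4 a) (g5 a) (g6 a) (g7 a)).
Proof.
  intros. assert (H7 : Dec 7 (fun a => eqN (get 0 a) (get 1 a) (get 2 a) (get 3 a) (get 4 a) (get 5 a) (get 6 a))).
  { unfold eqN. pr; apply PR_cvalue; pr. }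
  eapply PR_ext; [|apply (PR_comp n 7 _ [g1; g2; g3; g4; g5; g6; g7] H7); repeat constructor; auto]. reflexivity.
Qed.

Lemma D5_cmpN : D5 cmpN.
Proof. unfold cmpN, negp, posp. pr. Qed.
Lemma F4_gval : F4 gval.
Proof. unfold gval. pr. Qed.
Ltac base2 := first [ base1 | match goal with
  | |- PR _ (fun a => gval _ _ _ _) => apply (PR_c4 gval _ _ _ _ _ F4_gval)
  | |- Dec _ (fun a => eqN _ _ _ _ _ _ _) => apply Dec_eqN
  | |- Dec _ (fun a => cmpN _ _ _ _ _) => apply (Dec_c5 cmpN _ _ _ _ _ _ D5_cmpN) end ].
Ltac pr_user ::= base2.
Lemma D5_gloc : D5 gloc.
Proof. unfold gloc. pr. Qed.
Lemma D4_gsat : D4 gsat.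
Proof.
  pose proof D5_gloc as HD. unfold gsat. pr.
  apply (Dec_c5 gloc _ _ _ _ _ _ HD); pr.
Qed.
Ltac base3 := first [ base2 | match goal with
  | |- Dec _ (fun a => gsat _ _ _ _) => apply (Dec_c4 gsat _ _ _ _ _ D4_gsat) end ].
Ltac pr_user ::= base3.

Lemma D3_silN : D3 silN.
Proof. unfold silN, qloc, qf, qA, qg, rsrc, rlab, rgd, rrs, rtg, wna, wnb, wini, wfin, wrul. pr. Qed.
Lemma D5_evN : D5 evN.
Proof.
  unfold evN, letN, tickN, qloc, qf, qA, qg, rsrc, rlab, rgd, rrs, rtg, wna, wnb, wini, wfin, wrul. pr.
Qed.
Lemma F1_NQ : F1 NQ. Proof. unfold NQ, NQm. pr. Qed.
Lemma F1_NE : F1 NE. Proof. unfold NE. pr. Qed.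
Lemma F1_NR : F1 NR. Proof. unfold NR. pr. Qed.
Ltac base4 := first [ base3 | match goal with
  | |- PR _ (fun a => NQ _) => apply (PR_c1 NQ _ _ F1_NQ)
  | |- PR _ (fun a => NE _) => apply (PR_c1 NE _ _ F1_NE)
  | |- PR _ (fun a => NR _) => apply (PR_c1 NR _ _ F1_NR)
  | |- Dec _ (fun a => silN _ _ _) => apply (Dec_c3 silN _ _ _ _ D3_silN)
  | |- Dec _ (fun a => evN _ _ _ _ _) => apply (Dec_c5 evN _ _ _ _ _ _ D5_evN) end ].
Ltac pr_user ::= base4.
Lemma D3_silP : D3 silP. Proof. unfold silP. pr. Qed.
Lemma D5_evP : D5 evP. Proof. unfold evP. pr. Qed.
Lemma D3_cntP : D3 cntP. Proof. unfold cntP, qf. pr. Qed.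
Lemma D2_iniP : D2 iniP. Proof. unfold iniP, qloc, qf, qA, qg, wini. pr. Qed.
Lemma D3_allowP : D3 allowP. Proof. unfold allowP, wna, wnb. pr. Qed.
Lemma F1_KK : F1 KK. Proof. unfold KK, Kb, MB. pr. Qed.
Ltac base5 := first [ base4 | match goal with
  | |- PR _ (fun a => KK _) => apply (PR_c1 KK _ _ F1_KK)
  | |- Dec _ (fun a => silP _ _ _) => apply (Dec_c3 silP _ _ _ _ D3_silP)
  | |- Dec _ (fun a => evP _ _ _ _ _) => apply (Dec_c5 evP _ _ _ _ _ _ D5_evP)
  | |- Dec _ (fun a => cntP _ _ _) => apply (Dec_c3 cntP _ _ _ _ D3_cntP)
  | |- Dec _ (fun a => iniP _ _) => apply (Dec_c2 iniP _ _ _ D2_iniP)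
  | |- Dec _ (fun a => allowP _ _ _) => apply (Dec_c3 allowP _ _ _ _ D3_allowP) end ].
Ltac pr_user ::= base5.
Lemma F1_NB : F1 NB. Proof. unfold NB. pr. Qed.
Lemma F3_rkd : F3 rkd. Proof. unfold rkd. pr. Qed.
Ltac base6 := first [ base5 | match goal with
  | |- PR _ (fun a => NB _) => apply (PR_c1 NB _ _ F1_NB)
  | |- PR _ (fun a => rkd _ _ _) => apply (PR_c3 rkd _ _ _ _ F3_rkd) end ].
Ltac pr_user ::= base6.
Lemma D4_okev : D4 okev.
Proof. unfold okev. pr. Qed.
Lemma D1_Solv : D1 Solv.
Proof.
  pose proof D4_okev as HD. unfold Solv. pr.
  apply (Dec_c4 okev _ _ _ _ _ HD); pr.
Qed.

Theorem decidable_Solv {T : Type} (enc : T -> nat) : decidable_pred enc (fun t => Solv (enc t)).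
Proof.
  destruct D1_Solv as [c Hc]. exists c. intros t. specialize (Hc [enc t] eq_refl). cbn [get hd] in Hc.
  split; intros H; [rewrite chi_true in Hc|rewrite chi_false in Hc]; auto.
Qed.
End Nat.

(** * The tick game over real valuations *)

Open Scope R_scope.

Lemma clocks_below_mono n m c : (n <= m)%nat -> clocks_below n c -> clocks_below m c.
Proof. intros H. induction c; simpl; intuition lia. Qed.
Lemma consts_below_mono n m c : (n <= m)%nat -> consts_below n c -> consts_below m c.
Proof. intros H. induction c; simpl; intuition lia. Qed.

Lemma enc_Z_abs z : (Z.abs z <= Z.of_nat (enc_Z z))%Z.
Proof. unfold enc_Z. destruct (Z.leb_spec 0 z); lia. Qed.

Lemma enc_cc_clocks c : clocks_below (S (enc_cc c)) c.
Proof.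
  induction c; cbn [enc_cc clocks_below]; auto.
  - pose proof (npair_ge_sum 1 (npair n (npair (enc_cmp c) (enc_Z z)))).
    pose proof (npair_ge_sum n (npair (enc_cmp c) (enc_Z z))). lia.
  - pose proof (npair_ge_sum 2 (npair n (npair n0 (npair (enc_cmp c) (enc_Z z))))).
    pose proof (npair_ge_sum n (npair n0 (npair (enc_cmp c) (enc_Z z)))).
    pose proof (npair_ge_sum n0 (npair (enc_cmp c) (enc_Z z))). lia.
  - apply clocks_below_mono with (2 := IHc). pose proof (npair_ge_sum 3 (enc_cc c)). lia.
  - pose proof (npair_ge_sum 4 (npair (enc_cc c1) (enc_cc c2))). pose proof (npair_ge_sum (enc_cc c1) (enc_cc c2)).
    split; [apply clocks_below_mono with (2 := IHc1)|apply clocks_below_mono with (2 := IHc2)]; lia.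
  - pose proof (npair_ge_sum 5 (npair (enc_cc c1) (enc_cc c2))). pose proof (npair_ge_sum (enc_cc c1) (enc_cc c2)).
    split; [apply clocks_below_mono with (2 := IHc1)|apply clocks_below_mono with (2 := IHc2)]; lia.
Qed.

Lemma enc_cc_consts c : consts_below (enc_cc c) c.
Proof.
  induction c; cbn [enc_cc consts_below]; auto.
  - pose proof (npair_ge_sum 1 (npair n (npair (enc_cmp c) (enc_Z z)))).
    pose proof (npair_ge_sum n (npair (enc_cmp c) (enc_Z z))).
    pose proof (npair_ge_sum (enc_cmp c) (enc_Z z)). pose proof (enc_Z_abs z). lia.
  - pose proof (npair_ge_sum 2 (npair n (npair n0 (npair (enc_cmp c) (enc_Z z))))).
    pose proof (npair_ge_sum n (npair n0 (npair (enc_cmp c) (enc_Z z)))).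
    pose proof (npair_ge_sum n0 (npair (enc_cmp c) (enc_Z z))).
    pose proof (npair_ge_sum (enc_cmp c) (enc_Z z)). pose proof (enc_Z_abs z). lia.
  - apply consts_below_mono with (2 := IHc). pose proof (npair_ge_sum 3 (enc_cc c)). lia.
  - pose proof (npair_ge_sum 4 (npair (enc_cc c1) (enc_cc c2))). pose proof (npair_ge_sum (enc_cc c1) (enc_cc c2)).
    split; [apply consts_below_mono with (2 := IHc1)|apply consts_below_mono with (2 := IHc2)]; lia.
  - pose proof (npair_ge_sum 5 (npair (enc_cc c1) (enc_cc c2))). pose proof (npair_ge_sum (enc_cc c1) (enc_cc c2)).
    split; [apply consts_below_mono with (2 := IHc1)|apply consts_below_mono with (2 := IHc2)]; lia.
Qed.

Section Spec.
Variable k : nat.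
Variable T : TA.
Notation w := (enc_TA T).
Notation n := (nC k w).
Notation M := (MM w).
Notation D := (DD k w).
Notation nTw := (nT w).

Lemma wna_enc : wna w = ta_na T.
Proof. unfold wna, enc_TA. apply pf_npair. Qed.
Lemma wnb_enc : wnb w = ta_nb T.
Proof. unfold wnb, enc_TA. rewrite ps_npair, pf_npair. auto. Qed.
Lemma wini_enc : wini w = enc_list (ta_init T).
Proof. unfold wini, enc_TA. rewrite !ps_npair, pf_npair. auto. Qed.
Lemma wfin_enc : wfin w = enc_list (ta_final T).
Proof. unfold wfin, enc_TA. rewrite !ps_npair, pf_npair. auto. Qed.
Lemma wrul_enc : wrul w = enc_list (map enc_rule (ta_rules T)).
Proof. unfold wrul, enc_TA. rewrite !ps_npair. auto. Qed.

Lemma w_bounds : (ta_na T <= w /\ ta_nb T <= w /\ enc_list (ta_init T) <= w /\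
  enc_list (map enc_rule (ta_rules T)) <= w)%nat.
Proof.
  rewrite <- wna_enc, <- wnb_enc, <- wini_enc, <- wrul_enc. unfold wna, wnb, wini, wrul.
  pose proof (pf_le w). pose proof (ps_le w). pose proof (pf_le (ps w)). pose proof (ps_le (ps w)).
  pose proof (pf_le (ps (ps w))). pose proof (ps_le (ps (ps w))). pose proof (ps_le (ps (ps (ps w)))). lia.
Qed.

Lemma rule_lt ru : In ru (ta_rules T) -> (enc_rule ru < S w)%nat.
Proof.
  intros H. apply (in_map enc_rule) in H. apply in_le_enc in H. pose proof w_bounds. lia.
Qed.

Lemma enc_rule_fields ru : rsrc (enc_rule ru) = r_src ru /\ rlab (enc_rule ru) = enc_lab (r_lab ru) /\
  rgd (enc_rule ru) = enc_cc (r_guard ru) /\ rrs (enc_rule ru) = enc_list (r_reset ru) /\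
  rtg (enc_rule ru) = r_tgt ru.
Proof.
  unfold rsrc, rlab, rgd, rrs, rtg, enc_rule. rewrite !ps_npair, !pf_npair. auto.
Qed.

Lemma rule_bounds ru : In ru (ta_rules T) ->
  (enc_cc (r_guard ru) <= w /\ (forall x, In x (r_reset ru) -> x < nTw) /\ r_tgt ru <= w)%nat.
Proof.
  intros H. apply rule_lt in H. destruct (enc_rule_fields ru) as [_ [_ [E1 [E2 E3]]]].
  rewrite <- E1, <- E3. unfold rgd, rrs, rtg in *. set (e := enc_rule ru) in *.
  pose proof (ps_le e). pose proof (ps_le (ps e)). pose proof (pf_le (ps (ps e))).
  pose proof (ps_le (ps (ps e))). pose proof (ps_le (ps (ps (ps e)))). pose proof (pf_le (ps (ps (ps e)))).
  split; [lia|split; [|lia]]. intros x Hx. apply in_le_enc in Hx. unfold nT. lia.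
Qed.

Lemma guard_eqv ru u v : In ru (ta_rules T) -> eqv n M u v -> (sat u (r_guard ru) <-> sat v (r_guard ru)).
Proof.
  intros H E. destruct (rule_bounds ru H) as [B _]. apply (eqv_sat n M); auto.
  - apply clocks_below_mono with (2 := enc_cc_clocks _). unfold nC, nT. lia.
  - apply consts_below_mono with (2 := enc_cc_consts _). unfold MM. lia.
Qed.

Lemma ex_rule (P : nat -> Prop) :
  (exists r, (r < S w)%nat /\ (inlc r (wrul w) /\ P r)) <-> exists ru, In ru (ta_rules T) /\ P (enc_rule ru).
Proof.
  rewrite wrul_enc. split.
  - intros [r [_ [H1 H2]]]. apply inlc_enc in H1. apply in_map_iff in H1. destruct H1 as [ru [<- H1]]. eauto.
  - intros [ru [H1 H2]]. exists (enc_rule ru). split; [apply rule_lt; auto|]. split; auto.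
    apply inlc_enc, in_map; auto.
Qed.

Definition gv g : valuation := nv D (fun x => digit (GB k w) g x).
Definition gd h dl : valuation := delay (gv h) (INR dl / INR D).

Lemma D_pos : 0 < INR D.
Proof. apply lt_0_INR. unfold DD. lia. Qed.

Lemma gd_gval h dl x : gd h dl x = INR (gval k w h dl x) / INR D.
Proof. unfold gd, delay, gv, nv, gval. rewrite plus_INR. pose proof D_pos. field. lra. Qed.

Lemma div_lt_iff a b : INR a / INR D < b <-> INR a < b * INR D.
Proof.
  pose proof D_pos. unfold Rdiv. split; intros.
  - apply Rmult_lt_compat_r with (r := INR D) in H0; auto. rewrite Rmult_assoc, Rinv_l in H0; lra.
  - apply Rmult_lt_reg_r with (INR D); auto. rewrite Rmult_assoc, Rinv_l; lra.
Qed.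

Lemma cmp_scaled A B P N :
  (INR A / INR D - INR B / INR D < INR P - INR N <-> (A + D * N < B + D * P)%nat).
Proof.
  pose proof D_pos. replace (INR A / INR D - INR B / INR D) with ((INR A - INR B) / INR D) by (field; lra).
  assert (E : (A + D * N < B + D * P)%nat <-> INR A + INR D * INR N < INR B + INR D * INR P).
  { rewrite <- !mult_INR, <- !plus_INR. split; [apply lt_INR|apply INR_lt]. }
  rewrite E. unfold Rdiv. split; intros.
  - apply Rmult_lt_compat_r with (r := INR D) in H0; auto. rewrite Rmult_assoc, Rinv_l in H0; lra.
  - apply Rmult_lt_reg_r with (INR D); auto. rewrite Rmult_assoc, Rinv_l; lra.
Qed.

Lemma gval_one h dl x :
  ((gval k w h dl x < D)%nat <-> gd h dl x < 1) /\ (gval k w h dl x = D <-> gd h dl x = 1) /\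
  (gval k w h dl x = 0%nat <-> gd h dl x = 0) /\ ((gval k w h dl x <= D)%nat <-> gd h dl x <= 1).
Proof.
  rewrite gd_gval. pose proof D_pos. set (g := gval k w h dl x).
  assert (E : forall a, INR g = a * INR D <-> INR g / INR D = a).
  { intros a. split; intros H1; [rewrite H1; field; lra|rewrite <- H1; field; lra]. }
  assert (E1 : (g < D)%nat <-> INR g < INR D) by (split; [apply lt_INR|apply INR_lt]).
  assert (E2 : g = D <-> INR g = INR D) by (split; [intros ->; auto|apply INR_eq]).
  assert (E0 : g = 0%nat <-> INR g = 0) by (split; [intros ->; auto|intros H1; apply INR_eq; simpl; auto]).
  assert (C1 : (g < D)%nat <-> INR g / INR D < 1) by (rewrite div_lt_iff, E1; split; lra).
  assert (C2 : g = D <-> INR g / INR D = 1) by (rewrite <- E, E2; split; lra).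
  split; auto. split; auto. split.
  - rewrite <- E, E0. split; lra.
  - split; intros H1.
    + destruct (Nat.eq_dec g D) as [H2|H2]; [apply C2 in H2; lra|].
      assert (H3 : (g < D)%nat) by lia. apply C1 in H3. lra.
    + destruct (Req_dec (INR g / INR D) 1) as [H2|H2]; [apply C2 in H2; lia|].
      assert (H3 : INR g / INR D < 1) by lra. apply C1 in H3. lia.
Qed.

Lemma enc_Z_pn z : IZR z = INR (posp (enc_Z z)) - INR (negp (enc_Z z)).
Proof.
  unfold posp, negp, enc_Z. destruct (Z.leb_spec 0 z).
  - replace (2 * Z.to_nat z)%nat with (Z.to_nat z * 2)%nat by lia.
    rewrite Nat.Div0.mod_mul, Nat.div_mul by lia.
    replace (1 - 0)%nat with 1%nat by lia. rewrite Nat.mul_1_l, Nat.mul_0_l. simpl (INR 0).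
    rewrite INR_IZR_INZ, Z2Nat.id by auto. lra.
  - set (m := Z.to_nat (- z)). assert (Hm : (0 < m)%nat) by (unfold m; lia).
    assert (E : (2 * m - 1 = 1 + (m - 1) * 2)%nat) by lia. rewrite E.
    rewrite Nat.Div0.mod_add. change (1 mod 2)%nat with 1%nat.
    replace (1 + (m - 1) * 2 + 1)%nat with (m * 2)%nat by lia. rewrite Nat.div_mul by lia.
    rewrite Nat.mul_1_l, Nat.sub_diag, Nat.mul_0_l. simpl (INR 0). unfold m.
    rewrite INR_IZR_INZ, Z2Nat.id, opp_IZR by lia. lra.
Qed.

Lemma cmpN_spec o A B z :
  cmpN k w (enc_cmp o) A B (enc_Z z) <-> cmpR o (INR A / INR D - INR B / INR D) (IZR z).
Proof.
  rewrite enc_Z_pn. set (P := posp (enc_Z z)). set (N := negp (enc_Z z)).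
  pose proof (cmp_scaled A B P N) as C1. pose proof (cmp_scaled B A N P) as C2.
  unfold cmpN. fold P N. destruct o; cbn [enc_cmp cmpR]; split; intros H;
    repeat match goal with H : _ \/ _ |- _ => destruct H end; try (exfalso; lia);
    repeat match goal with H : _ /\ _ |- _ => destruct H end; try discriminate.
  - apply C1; auto.
  - left. split; auto. apply C1; auto.
  - apply Rnot_lt_le. intros H1. assert (H2 : INR B / INR D - INR A / INR D < INR N - INR P) by lra.
    apply C2 in H2. lia.
  - right. left. split; auto. apply Nat.nlt_ge. intros H1. apply C2 in H1. lra.
  - assert (~ (INR A / INR D - INR B / INR D < INR P - INR N)) by (rewrite C1; lia).
    assert (~ (INR B / INR D - INR A / INR D < INR N - INR P)) by (rewrite C2; lia). lra.
  - right. right. left. split; auto.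
    assert (~ (A + D * N < B + D * P)%nat) by (rewrite <- C1; lra).
    assert (~ (B + D * P < A + D * N)%nat) by (rewrite <- C2; lra). lia.
  - apply Rle_ge, Rnot_lt_le. intros H1. apply C1 in H1. lia.
  - right. right. right. left. split; auto. apply Nat.nlt_ge. intros H1. apply C1 in H1. lra.
  - apply C2 in H0. lra.
  - right. right. right. right. split; auto. apply C2. lra.
Qed.

(** Compound constraints carry a positive tag, so their subformulas have smaller codes. This makes
    the truth table definable from the bottom up. *)
Lemma gloc_local h dl tt tt' c : (forall c', (c' < c)%nat -> (bit tt c' <-> bit tt' c')) ->
  (gloc k w h dl tt c <-> gloc k w h dl tt' c).
Proof.
  intros H. unfold gloc.
  assert (Hps : (0 < pf c)%nat -> (ps c < c)%nat) by apply ps_lt.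
  pose proof (pf_le (ps c)). pose proof (ps_le (ps c)).
  assert (A3 : pf c = 3%nat -> (bit tt (ps c) <-> bit tt' (ps c))) by (intros; apply H; lia).
  assert (A4 : (0 < pf c)%nat -> (bit tt (pf (ps c)) <-> bit tt' (pf (ps c)))) by (intros; apply H; lia).
  assert (A5 : (0 < pf c)%nat -> (bit tt (ps (ps c)) <-> bit tt' (ps (ps c)))) by (intros; apply H; lia).
  destruct (pf c) as [|[|[|[|[|[|p]]]]]]; try (intuition lia);
    try (specialize (A3 eq_refl)); try (specialize (A4 ltac:(lia)); specialize (A5 ltac:(lia)));
    intuition (try lia; try discriminate).
Qed.

Lemma truth_table h dl m : exists tt, (tt < 2 ^ m)%nat /\
  forall c, (c < m)%nat -> (bit tt c <-> gloc k w h dl tt c).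
Proof.
  induction m as [|m [tt [H1 H2]]].
  - exists 0%nat. split; [simpl; lia|]. intros; lia.
  - exists (setc (fun c => if lt_dec c m then bit tt c else gloc k w h dl tt c) (S m)).
    split; [apply setc_lt|].
    assert (Hb : forall c, (c < m)%nat ->
      (bit (setc (fun c => if lt_dec c m then bit tt c else gloc k w h dl tt c) (S m)) c <-> bit tt c)).
    { intros c Hc. rewrite bit_setc. destruct lt_dec; [|lia]. intuition lia. }
    intros c Hc. destruct (Nat.eq_dec c m) as [->|Hne].
    + rewrite bit_setc. destruct (lt_dec m m); [lia|].
      rewrite (gloc_local h dl _ tt m Hb). intuition lia.
    + rewrite Hb by lia. rewrite H2 by lia. symmetry. apply gloc_local.
      intros c' Hc'. apply Hb. lia.
Qed.

Lemma table_sat h dl m tt : (forall c, (c < m)%nat -> (bit tt c <-> gloc k w h dl tt c)) ->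
  forall c, (enc_cc c < m)%nat -> (bit tt (enc_cc c) <-> sat (gd h dl) c).
Proof.
  intros H c. induction c; intros Hm; rewrite H by auto; unfold gloc; cbn [enc_cc sat];
    rewrite ?pf_npair, ?ps_npair, ?pf_npair, ?ps_npair, ?pf_npair, ?ps_npair, ?pf_npair, ?ps_npair.
  - intuition.
  - rewrite cmpN_spec, gd_gval. simpl (INR 0). unfold Rdiv at 2. rewrite Rmult_0_l, Rminus_0_r.
    intuition (try discriminate).
  - rewrite cmpN_spec, !gd_gval. intuition (try discriminate).
  - cbn [enc_cc] in Hm. pose proof (npair_ge_sum 3 (enc_cc c)). specialize (IHc ltac:(lia)).
    rewrite IHc. intuition (try discriminate).
  - cbn [enc_cc] in Hm. pose proof (npair_ge_sum 4 (npair (enc_cc c1) (enc_cc c2))).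
    pose proof (npair_ge_sum (enc_cc c1) (enc_cc c2)).
    specialize (IHc1 ltac:(lia)). specialize (IHc2 ltac:(lia)). rewrite IHc1, IHc2. intuition (try discriminate).
  - cbn [enc_cc] in Hm. pose proof (npair_ge_sum 5 (npair (enc_cc c1) (enc_cc c2))).
    pose proof (npair_ge_sum (enc_cc c1) (enc_cc c2)).
    specialize (IHc1 ltac:(lia)). specialize (IHc2 ltac:(lia)). rewrite IHc1, IHc2. intuition (try discriminate).
Qed.

Lemma gsat_spec h dl c : gsat k w h dl (enc_cc c) <-> sat (gd h dl) c.
Proof.
  unfold gsat. split.
  - intros [tt [_ [H1 H2]]]. apply (table_sat h dl _ tt H1); auto.
  - intros Hs. destruct (truth_table h dl (S (enc_cc c))) as [tt [H1 H2]].
    exists tt. split; auto. split; auto. apply (table_sat h dl _ tt H2); auto.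
Qed.

Definition tmr B1 B2 := map (fun x => (nTw + x)%nat)
  (filter (fun x => andb (Nat.eqb (digit 2 B1 x) 1) (Nat.eqb (digit 2 B2 x) 1)) (seq 0 k)).

Lemma in_tmr B1 B2 x : In x (tmr B1 B2) <->
  (nTw <= x < n)%nat /\ bit B1 (x - nTw) /\ bit B2 (x - nTw).
Proof.
  unfold tmr, bit. rewrite in_map_iff. split.
  - intros [y [<- Hy]]. apply filter_In in Hy. destruct Hy as [H1 H2]. apply in_seq in H1.
    apply andb_prop in H2. destruct H2 as [H2 H3]. apply Nat.eqb_eq in H2, H3.
    replace (nTw + y - nTw)%nat with y by lia. unfold nC. repeat split; auto; lia.
  - intros [H1 [H2 H3]]. exists (x - nTw)%nat. split; [lia|]. apply filter_In. split.
    + apply in_seq. unfold nC in H1. lia.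
    + rewrite H2, H3. auto.
Qed.

Lemma tmr_00 : tmr 0 0 = nil.
Proof.
  destruct (tmr 0 0) as [|y l0] eqn:E; auto. exfalso.
  assert (In y (tmr 0 0)) by (rewrite E; left; auto). apply in_tmr in H. destruct H as [_ [H _]].
  unfold bit in H. rewrite (digit_high 2 0 _ 0) in H; simpl; lia.
Qed.

Lemma in_tmr_shift B1 B2 x : (x < k)%nat -> (In (nTw + x)%nat (tmr B1 B2) <-> bit B1 x /\ bit B2 x).
Proof.
  intros Hx. rewrite in_tmr. replace (nTw + x - nTw)%nat with x by lia. unfold nC. intuition lia.
Qed.

Lemma cvalue_spec h dl l B1 B2 x : (x <= n)%nat ->
  INR (cvalue k w h dl (enc_list l) B1 B2 x) / INR D = ext n (reset (l ++ tmr B1 B2) (gd h dl)) x.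
Proof.
  intros Hx. unfold cvalue. fold (gval k w h dl x).
  assert (E : (n <= x)%nat \/ inlc x (enc_list l) \/ ((nTw <= x)%nat /\ bit B1 (x - nTw) /\ bit B2 (x - nTw)) <->
              ~ (x < n)%nat \/ In x (l ++ tmr B1 B2)).
  { rewrite inlc_enc, in_app_iff, in_tmr. split; intros H; destruct (le_lt_dec n x); intuition lia. }
  rewrite (chi_iff _ _ E). unfold ext, reset, chi.
  destruct excluded_middle_informative as [H|H]; destruct (lt_dec x n); try destruct in_dec; try tauto.
  - rewrite Nat.sub_diag, Nat.mul_0_l. simpl. unfold Rdiv. lra.
  - rewrite Nat.sub_diag, Nat.mul_0_l. simpl. unfold Rdiv. lra.
  - rewrite Nat.sub_0_r, Nat.mul_1_l, gd_gval. auto.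
Qed.

Lemma gd_0 h x : gd h 0 x = gv h x.
Proof. unfold gd, delay, Rdiv. simpl. lra. Qed.

Lemma eqN_spec h dl l B1 B2 g :
  eqN k w h dl (enc_list l) B1 B2 g <-> eqv n M (reset (l ++ tmr B1 B2) (gd h dl)) (gv g).
Proof.
  assert (G : forall x, (x <= n)%nat -> INR (cvalue k w g 0 0 0 0 x) / INR D = ext n (gv g) x).
  { intros x Hx. change 0%nat with (enc_list nil) at 2. rewrite cvalue_spec by auto.
    rewrite tmr_00. unfold ext, reset. destruct lt_dec; auto. simpl. apply gd_0. }
  unfold eqN, eqv. split.
  - intros H x y Hx Hy z Hz.
    rewrite <- !cvalue_spec, <- !G by auto.
    pose (z2 := Z.to_nat (Z.max 0 z)). pose (z1 := Z.to_nat (Z.max 0 (- z))).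
    assert (Ez : IZR z = INR z2 - INR z1).
    { unfold z1, z2. rewrite !INR_IZR_INZ, !Z2Nat.id, <- minus_IZR by lia. f_equal. lia. }
    rewrite Ez, !cmp_scaled. apply H; unfold z1, z2; lia.
  - intros H x Hx y Hy z1 Hz1 z2 Hz2.
    specialize (H x y ltac:(lia) ltac:(lia) (Z.of_nat z2 - Z.of_nat z1)%Z ltac:(lia)).
    rewrite <- !cvalue_spec, <- !G, minus_IZR, <- !INR_IZR_INZ, !cmp_scaled in H by lia. exact H.
Qed.

Lemma eqN_plain h g : eqN k w h 0 0 0 0 g <-> eqv n M (gv h) (gv g).
Proof.
  change 0%nat with (enc_list nil) at 2. rewrite eqN_spec.
  assert (E : eqv n M (reset (nil ++ tmr 0 0) (gd h 0)) (gv h)).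
  { rewrite tmr_00. apply eqv_ext. intros x Hx. apply gd_0. }
  split; intros H; eapply eqv_trans; eauto using eqv_sym.
Qed.

(** [rsil], [rlet] and [rtick] are the moves of the arithmetical game at a real valuation [u], taken
    after the delay. The target valuation is fixed only up to region equivalence. *)
Definition rsil (l f A : nat) (u : valuation) (l' f' A' : nat) (u' : valuation) : Prop :=
  (forall x, (x < k)%nat -> bit A x -> u (nTw + x)%nat <= 1) /\
  exists ru, In ru (ta_rules T) /\ r_src ru = l /\ r_lab ru = None /\ sat u (r_guard ru) /\
    l' = r_tgt ru /\ A' = A /\
    ((In (r_tgt ru) (ta_final T) /\ f' = 1%nat) \/ (~ In (r_tgt ru) (ta_final T) /\ f' = f)) /\
    eqv n M (reset (r_reset ru) u) u'.

Definition rlet (a O b Y : nat) (l A : nat) (u : valuation) (l' f' A' : nat) (u' : valuation) : Prop :=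
  (a < ta_na T)%nat /\
  (forall x, (x < k)%nat -> bit A x -> u (nTw + x)%nat < 1) /\
  (forall x, (x < k)%nat -> (bit O x <-> bit A x /\ u (nTw + x)%nat = 0)) /\
  exists ru, In ru (ta_rules T) /\ r_src ru = l /\ r_lab ru = Some (a, b) /\ sat u (r_guard ru) /\
    l' = r_tgt ru /\ (forall x, (x < k)%nat -> (bit A' x <-> bit A x \/ bit Y x)) /\
    f' = chi (In (r_tgt ru) (ta_final T)) /\
    eqv n M (reset (r_reset ru ++ tmr Y Y) u) u'.

Definition rtick (Z Y : nat) (l A : nat) (u : valuation) (l' f' A' : nat) (u' : valuation) : Prop :=
  (exists x, (x < k)%nat /\ bit Z x) /\
  (forall x, (x < k)%nat -> bit A x -> u (nTw + x)%nat <= 1) /\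
  (forall x, (x < k)%nat -> (bit Z x <-> bit A x /\ u (nTw + x)%nat = 1)) /\
  l' = l /\ (forall x, (x < k)%nat -> (bit A' x <-> bit A x /\ (bit Z x -> bit Y x))) /\
  f' = 0%nat /\ eqv n M (reset (tmr Z Y) u) u'.

Definition rstep (e r l A : nat) (u : valuation) (l' f' A' : nat) (u' : valuation) : Prop :=
  (pf e = 0%nat /\ rlet (pf (ps e)) (ps (ps e)) (pf r) (ps r) l A u l' f' A' u') \/
  (pf e = 1%nat /\ rtick (ps e) (ps r) l A u l' f' A' u').

Lemma silN_spec q q' : silN k w q q' <-> exists h dl, (h < GB k w ^ n)%nat /\ (dl < GB k w)%nat /\
  eqv n M (gv h) (gv (qg q)) /\
  rsil (qloc q) (qf q) (qA q) (gd h dl) (qloc q') (qf q') (qA q') (gv (qg q')).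
Proof.
  assert (Core : forall h dl,
    ((forall x, (x < k)%nat -> bit (qA q) x -> (gval k w h dl (nT w + x) <= DD k w)%nat) /\
    exists r, (r < S w)%nat /\ (inlc r (wrul w) /\ (rsrc r = qloc q /\ (rlab r = 0%nat /\
      (gsat k w h dl (rgd r) /\ (qloc q' = rtg r /\ (qA q' = qA q /\
      (((inlc (rtg r) (wfin w) /\ qf q' = 1%nat) \/ (~ inlc (rtg r) (wfin w) /\ qf q' = qf q)) /\
       eqN k w h dl (rrs r) 0 0 (qg q'))))))))) <->
    rsil (qloc q) (qf q) (qA q) (gd h dl) (qloc q') (qf q') (qA q') (gv (qg q'))).
  { intros h dl. unfold rsil. rewrite ex_rule.
    assert (E1 : (forall x, (x < k)%nat -> bit (qA q) x -> (gval k w h dl (nT w + x) <= DD k w)%nat) <->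
      (forall x, (x < k)%nat -> bit (qA q) x -> gd h dl (nTw + x)%nat <= 1)).
    { split; intros H x Hx Hb; apply gval_one; auto. }
    rewrite E1. apply and_iff_compat_l.
    split; intros [ru [Hru H]]; exists ru; split; auto;
      destruct (enc_rule_fields ru) as [F1 [F2 [F3 [F4 F5]]]];
      rewrite F1, F2, F3, F4, F5, gsat_spec, eqN_spec, wfin_enc, inlc_enc, tmr_00, app_nil_r in *.
    - destruct H as [H1 [H2 H3]]. split; auto. split; auto.
      destruct (r_lab ru) as [[a b]|]; auto. discriminate.
    - destruct H as [H1 [H2 H3]]. split; auto. rewrite H2. split; auto. }
  unfold silN. split.
  - intros [h [Hh [dl [Hdl [H1 H2]]]]]. exists h, dl. rewrite eqN_plain in H1. rewrite <- Core. auto.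
  - intros [h [dl [Hh [Hdl [H1 H2]]]]]. exists h. split; auto. exists dl. split; auto.
    rewrite eqN_plain. rewrite <- Core in H2. auto.
Qed.

Lemma letN_spec e r q q' h dl : letN k w e r q q' h dl <->
  pf e = 0%nat /\ rlet (pf (ps e)) (ps (ps e)) (pf r) (ps r) (qloc q) (qA q) (gd h dl)
    (qloc q') (qf q') (qA q') (gv (qg q')).
Proof.
  unfold letN, rlet. rewrite wna_enc, ex_rule. apply and_iff_compat_l, and_iff_compat_l.
  assert (E1 : (forall x, (x < k)%nat -> bit (qA q) x -> (gval k w h dl (nT w + x) < DD k w)%nat) <->
      (forall x, (x < k)%nat -> bit (qA q) x -> gd h dl (nTw + x)%nat < 1)).
  { split; intros H x Hx Hb; apply gval_one; auto. }
  assert (E2 : (forall x, (x < k)%nat -> (bit (ps (ps e)) x <-> bit (qA q) x /\ gval k w h dl (nT w + x) = 0%nat)) <->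
      (forall x, (x < k)%nat -> (bit (ps (ps e)) x <-> bit (qA q) x /\ gd h dl (nTw + x)%nat = 0))).
  { split; intros H x Hx; rewrite H by auto; destruct (gval_one h dl (nTw + x)) as [_ [_ [G _]]]; rewrite G; tauto. }
  rewrite E1, E2. apply and_iff_compat_l, and_iff_compat_l.
  split; intros [ru [Hru H]]; exists ru; split; auto;
    destruct (enc_rule_fields ru) as [F1 [F2 [F3 [F4 F5]]]];
    rewrite F1, F2, F3, F4, F5, gsat_spec, eqN_spec, wfin_enc in *;
    rewrite (chi_iff _ _ (inlc_enc (r_tgt ru) (ta_final T))) in *.
  - destruct H as [H1 [H2 H3]]. split; auto. split; auto.
    destruct (r_lab ru) as [[a b]|]; [|discriminate]. cbn [enc_lab] in H2. injection H2 as H2.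
    pose proof (f_equal pf H2) as Ha. pose proof (f_equal ps H2) as Hb.
    rewrite !pf_npair in Ha. rewrite !ps_npair in Hb. rewrite Ha, Hb. auto.
  - destruct H as [H1 [H2 H3]]. split; auto. rewrite H2. split; auto.
Qed.

Lemma tickN_spec e r q q' h dl : tickN k w e r q q' h dl <->
  pf e = 1%nat /\ rtick (ps e) (ps r) (qloc q) (qA q) (gd h dl)
    (qloc q') (qf q') (qA q') (gv (qg q')).
Proof.
  unfold tickN, rtick. apply and_iff_compat_l, and_iff_compat_l.
  assert (E1 : (forall x, (x < k)%nat -> bit (qA q) x -> (gval k w h dl (nT w + x) <= DD k w)%nat) <->
      (forall x, (x < k)%nat -> bit (qA q) x -> gd h dl (nTw + x)%nat <= 1)).
  { split; intros H x Hx Hb; apply gval_one; auto. }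
  assert (E2 : (forall x, (x < k)%nat -> (bit (ps e) x <-> bit (qA q) x /\ gval k w h dl (nT w + x) = D)) <->
      (forall x, (x < k)%nat -> (bit (ps e) x <-> bit (qA q) x /\ gd h dl (nTw + x)%nat = 1))).
  { split; intros H x Hx; rewrite H by auto; destruct (gval_one h dl (nTw + x)) as [_ [G _]]; rewrite G; tauto. }
  rewrite E1, E2. change 0%nat with (enc_list nil) at 2. rewrite eqN_spec. tauto.
Qed.

Lemma evN_spec e r q q' : evN k w e r q q' <-> exists h dl, (h < GB k w ^ n)%nat /\ (dl < GB k w)%nat /\
  eqv n M (gv h) (gv (qg q)) /\
  rstep e r (qloc q) (qA q) (gd h dl) (qloc q') (qf q') (qA q') (gv (qg q')).
Proof.
  unfold evN, rstep. split.
  - intros [h [Hh [dl [Hdl [H1 H2]]]]]. exists h, dl. rewrite eqN_plain in H1.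
    rewrite letN_spec, tickN_spec in H2. auto.
  - intros [h [dl [Hh [Hdl [H1 H2]]]]]. exists h. split; auto. exists dl. split; auto.
    rewrite eqN_plain, letN_spec, tickN_spec. auto.
Qed.

Lemma timer_eqv u v x : eqv n M u v -> (x < k)%nat ->
  (u (nTw + x)%nat <= 1 <-> v (nTw + x)%nat <= 1) /\ (u (nTw + x)%nat < 1 <-> v (nTw + x)%nat < 1) /\
  (u (nTw + x)%nat = 0 <-> v (nTw + x)%nat = 0) /\ (u (nTw + x)%nat = 1 <-> v (nTw + x)%nat = 1).
Proof.
  intros H Hx.
  destruct (eqv_one n M u v (nTw + x) 0 H ltac:(unfold nC; lia) ltac:(unfold MM; lia)) as [A1 A2].
  destruct (eqv_one n M u v (nTw + x) 1 H ltac:(unfold nC; lia) ltac:(unfold MM; lia)) as [B1 B2].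
  pose proof (cmpR_iff CEq _ _ _ _ A1 A2) as A3. pose proof (cmpR_iff CEq _ _ _ _ B1 B2) as B3.
  pose proof (cmpR_iff CLe _ _ _ _ B1 B2) as B4. simpl in *. tauto.
Qed.

Lemma rsil_eqv l f A u v l' f' A' u' v' : eqv n M u v -> eqv n M u' v' ->
  rsil l f A u l' f' A' u' -> rsil l f A v l' f' A' v'.
Proof.
  intros E E' [H1 [ru [H2 [H3 [H4 [H5 [H6 [H7 [H8 H9]]]]]]]]]. split.
  - intros x Hx Hb. apply (timer_eqv u v x E Hx). auto.
  - exists ru. split; auto. split; auto. split; auto.
    split; [apply (guard_eqv ru u v); auto|]. split; auto. split; auto. split; auto.
    eapply eqv_trans; [|exact E']. eapply eqv_trans; [|exact H9]. apply eqv_reset, eqv_sym, E.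
Qed.

Lemma rstep_eqv e r l A u v l' f' A' u' v' : eqv n M u v -> eqv n M u' v' ->
  rstep e r l A u l' f' A' u' -> rstep e r l A v l' f' A' v'.
Proof.
  intros E E' [[He H]|[He H]]; [left|right]; split; auto.
  - destruct H as [H0 [H1 [H1' [ru [H2 [H3 [H4 [H5 [H6 [H7 [H8 H9]]]]]]]]]]].
    split; auto. split; [|split].
    + intros x Hx Hb. apply (timer_eqv u v x E Hx). auto.
    + intros x Hx. rewrite H1' by auto. destruct (timer_eqv u v x E Hx) as [_ [_ [G _]]]. rewrite G. tauto.
    + exists ru. split; auto. split; auto. split; auto. split; [apply (guard_eqv ru u v); auto|].
      split; auto. split; auto. split; auto.
      eapply eqv_trans; [|exact E']. eapply eqv_trans; [|exact H9]. apply eqv_reset, eqv_sym, E.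
  - destruct H as [H1 [H2 [H3 [H4 [H5 [H6 H7]]]]]].
    split; auto. split; [|split; [|split; [|split; [|split]]]]; auto.
    + intros x Hx Hb. apply (timer_eqv u v x E Hx). auto.
    + intros x Hx. rewrite H3 by auto. destruct (timer_eqv u v x E Hx) as [_ [_ [_ G]]]. rewrite G. tauto.
    + eapply eqv_trans; [|exact E']. eapply eqv_trans; [|exact H7]. apply eqv_reset, eqv_sym, E.
Qed.

Lemma gv_vec h : (forall x, (x < n)%nat -> (h x < GB k w)%nat) ->
  exists g, (g < GB k w ^ n)%nat /\ eqv n M (nv D h) (gv g).
Proof.
  intros H. exists (vec h n (GB k w)). assert (0 < GB k w)%nat by (unfold GB; lia).
  split; [apply vec_lt; auto|]. apply eqv_ext. intros x Hx. unfold gv, nv.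
  rewrite digit_vec, Nat.mod_small by auto. auto.
Qed.

Lemma grid_step J d : vnonneg n J -> 0 <= d ->
  exists h dl, (h < GB k w ^ n)%nat /\ (dl < GB k w)%nat /\ eqv n M J (gv h) /\ eqv n M (delay J d) (gd h dl).
Proof.
  intros HJ Hd. destruct (grid_delay n M J d HJ Hd) as [h [dl [H1 [H2 [H3 H4]]]]].
  assert (HG : forall x, (x < n)%nat -> (h x < GB k w)%nat).
  { intros x Hx. specialize (H1 x Hx). unfold GB, gbound in *. lia. }
  destruct (gv_vec h HG) as [g [Hg E]].
  assert (Ep : forall x, (x < n)%nat -> gv (vec h n (GB k w)) x = nv D h x).
  { intros x Hx. unfold gv, nv. rewrite digit_vec, Nat.mod_small; auto. unfold GB; lia. }
  exists (vec h n (GB k w)), dl. assert (0 < GB k w)%nat by (unfold GB; lia).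
  split; [apply vec_lt; auto|]. split; [unfold GB, gbound in *; lia|]. split.
  - eapply eqv_trans; [exact H3|]. apply eqv_ext. intros. symmetry. auto.
  - eapply eqv_trans; [exact H4|]. apply eqv_ext. intros x Hx. unfold gd, delay. rewrite Ep; auto.
Qed.

Lemma qmk_fields l f A g : qloc (qmk l f A g) = l /\ qf (qmk l f A g) = f /\ qA (qmk l f A g) = A /\
  qg (qmk l f A g) = g.
Proof. unfold qloc, qf, qA, qg, qmk. rewrite !ps_npair, !pf_npair. auto. Qed.

Lemma config_exists l f A J : (l <= w)%nat -> (f <= 1)%nat -> (A <= 2 ^ k)%nat -> vnonneg n J ->
  exists q, (q < NQm k w)%nat /\ qloc q = l /\ qf q = f /\ qA q = A /\ eqv n M J (gv (qg q)).
Proof.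
  intros Hl Hf HA HJ. destruct (grid_step J 0 HJ ltac:(lra)) as [g [_ [Hg [_ [E _]]]]].
  exists (qmk l f A g). destruct (qmk_fields l f A g) as [-> [-> [-> ->]]].
  split; auto. unfold NQm, qmk. apply Nat.lt_succ_r. repeat apply npair_le; auto. lia.
Qed.

(** [sil_fwd] and [ev_fwd] follow real moves on the grid and serve to analyse the controller built
    from ranks. [sil_bwd] and [ev_bwd] realise grid moves by real delays and turn a lost tick game
    into a timed play. *)
Lemma sil_fwd q J d l' f' A' J' : vnonneg n J -> eqv n M J (gv (qg q)) -> 0 <= d ->
  rsil (qloc q) (qf q) (qA q) (delay J d) l' f' A' J' -> vnonneg n J' ->
  (l' <= w)%nat -> (f' <= 1)%nat -> (A' <= 2 ^ k)%nat ->
  exists q', (q' < NQm k w)%nat /\ qloc q' = l' /\ qf q' = f' /\ qA q' = A' /\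
    eqv n M J' (gv (qg q')) /\ silN k w q q'.
Proof.
  intros HJ E Hd H HJ' Hl Hf HA.
  destruct (config_exists l' f' A' J' Hl Hf HA HJ') as [q' [Hq [<- [<- [<- E']]]]].
  exists q'. do 5 (split; [auto|]). apply silN_spec.
  destruct (grid_step J d HJ Hd) as [h [dl [Hh [Hdl [E1 E2]]]]].
  exists h, dl. split; [auto|]. split; [auto|]. split.
  - eapply eqv_trans; [apply eqv_sym, E1|exact E].
  - eapply rsil_eqv; eauto.
Qed.

Lemma ev_fwd e r q J d l' f' A' J' : vnonneg n J -> eqv n M J (gv (qg q)) -> 0 <= d ->
  rstep e r (qloc q) (qA q) (delay J d) l' f' A' J' -> vnonneg n J' ->
  (l' <= w)%nat -> (f' <= 1)%nat -> (A' <= 2 ^ k)%nat ->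
  exists q', (q' < NQm k w)%nat /\ qloc q' = l' /\ qf q' = f' /\ qA q' = A' /\
    eqv n M J' (gv (qg q')) /\ evN k w e r q q'.
Proof.
  intros HJ E Hd H HJ' Hl Hf HA.
  destruct (config_exists l' f' A' J' Hl Hf HA HJ') as [q' [Hq [<- [<- [<- E']]]]].
  exists q'. do 5 (split; [auto|]). apply evN_spec.
  destruct (grid_step J d HJ Hd) as [h [dl [Hh [Hdl [E1 E2]]]]].
  exists h, dl. split; [auto|]. split; [auto|]. split.
  - eapply eqv_trans; [apply eqv_sym, E1|exact E].
  - eapply rstep_eqv; eauto.
Qed.

Lemma grid_lift q h dl J : vnonneg n J -> eqv n M J (gv (qg q)) -> eqv n M (gv h) (gv (qg q)) ->
  exists d, 0 <= d /\ eqv n M (gd h dl) (delay J d).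
Proof.
  intros HJ E1 E2.
  assert (E : eqv n M (gv h) J) by (eapply eqv_trans; [exact E2|apply eqv_sym, E1]).
  destruct (eqv_delay n M (gv h) J (INR dl / INR D) E) as [d [Hd H]].
  - apply eqv_vnonneg with M J; auto using eqv_sym.
  - pose proof D_pos. apply Rmult_le_pos; [apply pos_INR|]. left. apply Rinv_0_lt_compat. auto.
  - eauto.
Qed.

Lemma sil_bwd q q' J : vnonneg n J -> eqv n M J (gv (qg q)) -> silN k w q q' ->
  exists d, 0 <= d /\ rsil (qloc q) (qf q) (qA q) (delay J d) (qloc q') (qf q') (qA q') (gv (qg q')).
Proof.
  intros HJ E H. apply silN_spec in H. destruct H as [h [dl [_ [_ [E1 H]]]]].
  destruct (grid_lift q h dl J HJ E E1) as [d [Hd E2]].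
  exists d. split; auto. eapply rsil_eqv; eauto using eqv_refl.
Qed.

Lemma ev_bwd e r q q' J : vnonneg n J -> eqv n M J (gv (qg q)) -> evN k w e r q q' ->
  exists d, 0 <= d /\ rstep e r (qloc q) (qA q) (delay J d) (qloc q') (qf q') (qA q') (gv (qg q')).
Proof.
  intros HJ E H. apply evN_spec in H. destruct H as [h [dl [_ [_ [E1 H]]]]].
  destruct (grid_lift q h dl J HJ E E1) as [d [Hd E2]].
  exists d. split; auto. eapply rstep_eqv; eauto using eqv_refl.
Qed.

End Spec.

(** * From ranks to a controller *)

Lemma finite_argmax k (P : nat -> Prop) (f : nat -> R) : (exists x, (x < k)%nat /\ P x) ->
  exists x, (x < k)%nat /\ P x /\ forall y, (y < k)%nat -> P y -> f y <= f x.
Proof.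
  induction k as [|k IH]; intros [x [Hx Px]]; [lia|].
  destruct (classic (exists y, (y < k)%nat /\ P y)) as [H|H].
  - destruct (IH H) as [z [Hz [Pz Mz]]].
    destruct (classic (P k /\ f z < f k)) as [[Pk Hk]|Hk].
    + exists k. repeat split; auto. intros y Hy Py. destruct (Nat.eq_dec y k) as [->|]; [lra|].
      specialize (Mz y ltac:(lia) Py). lra.
    + exists z. repeat split; auto. intros y Hy Py. destruct (Nat.eq_dec y k) as [->|]; [|apply Mz; auto; lia].
      apply Rnot_lt_le. tauto.
  - assert (x = k) by (destruct (Nat.eq_dec x k); auto; exfalso; apply H; exists x; split; auto; lia).
    subst. exists k. repeat split; auto. intros y Hy Py.
    destruct (Nat.eq_dec y k) as [->|]; [lra|]. exfalso. apply H. exists y. split; auto. lia.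
Qed.

Section Controller.
Variable k : nat.
Variable T : TA.
Notation w := (enc_TA T).
Notation n := (nC k w).
Notation M := (MM w).
Notation nTw := (nT w).
Notation K := (KK k w).
Notation rk := (rkd k w).
Variable X : nat.

Definition inX b := (b < NB k w)%nat /\ bit X b.

Definition good_answer b e r b' := (r < NR k w)%nat /\ allowP w e r /\ inX b' /\
  forall p p', (p < NQ k w)%nat -> (p' < NQ k w)%nat -> evP k w e r p p' -> (rk b p <= K)%nat ->
      (rk b' p' + chi (cntP k e r p) <= rk b p)%nat.

Hypothesis X_sil : forall b, inX b -> forall p p', (p < NQ k w)%nat -> (p' < NQ k w)%nat ->
  silP k w p p' -> (rk b p' <= rk b p)%nat.
Hypothesis X_ev : forall b, inX b -> forall e, (e < NE k w)%nat -> exists r b', good_answer b e r b'.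
Variable b0 : nat.
Hypothesis X_b0 : inX b0.
Hypothesis X_ini : forall p, (p < NQ k w)%nat -> iniP k w p -> (rk b0 p <= K)%nat.

Lemma answer_ex b e : exists rb, inX b -> (e < NE k w)%nat -> good_answer b e (fst rb) (snd rb).
Proof.
  destruct (classic (inX b /\ (e < NE k w)%nat)) as [[H1 H2]|H].
  - destruct (X_ev b H1 e H2) as [r [b' H]]. exists (r, b'). auto.
  - exists (0%nat, 0%nat). tauto.
Qed.
Definition answer b e := proj1_sig (constructive_indefinite_description _ (answer_ex b e)).
Definition rsp b e := fst (answer b e).
Definition nxt b e := snd (answer b e).
Lemma answer_good b e : inX b -> (e < NE k w)%nat -> good_answer b e (rsp b e) (nxt b e).
Proof. exact (proj2_sig (constructive_indefinite_description _ (answer_ex b e))). Qed.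

(** Restart counts stay at most [K], since the rank of the monitor pays for every restart; the base
    leaves room for one more. *)
Definition CB := (K + 2)%nat.
Definition cdig c x := digit CB c x.

Lemma CB_pos : (0 < CB)%nat. Proof. unfold CB. lia. Qed.

(* Between letters, clock [x] of the controller has value [nu x] and its timer [nu x - cdig c x]; the
   next tick to be replayed is that of the timers with the largest excess. *)
Definition cand (nu : valuation) A c := exists x, (x < k)%nat /\ bit A x /\ INR (cdig c x) + 1 <= nu x.
Definition Zs (nu : valuation) A c := setc (fun x => bit A x /\ INR (cdig c x) + 1 <= nu x /\
  forall y, (y < k)%nat -> bit A y -> nu y - INR (cdig c y) <= nu x - INR (cdig c x)) k.

Definition tstate := (nat * nat * nat)%type.

Definition after_tick b A c Z : tstate :=
  let Y := ps (rsp b (npair 1 Z)) in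
  (nxt b (npair 1 Z), setc (fun x => bit A x /\ (bit Z x -> bit Y x)) k,
   vec (fun x => (cdig c x + chi (bit Z x /\ bit Y x))%nat) k CB).

Definition tstep nu (s : tstate) : tstate :=
  let '(b, A, c) := s in after_tick b A c (Zs nu A c).
Definition tcand nu (s : tstate) := let '(b, A, c) := s in cand nu A c.

Fixpoint loop F nu s := match F with
  | O => s
  | S F' => if excluded_middle_informative (tcand nu s) then loop F' nu (tstep nu s) else s end.

(** Each tick lowers the sum, over the active timers, of one plus the rank of the monitor, so there
    are at most this many ticks between two letters. *)
Definition fuel := (k * (K + 1))%nat.

(** A number that does not contain a rank function from [X] is read with [b0], so that the answers
    are legal for every memory value, as [valid_controller] demands. *)
Definition dec l : tstate :=
  ((if excluded_middle_informative (inX (pf l)) then pf l else b0), pf (ps l), ps (ps l)).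

Definition letter_of a (nu : valuation) A c :=
  npair 0 (npair a (setc (fun x => bit A x /\ nu x = INR (cdig c x)) k)).

Definition after_letter b A c e :=
  let Y := ps (rsp b e) in
  npair (nxt b e) (npair (setc (fun x => bit A x \/ bit Y x) k)
     (vec (fun x => ((1 - chi (bit Y x)) * cdig c x)%nat) k CB)).

Definition ylist Y := filter (fun x => Nat.eqb (digit 2 Y x) 1) (seq 0 k).

Definition delta l a nu : (nat * nat) * list nat :=
  let '(b, A, c) := loop fuel nu (dec l) in
  let e := letter_of a nu A c in
  ((after_letter b A c e, pf (rsp b e)), ylist (ps (rsp b e))).

Definition ctrl : controller :=
  mkCtrl (S (npair (NB k w) (npair (2 ^ k) (CB ^ k)))) (npair b0 (npair (setc (fun _ => True) k) 0)) delta.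

Lemma in_ylist Y x : In x (ylist Y) <-> (x < k)%nat /\ bit Y x.
Proof. unfold ylist, bit. rewrite filter_In, in_seq, Nat.eqb_eq. intuition lia. Qed.

Lemma tick_lt Z : (Z < 2 ^ k)%nat -> (npair 1 Z < NE k w)%nat.
Proof.
  intros H. unfold NE. apply Nat.lt_succ_r, npair_le; auto.
  pose proof (npair_ge_r w (2 ^ k)). lia.
Qed.
Lemma letter_lt a O : (a <= w)%nat -> (O < 2 ^ k)%nat -> (npair 0 (npair a O) < NE k w)%nat.
Proof. intros H1 H2. unfold NE. apply Nat.lt_succ_r. apply npair_le; [lia|apply npair_le; lia]. Qed.

Lemma loop_inX F nu s : inX (fst (fst s)) -> inX (fst (fst (loop F nu s))).
Proof.
  revert s. induction F as [|F IH]; intros [[b A] c] H; simpl; auto.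
  destruct excluded_middle_informative; auto. apply IH. simpl.
  apply (answer_good b (npair 1 (Zs nu A c))); auto. apply tick_lt, setc_lt.
Qed.

Lemma dec_inX l : inX (fst (fst (dec l))).
Proof. unfold dec. simpl. destruct excluded_middle_informative; auto. Qed.

(** The constant of the controller: clocks are compared with a restart count or its successor, and
    clock differences with differences of counts. *)
Definition m1 := S CB.

Lemma cmp_region nu nu' c x : eqv k m1 nu nu' -> (x < k)%nat ->
  (INR (cdig c x) + 1 <= nu x <-> INR (cdig c x) + 1 <= nu' x) /\
  (nu x = INR (cdig c x) <-> nu' x = INR (cdig c x)).
Proof.
  intros H Hx. assert (Hc : (cdig c x < CB)%nat) by apply digit_lt, CB_pos.
  destruct (eqv_one k m1 nu nu' x (Z.of_nat (cdig c x) + 1) H Hx) as [A1 A2]; [unfold m1; lia|].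
  destruct (eqv_one k m1 nu nu' x (Z.of_nat (cdig c x)) H Hx) as [B1 B2]; [unfold m1; lia|].
  pose proof (cmpR_iff CGe _ _ _ _ A1 A2) as A3. pose proof (cmpR_iff CEq _ _ _ _ B1 B2) as B3.
  simpl in A3, B3. rewrite plus_IZR, <- INR_IZR_INZ in A3. rewrite <- INR_IZR_INZ in B3.
  split; [|exact B3]. split; intros; apply Rge_le, A3; lra.
Qed.

Lemma cmp_region2 nu nu' c x y : eqv k m1 nu nu' -> (x < k)%nat -> (y < k)%nat ->
  (nu y - INR (cdig c y) <= nu x - INR (cdig c x) <-> nu' y - INR (cdig c y) <= nu' x - INR (cdig c x)).
Proof.
  intros H Hx Hy. assert (Hc : (cdig c x < CB)%nat) by apply digit_lt, CB_pos.
  assert (Hc' : (cdig c y < CB)%nat) by apply digit_lt, CB_pos.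
  destruct (eqv_diff k m1 nu nu' y x (Z.of_nat (cdig c y) - Z.of_nat (cdig c x)) H Hy Hx) as [A1 A2]; [unfold m1; lia|].
  pose proof (cmpR_iff CLe _ _ _ _ A1 A2) as A3. simpl in A3. rewrite minus_IZR, <- !INR_IZR_INZ in A3.
  split; intros H1.
  - assert (nu' y - nu' x <= INR (cdig c y) - INR (cdig c x)) by (apply A3; lra). lra.
  - assert (nu y - nu x <= INR (cdig c y) - INR (cdig c x)) by (apply A3; lra). lra.
Qed.

Lemma Zs_ext nu nu' A c : eqv k m1 nu nu' -> Zs nu A c = Zs nu' A c.
Proof.
  intros H. apply setc_ext. intros x Hx.
  destruct (cmp_region nu nu' c x H Hx) as [E _]. rewrite E.
  split; intros [H1 [H2 H3]]; (split; [auto|split; [auto|]]); intros y Hy Hb;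
    apply (cmp_region2 nu nu' c x y H Hx Hy); auto.
Qed.

Lemma cand_ext nu nu' A c : eqv k m1 nu nu' -> (cand nu A c <-> cand nu' A c).
Proof.
  intros H. split; intros [x [Hx [Hb Hl]]]; exists x; split; auto; split; auto;
    apply (cmp_region nu nu' c x H Hx); auto.
Qed.

Lemma loop_ext F nu nu' s : eqv k m1 nu nu' -> loop F nu s = loop F nu' s.
Proof.
  intros H. revert s. induction F as [|F IH]; intros [[b A] c]; simpl; auto.
  rewrite (Zs_ext nu nu' A c H), IH.
  pose proof (cand_ext nu nu' A c H).
  destruct (excluded_middle_informative (cand nu A c)), (excluded_middle_informative (cand nu' A c)); tauto.
Qed.

Lemma delta_ext l a nu nu' : eqv k m1 nu nu' -> delta l a nu = delta l a nu'.
Proof.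
  intros H. unfold delta. rewrite (loop_ext fuel nu nu' _ H).
  destruct (loop fuel nu' (dec l)) as [[b A] c].
  assert (E : letter_of a nu A c = letter_of a nu' A c).
  { unfold letter_of. do 2 f_equal. apply setc_ext. intros x Hx.
    destruct (cmp_region nu nu' c x H Hx) as [_ E]. rewrite E. tauto. }
  rewrite E. auto.
Qed.

Lemma mem_bound b A c : (b < NB k w)%nat -> (A < 2 ^ k)%nat -> (c < CB ^ k)%nat ->
  (npair b (npair A c) < c_size ctrl)%nat.
Proof. intros. simpl. apply Nat.lt_succ_r. repeat apply npair_le; lia. Qed.

Lemma ctrl_valid : valid_controller k m1 (ta_na T) (ta_nb T) ctrl.
Proof.
  split; [|split].
  - apply mem_bound; [apply X_b0|apply setc_lt|]. pose proof CB_pos.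
    apply Nat.neq_0_lt_0, Nat.pow_nonzero. lia.
  - intros l a v Hl Ha. simpl c_delta. unfold delta.
    pose proof (loop_inX fuel v (dec l) (dec_inX l)) as HX.
    destruct (loop fuel v (dec l)) as [[b A] c]. simpl in HX. cbn [fst snd].
    set (e := letter_of a v A c).
    assert (He : (e < NE k w)%nat).
    { apply letter_lt; [pose proof (w_bounds T); lia|apply setc_lt]. }
    destruct (answer_good b e HX He) as [_ [G2 [G3 _]]]. split; [|split].
    + apply mem_bound; [apply G3|apply setc_lt|apply vec_lt, CB_pos].
    + unfold allowP in G2. rewrite wna_enc, wnb_enc in G2. apply G2; unfold e, letter_of;
        rewrite ?ps_npair, ?pf_npair; auto.
    + intros y Hy. apply in_ylist in Hy. tauto.
  - intros l a v v' _ _ H. apply delta_ext, region_eqv. exact H.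
Qed.

(** * The controller wins *)

Section Play.
Variables (a : nat -> nat) (t : nat -> R).
Hypothesis a_lt : forall i, (a i < ta_na T)%nat.
Variables (r : nat -> rule) (tm : nat -> R) (loc : nat -> nat) (val : nat -> valuation) (g : nat -> nat).
Hypothesis run : is_run T r tm loc val.
Hypothesis g_inc : forall i, (g i < g (S i))%nat.
Hypothesis g_lab : forall i, r_lab (r (g i)) = Some (a i, canswer ctrl a t i) /\ tm (g i) = t i.
Hypothesis g_all : forall i, r_lab (r i) <> None -> exists j, g j = i.

Notation cs := (cstate ctrl a t).
Definition nu nn tau : valuation := delay (snd (cs nn)) (tau - prev t nn).

Inductive treach (v : valuation) (s0 : tstate) : nat -> tstate -> Prop :=
| tr0 : treach v s0 0 s0
| trS j s : treach v s0 j s -> tcand v s -> treach v s0 (S j) (tstep v s).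

Lemma Zs_max v A c x : cand v A c -> (x < k)%nat ->
  (bit (Zs v A c) x <-> bit A x /\ forall y, (y < k)%nat -> bit A y -> v y - INR (cdig c y) <= v x - INR (cdig c x)).
Proof.
  intros [z [Hz [Bz Lz]]] Hx. unfold Zs. rewrite bit_setc. split.
  - intros [_ [H1 [_ H2]]]. auto.
  - intros [H1 H2]. split; auto. split; auto. split; auto. specialize (H2 z Hz Bz). lra.
Qed.

(** A delay adds the same amount to all excesses, so the order in which timers ran out can be read
    off later: the ticks replayed at a letter are those that occurred on the way. *)
Lemma treach_later v v' d s0 j s : 0 <= d -> (forall x, (x < k)%nat -> v' x = v x + d) ->
  treach v s0 j s -> treach v' s0 j s.
Proof.
  intros Hd E. induction 1 as [|j [[b A] c] H IH Hc]; [constructor|].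
  assert (Hc' : cand v' A c).
  { destruct Hc as [x [Hx [Bx Lx]]]. exists x. split; auto. split; auto. rewrite E by auto. lra. }
  replace (tstep v (b, A, c)) with (tstep v' (b, A, c)); [constructor; auto|].
  simpl. f_equal. apply setc_ext. intros x Hx.
  pose proof (Zs_max v A c x Hc Hx) as Z1. pose proof (Zs_max v' A c x Hc' Hx) as Z2.
  unfold Zs in Z1, Z2. rewrite bit_setc in Z1, Z2.
  assert (EQ : (forall y, (y < k)%nat -> bit A y -> v y - INR (cdig c y) <= v x - INR (cdig c x)) <->
   (forall y, (y < k)%nat -> bit A y -> v' y - INR (cdig c y) <= v' x - INR (cdig c x))).
  { split; intros G y Hy By; specialize (G y Hy By); rewrite !E in * by auto; lra. }
  tauto.
Qed.

Lemma treach_loop v s0 j s F : treach v s0 j s -> ~ tcand v s -> (j <= F)%nat -> loop F v s0 = s.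
Proof.
  intros H Hn.
  assert (G : forall j s1, treach v s0 j s1 -> forall F, loop (j + F) v s0 = loop F v s1).
  { clear. induction 1 as [|j s H IH Hc]; intros F; auto.
    replace (S j + F)%nat with (j + S F)%nat by lia. rewrite IH. simpl.
    destruct excluded_middle_informative; tauto. }
  intros Hj. replace F with (j + (F - j))%nat by lia. rewrite (G j s H).
  destruct (F - j)%nat; simpl; auto. destruct excluded_middle_informative; tauto.
Qed.

Definition meas b A := bsum k (fun x => (chi (bit A x) * S (rk b (S x)))%nat).

(** The simulation before transition [i], after [nn] letters, at time [tau], with [j] ticks since
    the last letter. By [I_reach] the controller will replay just these ticks; by [I_tmr] a timer is
    its clock minus the number of restarts; [I_mon] and [I_meas] bound the restarts and the ticks by
    monitor ranks. *)
Record Inv (i nn : nat) (tau : R) (j b A c : nat) (J : valuation) (q : nat) : Prop := {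
  I_X : inX b;
  I_reach : treach (nu nn tau) (dec (fst (cs nn))) j (b, A, c);
  I_tau : prev tm i <= tau;
  I_J0 : vnonneg n J;
  I_J : forall x, (x < nTw)%nat -> J x = val i x + (tau - prev tm i);
  I_tmr : forall x, (x < k)%nat -> bit A x ->
     J (nTw + x)%nat = nu nn tau x - INR (cdig c x) /\ J (nTw + x)%nat <= 1;
  I_q : (q < NQm k w)%nat /\ qloc q = loc i /\ qA q = A /\ (qf q <= 1)%nat /\ eqv n M J (gv k T (qg q));
  I_A : (A < 2 ^ k)%nat;
  I_rk : (rk b (S k + q) <= K)%nat /\ (rk b 0 <= K)%nat;
  I_mon : forall x, (x < k)%nat -> (rk b (S x) <= K)%nat /\ (bit A x -> (cdig c x + rk b (S x) <= K)%nat);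
  I_meas : (j + meas b A <= fuel)%nat;
  I_let : (forall l, (l < nn)%nat -> (g l < i)%nat) /\ (i <= g nn)%nat }.

Arguments I_X {i nn tau j b A c J q}.
Arguments I_reach {i nn tau j b A c J q}.
Arguments I_tau {i nn tau j b A c J q}.
Arguments I_J0 {i nn tau j b A c J q}.
Arguments I_J {i nn tau j b A c J q}.
Arguments I_tmr {i nn tau j b A c J q}.
Arguments I_q {i nn tau j b A c J q}.
Arguments I_A {i nn tau j b A c J q}.
Arguments I_rk {i nn tau j b A c J q}.
Arguments I_mon {i nn tau j b A c J q}.
Arguments I_meas {i nn tau j b A c J q}.
Arguments I_let {i nn tau j b A c J q}.

(* Decreases at each event that follows a final location, and when one is first seen. *)
Definition Phi b q := (2 * rk b (S k + q) + (1 - qf q))%nat.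

Lemma nu_later nn tau tau' x : nu nn tau' x = nu nn tau x + (tau' - tau).
Proof. unfold nu, delay. lra. Qed.

Lemma NQ_main q : (q < NQm k w)%nat -> (S k + q < NQ k w)%nat.
Proof. unfold NQ. lia. Qed.
Lemma NQ_mon x : (x < k)%nat -> (S x < NQ k w)%nat.
Proof. unfold NQ, NQm. lia. Qed.

Lemma evP_main e rr q q' : evN k w e rr q q' -> evP k w e rr (S k + q) (S k + q').
Proof.
  intros H. right. right. split; [lia|]. split; [lia|].
  replace (S k + q - S k)%nat with q by lia. replace (S k + q' - S k)%nat with q' by lia. auto.
Qed.

Lemma cnt_main e rr q : (qf q <= 1)%nat -> chi (cntP k e rr (S k + q)) = qf q.
Proof.
  intros H. destruct (Nat.eq_dec (qf q) 0) as [E|E].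
  - rewrite E. apply chi_false. intros [H1|[_ H1]]; [lia|].
    replace (S k + q - S k)%nat with q in H1 by lia. lia.
  - replace (qf q) with 1%nat by lia. apply chi_true. right. split; [lia|].
    replace (S k + q - S k)%nat with q by lia. lia.
Qed.

Lemma ranks_after b e q q' : inX b -> (e < NE k w)%nat -> (q < NQm k w)%nat -> (q' < NQm k w)%nat ->
  (qf q <= 1)%nat ->
  evN k w e (rsp b e) q q' -> (rk b (S k + q) <= K)%nat -> (rk b 0 <= K)%nat ->
  (rk (nxt b e) (S k + q') + qf q <= rk b (S k + q))%nat /\ (rk (nxt b e) 0 <= K)%nat /\
  forall x, (x < k)%nat -> (rk (nxt b e) (S x) <= K)%nat.
Proof.
  intros Hb He Hq Hq' Hf Hev R1 R2. destruct (answer_good b e Hb He) as [_ [_ [_ G]]].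
  split; [|split].
  - pose proof (G _ _ (NQ_main q Hq) (NQ_main q' Hq') (evP_main _ _ _ _ Hev) R1) as H.
    rewrite cnt_main in H; auto.
  - assert (H0 : (0 < NQ k w)%nat) by (unfold NQ; lia).
    pose proof (G 0%nat 0%nat H0 H0 ltac:(left; split; lia) R2). lia.
  - intros x Hx. assert (H0 : (0 < NQ k w)%nat) by (unfold NQ; lia).
    pose proof (G 0%nat (S x) H0 (NQ_mon x Hx) ltac:(left; split; lia) R2). lia.
Qed.

Lemma monitor_after b e x : inX b -> (e < NE k w)%nat -> (x < k)%nat -> (rk b (S x) <= K)%nat ->
  (pf e = 0%nat -> ~ bit (ps (rsp b e)) x) ->
  (rk (nxt b e) (S x) + chi (pf e = 1%nat /\ bit (ps e) x /\ bit (ps (rsp b e)) x) <= rk b (S x))%nat.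
Proof.
  intros Hb He Hx R Hn. destruct (answer_good b e Hb He) as [_ [_ [_ G]]].
  assert (E : evP k w e (rsp b e) (S x) (S x)).
  { right. left. split; [lia|]. split; [lia|]. split; auto. replace (S x - 1)%nat with x by lia. auto. }
  pose proof (G _ _ (NQ_mon x Hx) (NQ_mon x Hx) E R) as H.
  rewrite (chi_iff _ (cntP k e (rsp b e) (S x))); auto.
  unfold cntP. replace (S x - 1)%nat with x by lia. split; [|intuition lia].
  intros [H1 [H2 H3]]. left. repeat split; auto; lia.
Qed.

Lemma loc_le i : (loc i <= w)%nat.
Proof.
  destruct run as [R1 [R2 [R3 [R4 R5]]]]. destruct i as [|i'].
  - apply in_le_enc in R1. pose proof (w_bounds T). lia.
  - destruct (R5 i') as [S1 [_ [_ [S4 _]]]]. rewrite S4. apply (rule_bounds T); auto.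
Qed.

Lemma tick_one i nn tau j b A c J q tau' :
  Inv i nn tau j b A c J q -> tau <= tau' -> cand (nu nn tau') A c ->
  exists tau'' b' A' c' J' q', tau <= tau'' <= tau' /\ Inv i nn tau'' (S j) b' A' c' J' q' /\
    ((Phi b' q' < Phi b q)%nat \/ Phi b' q' = Phi b q /\ qf q' = qf q).
Proof.
  intros I Htau Hcand.
  destruct (finite_argmax k (bit A) (fun x => nu nn tau' x - INR (cdig c x))) as [x0 [Hx0 [Bx0 Mx0]]].
  { destruct Hcand as [x [Hx [Bx _]]]. eauto. }
  assert (L0 : 1 <= nu nn tau' x0 - INR (cdig c x0)).
  { destruct Hcand as [x [Hx [Bx Lx]]]. specialize (Mx0 x Hx Bx). cbv beta in Mx0. lra. }
  (* The moment at which the timer with the largest excess reached 1. *)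
  pose (tau'' := tau' - (nu nn tau' x0 - INR (cdig c x0) - 1)).
  assert (E0 : nu nn tau'' x0 - INR (cdig c x0) = 1).
  { rewrite (nu_later nn tau' tau''). unfold tau''. lra. }
  assert (Ht : tau <= tau'' <= tau').
  { split; [|unfold tau''; lra]. destruct (I_tmr I x0 Hx0 Bx0) as [E L].
    rewrite (nu_later nn tau tau'') in E0. lra. }
  assert (Mx : forall x, (x < k)%nat -> bit A x -> nu nn tau'' x - INR (cdig c x) <= 1).
  { intros x Hx Bx. specialize (Mx0 x Hx Bx). cbv beta in Mx0.
    rewrite (nu_later nn tau' tau'') in *. lra. }
  assert (Hc'' : cand (nu nn tau'') A c) by (exists x0; split; auto; split; auto; lra).
  set (Z := Zs (nu nn tau'') A c).
  assert (HZ : forall x, (x < k)%nat -> (bit Z x <-> bit A x /\ nu nn tau'' x - INR (cdig c x) = 1)).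
  { intros x Hx. unfold Z. rewrite Zs_max by auto. split.
    - intros [H1 H2]. split; auto. specialize (H2 x0 Hx0 Bx0). specialize (Mx x Hx H1). lra.
    - intros [H1 H2]. split; auto. intros y Hy By. specialize (Mx y Hy By). lra. }
  set (e := npair 1 Z). set (Y := ps (rsp b e)).
  assert (He : (e < NE k w)%nat) by apply tick_lt, setc_lt.
  pose (u := delay J (tau'' - tau)).
  assert (Hu : forall x, (x < k)%nat -> bit A x -> u (nTw + x)%nat = nu nn tau'' x - INR (cdig c x)).
  { intros x Hx Bx. unfold u, delay. destruct (I_tmr I x Hx Bx) as [E _].
    rewrite E, (nu_later nn tau tau''). lra. }
  pose (J' := reset (tmr k T Z Y) u).
  pose (A' := setc (fun x => bit A x /\ (bit Z x -> bit Y x)) k).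
  destruct (I_q I) as [Q1 [Q2 [Q3 [Q4 Q5]]]].
  assert (Hu0 : vnonneg n u).
  { intros x Hx. unfold u, delay. pose proof (I_J0 I x Hx). lra. }
  assert (HJ'0 : vnonneg n J').
  { intros x Hx. unfold J', reset. destruct in_dec; [lra|auto]. }
  destruct (ev_fwd k T e (rsp b e) q J (tau'' - tau) (loc i) 0%nat A' J') as [q' [P1 [P2 [P3 [P4 [P5 P6]]]]]]; auto.
  { apply (I_J0 I). }
  { lra. }
  { right. unfold e. rewrite pf_npair, ps_npair. split; auto. fold e Y. rewrite Q2, Q3. unfold rtick. fold u.
    split; [exists x0; split; auto; apply HZ; auto|].
    split; [intros x Hx Bx; rewrite Hu by auto; auto|].
    split; [intros x Hx; rewrite HZ by auto; split; intros [H1 H2]; split; auto; rewrite Hu in * by auto; auto|].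
    split; auto. split; [|split; [auto|apply eqv_refl]].
    intros x Hx. unfold A'. rewrite bit_setc. tauto. }
  { apply loc_le. }
  { unfold A'. pose proof (setc_lt (fun x => bit A x /\ (bit Z x -> bit Y x)) k). lia. }
  destruct (I_rk I) as [RK1 RK2].
  pose proof (I_X I) as Hb.
  destruct (ranks_after b e q q' Hb He Q1 P1 Q4 P6 RK1 RK2) as [N1 [N2 N3]].
  assert (Nm : forall x, (x < k)%nat -> (rk (nxt b e) (S x) + chi (bit Z x /\ bit Y x) <= rk b (S x))%nat).
  { intros x Hx. pose proof (monitor_after b e x Hb He Hx) as H.
    rewrite (chi_iff _ (pf e = 1%nat /\ bit (ps e) x /\ bit (ps (rsp b e)) x)).
    - apply H; [apply (I_mon I x Hx)|]. unfold e. rewrite pf_npair. discriminate.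
    - unfold e. rewrite pf_npair, ps_npair. fold e Y. tauto. }
  pose (c' := vec (fun x => (cdig c x + chi (bit Z x /\ bit Y x))%nat) k CB).
  assert (Hc' : forall x, (x < k)%nat -> bit A' x -> cdig c' x = (cdig c x + chi (bit Z x /\ bit Y x))%nat).
  { intros x Hx Bx. unfold c', cdig at 1. rewrite digit_vec by (auto; apply CB_pos).
    apply Nat.mod_small. assert (BA : bit A x) by (unfold A' in Bx; rewrite bit_setc in Bx; tauto).
    destruct (I_mon I x Hx) as [_ H]. specialize (H BA). unfold CB.
    assert (chi (bit Z x /\ bit Y x) <= 1)%nat by (unfold chi; destruct excluded_middle_informative; lia). lia. }
  exists tau'', (nxt b e), A', c', J', q'. split; auto. split.
  - constructor.
    + apply (answer_good b e Hb He).
    + change (nxt b e, A', c') with (tstep (nu nn tau'') (b, A, c)). constructor; [|exact Hc''].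
      apply treach_later with (nu nn tau) (tau'' - tau); [lra| |apply (I_reach I)].
      intros x Hx. apply nu_later.
    + pose proof (I_tau I). lra.
    + auto.
    + intros x Hx. unfold J', reset. destruct in_dec as [Hi|_].
      * apply in_tmr in Hi. lia.
      * unfold u, delay. rewrite (I_J I x Hx). lra.
    + intros x Hx Bx. rewrite (Hc' x Hx Bx).
      assert (BA : bit A x /\ (bit Z x -> bit Y x)) by (unfold A' in Bx; rewrite bit_setc in Bx; tauto).
      destruct BA as [BA BZ]. unfold J', reset. destruct in_dec as [Hi|Hi].
      * apply in_tmr_shift in Hi; auto. rewrite chi_true by auto.
        destruct Hi as [Hi _]. apply HZ in Hi; auto. rewrite plus_INR. simpl. lra.
      * rewrite in_tmr_shift in Hi by auto. rewrite chi_false by auto. rewrite Nat.add_0_r, Hu by auto.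
        split; auto.
    + rewrite P3. split; [auto|]. split; [auto|]. split; [auto|]. split; [lia|auto].
    + apply setc_lt.
    + split; auto. lia.
    + intros x Hx. split; auto. intros Bx. rewrite (Hc' x Hx Bx).
      assert (BA : bit A x) by (unfold A' in Bx; rewrite bit_setc in Bx; tauto).
      destruct (I_mon I x Hx) as [_ H]. specialize (H BA). specialize (Nm x Hx). lia.
    (* Timer [x0] is either restarted, which lowers the rank of its monitor, or switched off, which
       removes a positive term. *)
    + assert (meas (nxt b e) A' < meas b A)%nat.
      { apply bsum_lt with x0; auto.
        - intros x Hx. specialize (Nm x Hx). destruct (classic (bit A' x)) as [Bx|Bx].
          + assert (BA : bit A x) by (unfold A' in Bx; rewrite bit_setc in Bx; tauto).
            rewrite !chi_true by auto. lia.
          + rewrite (chi_false _ Bx). lia.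
        - specialize (Nm x0 Hx0). rewrite (chi_true _ Bx0).
          assert (BZ : bit Z x0) by (apply HZ; auto).
          destruct (classic (bit Y x0)) as [BY|BY].
          + rewrite (chi_true (bit Z x0 /\ bit Y x0)) in Nm by auto.
            unfold chi. destruct excluded_middle_informative; lia.
          + rewrite (chi_false (bit A' x0)); [lia|]. unfold A'. rewrite bit_setc. tauto. }
      pose proof (I_meas I). lia.
    + apply (I_let I).
  - unfold Phi. rewrite P3. lia.
Qed.

Lemma ticks_all i nn tau' : forall fl tau j b A c J q, (fuel - j <= fl)%nat ->
  Inv i nn tau j b A c J q -> tau <= tau' ->
  exists tau'' j' b' A' c' J' q', tau <= tau'' <= tau' /\ Inv i nn tau'' j' b' A' c' J' q' /\
    ~ cand (nu nn tau') A' c' /\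
    ((Phi b' q' < Phi b q)%nat \/ Phi b' q' = Phi b q /\ qf q' = qf q).
Proof.
  induction fl as [|fl IH]; intros tau j b A c J q Hfl I Ht;
    (destruct (classic (cand (nu nn tau') A c)) as [Hc|Hc];
     [|exists tau, j, b, A, c, J, q; split; [lra|]; split; [auto|]; split; auto]);
    destruct (tick_one i nn tau j b A c J q tau' I Ht Hc) as [t2 [b2 [A2 [c2 [J2 [q2 [Ht2 [I2 P2]]]]]]]];
    pose proof (I_meas I2); [lia|].
  destruct (IH t2 (S j) b2 A2 c2 J2 q2) as [t3 [j3 [b3 [A3 [c3 [J3 [q3 [Ht3 [I3 [N3 P3]]]]]]]]]]; auto; try lia; try lra.
  exists t3, j3, b3, A3, c3, J3, q3. split; [lra|]. split; auto. split; auto.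
  destruct P2 as [P2|[P2 P2']], P3 as [P3|[P3 P3']]; [left; lia|left; lia|left; lia|right; split; lia].
Qed.

Lemma g_mono l l' : (l < l')%nat -> (g l < g l')%nat.
Proof. induction 1; [auto|]. specialize (g_inc m). lia. Qed.

Lemma sat_agree u v ru : In ru (ta_rules T) -> (forall x, (x < nTw)%nat -> u x = v x) ->
  (sat u (r_guard ru) <-> sat v (r_guard ru)).
Proof.
  intros H E. apply (eqv_sat nTw M); [apply eqv_ext; auto| |].
  - apply clocks_below_mono with (2 := enc_cc_clocks _). destruct (rule_bounds T ru H). unfold nT. lia.
  - apply consts_below_mono with (2 := enc_cc_consts _). destruct (rule_bounds T ru H). unfold MM. lia.
Qed.

(** All ticks due by [tm i] are carried out first, so that the active timers are below 1; then the
    transition is matched on the grid by a letter or a silent step. *)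
Lemma run_step i nn tau j b A c J q : Inv i nn tau j b A c J q -> tau <= tm i ->
  exists nn' j' b' A' c' J' q', Inv (S i) nn' (tm i) j' b' A' c' J' q' /\
    ((Phi b' q' < Phi b q)%nat \/
     Phi b' q' = Phi b q /\ qf q' = qf q /\ (In (loc (S i)) (ta_final T) -> qf q = 1%nat) /\
     (r_lab (r i) <> None -> qf q = 0%nat)).
Proof.
  intros I0 Ht0.
  destruct (ticks_all i nn (tm i) _ tau j b A c J q (le_n _) I0 Ht0)
    as [t1 [j1 [b1 [A1 [c1 [J1 [q1 [Ht1 [I [Hn P1]]]]]]]]]].
  clear I0 Ht0.
  destruct run as [_ [_ [_ [_ R5]]]]. destruct (R5 i) as [S1 [S2 [S3 [S4 S5]]]].
  destruct (rule_bounds T (r i) S1) as [_ [B2 B3]].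
  pose (u := delay J1 (tm i - t1)).
  assert (Hu : forall x, (x < k)%nat -> bit A1 x -> u (nTw + x)%nat = nu nn (tm i) x - INR (cdig c1 x)).
  { intros x Hx Bx. unfold u, delay. destruct (I_tmr I x Hx Bx) as [E _].
    rewrite E, (nu_later nn t1 (tm i)). lra. }
  assert (Hu1 : forall x, (x < k)%nat -> bit A1 x -> u (nTw + x)%nat < 1).
  { intros x Hx Bx. rewrite Hu by auto. apply Rnot_le_lt. intros H. apply Hn. exists x.
    split; auto. split; auto. lra. }
  assert (HuT : forall x, (x < nTw)%nat -> u x = delay (val i) (tm i - prev tm i) x).
  { intros x Hx. unfold u, delay. rewrite (I_J I x Hx). lra. }
  assert (Hu0 : vnonneg n u).
  { intros x Hx. unfold u, delay. pose proof (I_J0 I x Hx). lra. }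
  assert (Hsat : sat u (r_guard (r i))) by (apply (sat_agree u _ _ S1 HuT); auto).
  destruct (I_q I) as [Q1 [Q2 [Q3 [Q4 Q5]]]].
  pose proof (I_A I) as HA.
  pose proof (I_X I) as Hb.
  destruct (I_rk I) as [RK1 RK2].
  destruct (I_let I) as [L1 L2].
  assert (Hreach : treach (nu nn (tm i)) (dec (fst (cs nn))) j1 (b1, A1, c1)).
  { apply treach_later with (nu nn t1) (tm i - t1); [lra| |apply (I_reach I)].
    intros x Hx. apply nu_later. }
  destruct (r_lab (r i)) as [lb|] eqn:Elab.
  - destruct (g_all i) as [nn' Hnn']; [congruence|].
    assert (nn' = nn).
    { destruct (Nat.lt_trichotomy nn' nn) as [H|[H|H]]; auto.
      - specialize (L1 nn' H). lia.
      - pose proof (g_mono _ _ H). lia. }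
    subst nn'. destruct (g_lab nn) as [G1 G2]. rewrite Hnn' in G1, G2.
    rewrite Elab in G1. injection G1 as G1. subst lb.
    (* Woken by the letter, the controller arrives at the tick state of the simulation: no tick is
       pending, and the fuel was sufficient. *)
    assert (Hloop : loop fuel (nu nn (t nn)) (dec (fst (cs nn))) = (b1, A1, c1)).
    { rewrite <- G2. apply treach_loop with j1; auto.
      pose proof (I_meas I). lia. }
    set (e := letter_of (a nn) (nu nn (t nn)) A1 c1).
    assert (Hdelta : c_delta ctrl (fst (cs nn)) (a nn) (nu nn (t nn)) =
       ((after_letter b1 A1 c1 e, pf (rsp b1 e)), ylist (ps (rsp b1 e)))).
    { simpl c_delta. unfold delta. rewrite Hloop. auto. }
    assert (Hans : canswer ctrl a t nn = pf (rsp b1 e)).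
    { unfold canswer. fold (nu nn (t nn)). rewrite Hdelta. auto. }
    assert (Hcs : cs (S nn) = (after_letter b1 A1 c1 e, reset (ylist (ps (rsp b1 e))) (nu nn (t nn)))).
    { cbn [cstate]. fold (nu nn (t nn)). rewrite Hdelta. auto. }
    set (Y := ps (rsp b1 e)) in *.
    assert (He : (e < NE k w)%nat).
    { apply letter_lt; [pose proof (w_bounds T); specialize (a_lt nn); lia|apply setc_lt]. }
    assert (Ep : pf e = 0%nat) by (unfold e, letter_of; apply pf_npair).
    pose (J' := reset (r_reset (r i) ++ tmr k T Y Y) u).
    pose (A' := setc (fun x => bit A1 x \/ bit Y x) k).
    pose (c' := vec (fun x => ((1 - chi (bit Y x)) * cdig c1 x)%nat) k CB).
    pose (f' := chi (In (r_tgt (r i)) (ta_final T))).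
    assert (HJ'0 : vnonneg n J').
    { intros x Hx. unfold J', reset. destruct in_dec; [lra|auto]. }
    assert (Hf' : (f' <= 1)%nat) by (unfold f', chi; destruct excluded_middle_informative; lia).
    destruct (ev_fwd k T e (rsp b1 e) q1 J1 (tm i - t1) (r_tgt (r i)) f' A' J')
      as [q' [N1 [N2 [N3 [N4 [N5 N6]]]]]]; auto.
    { apply (I_J0 I). }
    { lra. }
    { left. split; auto. fold Y u. rewrite Q2, Q3. unfold e at 1 2, letter_of. rewrite !ps_npair, pf_npair.
      split; auto. split; auto. split.
      - intros x Hx. rewrite bit_setc. rewrite <- G2.
        split; intros H; [destruct H as [_ [H1 H2]]|destruct H as [H1 H2]; split; auto];
          (split; auto; rewrite Hu in * by auto; lra).
      - exists (r i). split; auto. split; auto. split; [rewrite Elab, Hans; auto|]. split; auto. split; auto.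
        split; [|split; [auto|apply eqv_refl]].
        intros x Hx. unfold A'. rewrite bit_setc. tauto. }
    { unfold A'. pose proof (setc_lt (fun x => bit A1 x \/ bit Y x) k). lia. }
    destruct (ranks_after b1 e q1 q' Hb He Q1 N1 Q4 N6 RK1 RK2) as [V1 [V2 V3]].
    assert (HXn : inX (nxt b1 e)) by apply (answer_good b1 e Hb He).
    assert (Hdec : dec (fst (cs (S nn))) = (nxt b1 e, A', c')).
    { rewrite Hcs. simpl fst. unfold dec, after_letter. rewrite !ps_npair, !pf_npair.
      destruct excluded_middle_informative; [auto|tauto]. }
    assert (Hc' : forall x, (x < k)%nat -> cdig c' x = ((1 - chi (bit Y x)) * cdig c1 x)%nat).
    { intros x Hx. unfold c', cdig at 1. rewrite digit_vec by (auto; apply CB_pos). apply Nat.mod_small.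
      assert (cdig c1 x < CB)%nat by apply digit_lt, CB_pos. unfold chi. destruct excluded_middle_informative; lia. }
    assert (Hnu : forall x, nu (S nn) (tm i) x = reset (ylist Y) (nu nn (t nn)) x).
    { intros x. unfold nu at 1. rewrite Hcs. simpl. unfold delay. rewrite G2. lra. }
    exists (S nn), 0%nat, (nxt b1 e), A', c', J', q'. split.
    + constructor.
      * auto.
      * rewrite Hdec. constructor.
      * simpl. lra.
      * auto.
      * intros x Hx. simpl. rewrite S5. unfold J', reset. destruct in_dec as [Hi|Hi], in_dec as [Hi'|Hi'].
        -- lra.
        -- apply in_app_or in Hi. destruct Hi as [Hi|Hi]; [tauto|]. apply in_tmr in Hi. lia.
        -- exfalso. apply Hi. apply in_or_app. auto.
        -- rewrite HuT by auto. lra.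
      * intros x Hx Bx. rewrite Hc', Hnu by auto. unfold J', reset.
        assert (Ht : In (nTw + x)%nat (r_reset (r i) ++ tmr k T Y Y) <-> bit Y x).
        { rewrite in_app_iff, in_tmr_shift by auto. split; [|auto]. intros [H|H]; [|tauto].
          apply B2 in H. lia. }
        assert (Hy : In x (ylist Y) <-> bit Y x) by (rewrite in_ylist; tauto).
        destruct in_dec as [Hi|Hi], in_dec as [Hi'|Hi']; try tauto.
        -- rewrite chi_true by tauto. simpl. lra.
        -- rewrite chi_false by tauto. rewrite Nat.sub_0_r, Nat.mul_1_l.
           assert (BA : bit A1 x) by (unfold A' in Bx; rewrite bit_setc in Bx; tauto).
           rewrite Hu by auto. rewrite G2. split; auto. specialize (Hu1 x Hx BA). rewrite Hu, G2 in Hu1 by auto. lra.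
      * split; [auto|]. split; [rewrite N2; auto|]. split; [auto|]. split; [lia|auto].
      * apply setc_lt.
      * split; auto. lia.
      * intros x Hx. split; auto. intros Bx. rewrite Hc' by auto. destruct (classic (bit Y x)) as [BY|BY].
        -- rewrite chi_true by auto. specialize (V3 x Hx). lia.
        -- rewrite chi_false by auto.
           assert (BA : bit A1 x) by (unfold A' in Bx; rewrite bit_setc in Bx; tauto).
           destruct (I_mon I x Hx) as [M1 M2]. specialize (M2 BA).
           pose proof (monitor_after b1 e x Hb He Hx M1 ltac:(auto)). lia.
      * simpl. unfold meas, fuel. rewrite <- bsum_const. apply bsum_le. intros x Hx. specialize (V3 x Hx).
        unfold chi. destruct excluded_middle_informative; lia.
      * split.
        -- intros l Hl. destruct (Nat.eq_dec l nn) as [->|]; [lia|]. specialize (L1 l ltac:(lia)). lia.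
        -- specialize (g_inc nn). lia.
    + unfold Phi in *. rewrite N3. rewrite S4.
      assert (Hff : In (r_tgt (r i)) (ta_final T) -> f' = 1%nat) by (intros; unfold f'; apply chi_true; auto).
      assert (Hff0 : ~ In (r_tgt (r i)) (ta_final T) -> f' = 0%nat) by (intros; unfold f'; apply chi_false; auto).
      destruct P1 as [P1|[P1 P1']]; [left; lia|].
      destruct (classic (In (r_tgt (r i)) (ta_final T))) as [HF|HF].
      * rewrite (Hff HF). left. lia.
      * rewrite (Hff0 HF). destruct (Nat.eq_dec (qf q1) 0) as [E|E]; [|left; lia].
        destruct (Nat.eq_dec (rk (nxt b1 e) (S k + q')) (rk b1 (S k + q1))) as [E2|E2]; [|left; lia].
        right. split; [lia|]. split; [lia|]. split; [tauto|]. intros _. lia.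
  - pose (J' := reset (r_reset (r i)) u).
    pose (f' := if excluded_middle_informative (In (r_tgt (r i)) (ta_final T)) then 1%nat else qf q1).
    assert (Hf' : (f' <= 1)%nat) by (unfold f'; destruct excluded_middle_informative; lia).
    assert (HJ'0 : vnonneg n J').
    { intros x Hx. unfold J', reset. destruct in_dec; [lra|auto]. }
    destruct (sil_fwd k T q1 J1 (tm i - t1) (r_tgt (r i)) f' A1 J')
      as [q' [N1 [N2 [N3 [N4 [N5 N6]]]]]]; auto; try lia; try lra.
    { apply (I_J0 I). }
    { fold u. rewrite Q2, Q3. split.
      - intros x Hx Bx. left. auto.
      - exists (r i). split; auto. split; auto. split; auto. split; auto. split; auto. split; auto.
        split; [|apply eqv_refl]. unfold f'. destruct excluded_middle_informative; auto. }
    assert (V1 : (rk b1 (S k + q') <= rk b1 (S k + q1))%nat).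
    { apply (X_sil b1 Hb (S k + q1) (S k + q')); auto using NQ_main.
      split; [lia|]. split; [lia|].
      replace (S k + q1 - S k)%nat with q1 by lia. replace (S k + q' - S k)%nat with q' by lia. auto. }
    assert (Hig : i <> g nn).
    { intros Hi. destruct (g_lab nn) as [G1 _]. rewrite <- Hi in G1. congruence. }
    exists nn, j1, b1, A1, c1, J', q'. split.
    + constructor; auto.
      * simpl. lra.
      * intros x Hx. simpl. rewrite S5. unfold J', reset. destruct in_dec; [lra|]. rewrite HuT by auto. lra.
      * intros x Hx Bx. unfold J', reset. destruct in_dec as [Hi|]; [apply B2 in Hi; lia|].
        split; [auto|]. left. auto.
      * split; [auto|]. split; [rewrite N2; auto|]. split; [auto|]. split; [lia|auto].
      * split; auto. lia.
      * apply (I_mon I).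
      * apply (I_meas I).
      * split; [|lia]. intros l Hl. specialize (L1 l Hl). lia.
    + unfold Phi in *. rewrite N3, S4.
      assert (Hff : f' = 1%nat \/ f' = qf q1 /\ ~ In (r_tgt (r i)) (ta_final T)).
      { unfold f'. destruct excluded_middle_informative; auto. }
      destruct P1 as [P1|[P1 P1']]; [left; destruct Hff as [->|[-> _]]; lia|].
      destruct Hff as [->|[-> HF]].
      * destruct (Nat.eq_dec (qf q1) 0) as [E|E]; [left; lia|].
        destruct (Nat.eq_dec (rk b1 (S k + q')) (rk b1 (S k + q1))) as [E2|E2]; [|left; lia].
        right. split; [lia|]. split; [lia|]. split; [intros; lia|]. intros H; congruence.
      * destruct (Nat.eq_dec (rk b1 (S k + q')) (rk b1 (S k + q1))) as [E2|E2]; [|left; lia].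
        right. split; [lia|]. split; [lia|]. split; [tauto|]. intros H; congruence.
Qed.

Lemma inv_init : exists q, Inv 0 0 0 0 b0 (setc (fun _ => True) k) 0 zero_val q.
Proof.
  destruct run as [R1 [R2 _]].
  destruct (config_exists k T (loc 0%nat) 0 (setc (fun _ => True) k) zero_val) as [q [H1 [H2 [H3 [H4 H5]]]]].
  - apply loc_le.
  - lia.
  - pose proof (setc_lt (fun _ => True) k). lia.
  - intros x _. unfold zero_val. lra.
  - exists q.
    assert (Hmon : forall x, (x < S k)%nat -> (rk b0 x <= K)%nat).
    { intros x Hx. apply X_ini; [unfold NQ; lia|]. left. auto. }
    assert (Hdec : dec (fst (cs 0)) = (b0, setc (fun _ => True) k, 0%nat)).
    { simpl. unfold dec. rewrite !ps_npair, !pf_npair. destruct excluded_middle_informative; tauto. }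
    assert (D0 : forall x, cdig 0 x = 0%nat).
    { intros x. unfold cdig. apply digit_high with 0%nat; [apply CB_pos|simpl; lia|lia]. }
    constructor.
    + auto.
    + rewrite Hdec. constructor.
    + simpl. lra.
    + intros x _. unfold zero_val. lra.
    + intros x _. rewrite R2. unfold zero_val. simpl. lra.
    + intros x Hx _. rewrite D0. unfold nu, delay. simpl. unfold zero_val. lra.
    + split; [auto|]. split; [auto|]. split; [auto|]. split; [lia|auto].
    + apply setc_lt.
    + split; [|apply Hmon; lia]. apply X_ini; [apply NQ_main; auto|]. right. split; [lia|].
      replace (S k + q - S k)%nat with q by lia. rewrite H2, H3, H4, wini_enc, inlc_enc.
      split; auto. split; auto. split; [intros x Hx; rewrite bit_setc; auto|].
      apply eqN_plain. eapply eqv_trans; [|exact H5]. apply eqv_ext. intros x Hx.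
      unfold gv, nv, zero_val. rewrite (digit_high _ 0 x 0); try lia; [simpl; unfold Rdiv; lra| |simpl; lia].
      unfold GB. lia.
    + intros x Hx. rewrite D0. split; [apply Hmon; lia|]. intros _. apply Hmon. lia.
    + simpl. unfold meas, fuel. rewrite <- bsum_const. apply bsum_le. intros x Hx.
      specialize (Hmon (S x) ltac:(lia)). unfold chi. destruct excluded_middle_informative; lia.
    + split; [intros; lia|lia].
Qed.

Hypothesis acc : buchi T loc.

Lemma tm_le i : prev tm i <= tm i.
Proof. destruct run as [_ [_ [R3 [R4 _]]]]. destruct i; simpl; auto. Qed.

(** If [Phi] stopped decreasing, the flag would be constant from then on: up because final locations
    recur, and down because letters recur. *)
Lemma no_accepting_run : False.
Proof.
  assert (G : forall ph i nn j b A c J q, Phi b q = ph -> Inv i nn (prev tm i) j b A c J q -> False).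
  { induction ph as [ph IH] using (well_founded_induction lt_wf). intros i nn j b A c J q Hph I.
    assert (S : forall d, exists nn' j' b' A' c' J' q', Inv (i + d) nn' (prev tm (i + d)) j' b' A' c' J' q' /\
      Phi b' q' = ph /\ qf q' = qf q /\
      (forall d', (d' < d)%nat -> (In (loc (S (i + d'))) (ta_final T) -> qf q = 1%nat) /\
         (r_lab (r (i + d')) <> None -> qf q = 0%nat))).
    { induction d as [|d [nn' [j' [b' [A' [c' [J' [q' [I' [P1 [P2 P3]]]]]]]]]]].
      - rewrite Nat.add_0_r. exists nn, j, b, A, c, J, q. split; auto. split; auto. split; auto. intros; lia.
      - destruct (run_step _ _ _ _ _ _ _ _ _ I' (tm_le (i + d)))
          as [nn2 [j2 [b2 [A2 [c2 [J2 [q2 [I2 H]]]]]]]].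
        destruct H as [H|[H1 [H2 [H3 H4]]]].
        + exfalso. apply (IH (Phi b2 q2)) with (S (i + d)) nn2 j2 b2 A2 c2 J2 q2; auto. lia.
        + rewrite Nat.add_succ_r. exists nn2, j2, b2, A2, c2, J2, q2. split; auto.
          split; [congruence|]. split; [congruence|]. intros d' Hd'.
          destruct (Nat.eq_dec d' d) as [->|]; [|apply P3; lia]. rewrite <- P2. auto. }
    destruct (acc (Datatypes.S i)) as [i1 [Hi1 HF]].
    assert (Hg : forall N, exists l, (N <= g l)%nat).
    { induction N as [|N [l Hl]]; [exists 0%nat; lia|]. exists (Datatypes.S l). specialize (g_inc l). lia. }
    destruct (Hg i) as [l Hl].
    destruct (S (i1 + g l)%nat) as [? [? [? [? [? [? [? [_ [_ [_ H]]]]]]]]]].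
    destruct (H (i1 - i - 1)%nat ltac:(lia)) as [H1 _].
    replace (Datatypes.S (i + (i1 - i - 1)))%nat with i1 in H1 by lia. specialize (H1 HF).
    destruct (H (g l - i)%nat) as [_ H2].
    { lia. }
    replace (i + (g l - i))%nat with (g l) in H2 by lia.
    destruct (g_lab l) as [GL _]. rewrite GL in H2. specialize (H2 ltac:(discriminate)). lia. }
  destruct inv_init as [q I]. eapply G; [reflexivity|]. exact I.
Qed.
End Play.

Lemma ctrl_winning : winning T ctrl.
Proof.
  intros a t Ha _ _ [r [tm [loc [val [g [H1 [H2 [H3 [H4 H5]]]]]]]]].
  exact (no_accepting_run a t Ha r tm loc val g H1 H3 H4 H5 H2).
Qed.
End Controller.

Theorem controller_of_ranks k T : Solv k (enc_TA T) -> has_km_controller k T.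
Proof.
  intros [X [_ [[b0 [Hb0 [Hb0' Hini]]] HX]]].
  assert (X_sil : forall b, inX k T X b -> forall p p', (p < NQ k (enc_TA T))%nat -> (p' < NQ k (enc_TA T))%nat ->
    silP k (enc_TA T) p p' -> (rkd k (enc_TA T) b p' <= rkd k (enc_TA T) b p)%nat).
  { intros b [H1 H2] p p' Hp Hp'. apply (HX b H1 H2); auto. }
  assert (X_ev : forall b, inX k T X b -> forall e, (e < NE k (enc_TA T))%nat -> exists r b', good_answer k T X b e r b').
  { intros b [H1 H2] e He. destruct (HX b H1 H2) as [_ H3].
    destruct (H3 e He) as [r [Hr [Hal [b' [Hb' [Hb2 H4]]]]]].
    exists r, b'. split; auto. split; auto. split; [split; auto|]. intros p p' Hp Hp'. apply H4; auto. }
  exists (m1 k T), (ctrl k T X X_ev b0). split.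
  - apply ctrl_valid. split; auto.
  - apply ctrl_winning; auto. split; auto.
Qed.

(** * From a controller to a strategy in the tick game *)

Notation fl r := (IZR (Int_part r)).

Lemma fl_bounds r : fl r <= r < fl r + 1.
Proof. pose proof (base_Int_part r). lra. Qed.

Lemma Int_part_unique r z : IZR z <= r < IZR z + 1 -> Int_part r = z.
Proof.
  intros H. pose proof (fl_bounds r).
  assert (IZR (Int_part r) < IZR (z + 1)) by (rewrite plus_IZR; lra).
  assert (IZR z < IZR (Int_part r + 1)) by (rewrite plus_IZR; lra).
  apply lt_IZR in H1, H2. lia.
Qed.

Lemma fl_nonneg r : 0 <= r -> (0 <= Int_part r)%Z.
Proof.
  intros H. pose proof (fl_bounds r). assert (IZR (-1) < IZR (Int_part r)) by (simpl; lra).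
  apply lt_IZR in H1. lia.
Qed.

Lemma eqv_intro n M v v' :
  (forall x y z, (x < n)%nat -> (y < n)%nat -> (Z.abs z <= Z.of_nat M)%Z ->
     (v x - v y < IZR z <-> v' x - v' y < IZR z)) ->
  (forall x z, (x < n)%nat -> (Z.abs z <= Z.of_nat M)%Z ->
     (v x < IZR z <-> v' x < IZR z) /\ (v x > IZR z <-> v' x > IZR z)) -> eqv n M v v'.
Proof.
  intros H1 H2 x y Hx Hy z Hz. unfold ext. destruct (lt_dec x n), (lt_dec y n).
  - apply H1; auto.
  - rewrite !Rminus_0_r. apply H2; auto.
  - destruct (H2 y (- z)%Z l ltac:(lia)) as [_ E]. rewrite opp_IZR in E.
    split; intros; [assert (v' y > - IZR z)|assert (v y > - IZR z)]; try lra; apply E; lra.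
  - tauto.
Qed.

(** * What a controller with constant [m] needs to know about its clocks *)

Section Sig.
Variables k m : nat.

(** Regions with constants up to [m] do not show whether a clock has reached [m + 1], where its
    timer is switched off, so this is added. *)
Definition sigeq (v v' : valuation) := eqv k m v v' /\
  forall x, (x < k)%nat -> (v x < INR m + 1 <-> v' x < INR m + 1).

Definition NI := S (npair k (npair k (2 * m))).
Definition sigc (v : valuation) : nat :=
  npair (setc (fun i => ((pf i <= k)%nat /\ (pf (ps i) <= k)%nat /\ (ps (ps i) <= 2 * m)%nat) /\
           ext k v (pf i) - ext k v (pf (ps i)) < IZR (Z.of_nat (ps (ps i)) - Z.of_nat m)) NI)
        (setc (fun x => v x < INR m + 1) k).
Definition NSig := S (npair (2 ^ NI) (2 ^ k)).

Lemma sig_lt v : (sigc v < NSig)%nat.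
Proof. unfold sigc, NSig. apply Nat.lt_succ_r, npair_le; apply Nat.lt_le_incl, setc_lt. Qed.

Lemma sigeq_sym v v' : sigeq v v' -> sigeq v' v.
Proof. intros [H1 H2]. split; [apply eqv_sym; auto|]. intros. symmetry. auto. Qed.
Lemma sigeq_trans v v' v'' : sigeq v v' -> sigeq v' v'' -> sigeq v v''.
Proof.
  intros [H1 H2] [H3 H4]. split; [eapply eqv_trans; eauto|]. intros x Hx. rewrite H2, H4 by auto. tauto.
Qed.

Lemma sig_sigeq v v' : sigc v = sigc v' -> sigeq v v'.
Proof.
  intros H. unfold sigc in H. pose proof (f_equal pf H) as H1. pose proof (f_equal ps H) as H2.
  rewrite !pf_npair in H1. rewrite !ps_npair in H2. split.
  - intros x y Hx Hy z Hz. set (i := npair x (npair y (Z.to_nat (z + Z.of_nat m)))).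
    assert (Hi : (i < NI)%nat) by (apply Nat.lt_succ_r; repeat apply npair_le; lia).
    assert (E : forall u : valuation, bit (setc (fun i => ((pf i <= k)%nat /\ (pf (ps i) <= k)%nat /\ (ps (ps i) <= 2 * m)%nat) /\
           ext k u (pf i) - ext k u (pf (ps i)) < IZR (Z.of_nat (ps (ps i)) - Z.of_nat m)) NI) i <->
       ext k u x - ext k u y < IZR z).
    { intros u. rewrite bit_setc. unfold i. rewrite !ps_npair, !pf_npair.
      replace (Z.of_nat (Z.to_nat (z + Z.of_nat m)) - Z.of_nat m)%Z with z by lia.
      split; [tauto|]. intros. split; [exact Hi|]. split; auto. repeat split; lia. }
    rewrite <- (E v), <- (E v'), H1. tauto.
  - intros x Hx. assert (E : forall u : valuation, bit (setc (fun x => u x < INR m + 1) k) x <-> u x < INR m + 1).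
    { intros u. rewrite bit_setc. tauto. }
    rewrite <- (E v), <- (E v'), H2. tauto.
Qed.

(** Finite memory can hold only the class of a valuation; the strategy calculates with a fixed
    representative of it. *)
Lemma rep_ex c : exists v, vnonneg k v /\ ((exists v', vnonneg k v' /\ sigc v' = c) -> sigc v = c).
Proof.
  destruct (classic (exists v', vnonneg k v' /\ sigc v' = c)) as [[v [H1 H2]]|H].
  - exists v. auto.
  - exists zero_val. split; [intros x _; unfold zero_val; lra|tauto].
Qed.
Definition repr c := proj1_sig (constructive_indefinite_description _ (rep_ex c)).
Lemma rep_nonneg c : vnonneg k (repr c).
Proof. apply (proj2_sig (constructive_indefinite_description _ (rep_ex c))). Qed.
Lemma rep_sig v : vnonneg k v -> sigeq (repr (sigc v)) v.
Proof.
  intros H. apply sig_sigeq. apply (proj2_sig (constructive_indefinite_description _ (rep_ex (sigc v)))). eauto.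
Qed.

Lemma fl_le_m r : r < INR m + 1 -> (Int_part r <= Z.of_nat m)%Z.
Proof.
  intros H. pose proof (fl_bounds r). rewrite INR_IZR_INZ in H.
  assert (IZR (Int_part r) < IZR (Z.of_nat m + 1)) by (rewrite plus_IZR; lra). apply lt_IZR in H1. lia.
Qed.

Lemma sigeq_fl v v' x : sigeq v v' -> vnonneg k v -> (x < k)%nat -> v x < INR m + 1 ->
  Int_part (v' x) = Int_part (v x).
Proof.
  intros [H1 H2] Hv Hx Hl. pose proof (fl_bounds (v x)). pose proof (fl_le_m _ Hl).
  pose proof (fl_nonneg _ (Hv x Hx)). apply Int_part_unique. split.
  - destruct (eqv_one k m v v' x (Int_part (v x)) H1 Hx ltac:(lia)) as [E _].
    apply Rnot_lt_le. intros G. apply E in G. lra.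
  - destruct (Z.eq_dec (Int_part (v x)) (Z.of_nat m)) as [E|E].
    + rewrite E, <- INR_IZR_INZ. apply H2; auto.
    + destruct (eqv_one k m v v' x (Int_part (v x) + 1) H1 Hx ltac:(lia)) as [G _].
      rewrite plus_IZR in G. apply G. lra.
Qed.

(** A clock below [m + 1] is active. [mtick] leads to the first moment at which active clocks reach
    their next integer, and these are the clocks in [Z]; under [mlet] none reaches it, and [O]
    consists of the active clocks that are at an integer. *)
Definition mtick (v : valuation) Z d := 0 <= d /\ (exists x, (x < k)%nat /\ bit Z x) /\
  forall x, (x < k)%nat -> (bit Z x -> v x < INR m + 1) /\
    (v x < INR m + 1 -> v x + d <= fl (v x) + 1 /\ (bit Z x <-> v x + d = fl (v x) + 1)).
Definition mlet (v : valuation) O d := 0 <= d /\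
  forall x, (x < k)%nat -> (bit O x -> v x < INR m + 1) /\
    (v x < INR m + 1 -> v x + d < fl (v x) + 1 /\ (bit O x <-> v x + d = fl (v x))).

Lemma mlet_zero v O d x : mlet v O d -> (x < k)%nat -> bit O x -> d = 0.
Proof.
  intros [H1 H2] Hx Hb. destruct (H2 x Hx) as [H3 H4]. specialize (H3 Hb). destruct (H4 H3) as [_ H5].
  apply H5 in Hb. pose proof (fl_bounds (v x)). lra.
Qed.

(** If [O] is nonempty, both delays are 0; otherwise each active clock ends strictly between the
    same two integers for both valuations. This is why letters carry the set of timers equal to
    0. *)
Lemma mlet_sigeq v v' O d d' : sigeq v v' -> vnonneg k v -> vnonneg k v' -> mlet v O d -> mlet v' O d' ->
  sigeq (delay v d) (delay v' d').
Proof.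
  intros HS Hv Hv' H H'. destruct HS as [E1 E2].
  destruct (classic (exists x, (x < k)%nat /\ bit O x)) as [[x [Hx Hb]]|Hno].
  - rewrite (mlet_zero v O d x H Hx Hb), (mlet_zero v' O d' x H' Hx Hb). split.
    + eapply eqv_trans; [|eapply eqv_trans; [exact E1|]]; apply eqv_ext; intros; unfold delay; lra.
    + intros y Hy. unfold delay. rewrite !Rplus_0_r. auto.
  - assert (Act : forall x, (x < k)%nat -> v x < INR m + 1 -> exists z, (z <= Z.of_nat m)%Z /\
       IZR z < v x + d < IZR z + 1 /\ IZR z < v' x + d' < IZR z + 1).
    { intros x Hx Hl. exists (Int_part (v x)). split; [apply fl_le_m; auto|].
      destruct H as [D1 H]. destruct (H x Hx) as [_ H1]. destruct (H1 Hl) as [H2 H3].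
      assert (Hl' : v' x < INR m + 1) by (apply E2; auto).
      destruct H' as [D1' H']. destruct (H' x Hx) as [_ H1']. destruct (H1' Hl') as [H2' H3'].
      rewrite (sigeq_fl v v' x (conj E1 E2) Hv Hx Hl) in H2', H3'.
      pose proof (fl_bounds (v x)). pose proof (fl_bounds (v' x)) as FB.
      rewrite (sigeq_fl v v' x (conj E1 E2) Hv Hx Hl) in FB.
      assert (v x + d <> fl (v x)) by (intros G; apply Hno; exists x; split; auto; apply H3; auto).
      assert (v' x + d' <> fl (v x)) by (intros G; apply Hno; exists x; split; auto; apply H3'; auto). lra. }
    assert (Ina : forall x, (x < k)%nat -> ~ v x < INR m + 1 -> INR m + 1 <= v x + d /\ INR m + 1 <= v' x + d').
    { intros x Hx Hl. assert (~ v' x < INR m + 1) by (rewrite <- E2; auto).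
      destruct H as [D1 _], H' as [D1' _]. lra. }
    split.
    + apply eqv_intro.
      * intros x y z Hx Hy Hz. destruct (eqv_diff k m v v' x y z E1 Hx Hy Hz) as [G _]. unfold delay.
        split; intros; [assert (v' x - v' y < IZR z)|assert (v x - v y < IZR z)]; try lra; apply G; lra.
      * intros x z Hx Hz. unfold delay. destruct (Rlt_dec (v x) (INR m + 1)) as [Hl|Hl].
        -- destruct (Act x Hx Hl) as [c [_ [A1 A2]]].
           destruct (Z_lt_le_dec c z) as [G|G].
           ++ assert (IZR c + 1 <= IZR z) by (rewrite <- plus_IZR; apply IZR_le; lia). lra.
           ++ assert (IZR z <= IZR c) by (apply IZR_le; lia). lra.
        -- destruct (Ina x Hx Hl). assert (IZR z <= INR m) by (rewrite INR_IZR_INZ; apply IZR_le; lia). lra.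
    + intros x Hx. unfold delay. destruct (Rlt_dec (v x) (INR m + 1)) as [Hl|Hl].
      * destruct (Act x Hx Hl) as [c [Hc [A1 A2]]].
        assert (IZR c <= INR m) by (rewrite INR_IZR_INZ; apply IZR_le; lia). lra.
      * destruct (Ina x Hx Hl). lra.
Qed.

Lemma mlet_exists v v' O d : sigeq v v' -> vnonneg k v -> vnonneg k v' -> mlet v O d -> exists d', mlet v' O d'.
Proof.
  intros HS Hv Hv' H. destruct HS as [E1 E2].
  destruct (classic (exists x, (x < k)%nat /\ bit O x)) as [[x0 [Hx0 Hb0]]|Hno].
  - pose proof (mlet_zero v O d x0 H Hx0 Hb0) as D0. subst d. exists 0. split; [lra|].
    destruct H as [_ H]. intros x Hx. destruct (H x Hx) as [H1 H2]. split; [intros; apply E2; auto|].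
    intros Hl'. assert (Hl : v x < INR m + 1) by (apply E2; auto). destruct (H2 Hl) as [H3 H4].
    pose proof (fl_bounds (v' x)). split; [lra|].
    rewrite H4, (sigeq_fl v v' x (conj E1 E2) Hv Hx Hl).
    destruct (eqv_one k m v v' x (Int_part (v x)) E1 Hx) as [A1 A2].
    { pose proof (fl_le_m _ Hl). pose proof (fl_nonneg _ (Hv x Hx)). lia. }
    pose proof (cmpR_iff CEq _ _ _ _ A1 A2) as A3. simpl in A3. rewrite !Rplus_0_r. auto.
  - destruct (above_below 0 (map (fun x => fl (v' x) + 1 - v' x) (seq 0 k))) as [c [Hc1 Hc2]].
    { intros b Hb. apply in_map_iff in Hb. destruct Hb as [x [<- _]]. pose proof (fl_bounds (v' x)). lra. }
    exists c. split; [lra|]. intros x Hx. split; [intros; exfalso; eauto|]. intros Hl'.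
    assert (c < fl (v' x) + 1 - v' x).
    { apply Hc2. apply in_map_iff. exists x. split; auto. apply in_seq. lia. }
    split; [lra|]. split; [intros; exfalso; eauto|]. pose proof (fl_bounds (v' x)). lra.
Qed.

Lemma mtick_pos v Z d : mtick v Z d -> 0 < d.
Proof.
  intros [H1 [[x [Hx Hb]] H2]]. destruct (H2 x Hx) as [H3 H4]. destruct (H4 (H3 Hb)) as [_ H5].
  apply H5 in Hb. pose proof (fl_bounds (v x)). lra.
Qed.

(** After a tick some clock [x0] is at a known integer. Comparing a clock with a constant then
    amounts to comparing its difference with [x0], which delays preserve: here diagonal constraints
    are indispensable to the argument. *)
Lemma mtick_sigeq v v' Z d d' : sigeq v v' -> vnonneg k v -> vnonneg k v' -> mtick v Z d -> mtick v' Z d' ->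
  sigeq (delay v d) (delay v' d').
Proof.
  intros HS Hv Hv' H H'. pose proof (mtick_pos v Z d H) as P. pose proof (mtick_pos v' Z d' H') as P'.
  pose proof HS as [E1 E2].
  destruct H as [D0 [[x0 [Hx0 Hb0]] H]], H' as [D0' [_ H']].
  destruct (H x0 Hx0) as [A1 A2]. destruct (H' x0 Hx0) as [A1' A2'].
  specialize (A1 Hb0). specialize (A1' Hb0). destruct (A2 A1) as [_ A3]. destruct (A2' A1') as [_ A3'].
  apply A3 in Hb0 as B0. apply A3' in Hb0 as B0'. rewrite (sigeq_fl v v' x0 HS Hv Hx0 A1) in B0'.
  set (c := Int_part (v x0)) in *.
  assert (Hc : (0 <= c <= Z.of_nat m)%Z) by (split; [apply fl_nonneg; auto|apply fl_le_m; auto]).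
  split.
  - apply eqv_intro.
    + intros x y z Hx Hy Hz. destruct (eqv_diff k m v v' x y z E1 Hx Hy Hz) as [G _]. unfold delay.
      split; intros; [assert (v' x - v' y < IZR z)|assert (v x - v y < IZR z)]; try lra; apply G; lra.
    + intros x z Hx Hz. unfold delay. pose proof (Hv x Hx). pose proof (Hv' x Hx).
      (* Constants up to 0 are settled because the delays are positive. For [1 <= z <= m] and
         [0 <= c <= m] the diagonal constant [z - c - 1] stays within [m] in absolute value. *)
      destruct (Z_lt_le_dec z 1) as [Hz1|Hz1].
      * assert (IZR z <= 0) by (apply (IZR_le z 0); lia). lra.
      * destruct (eqv_diff k m v v' x x0 (z - c - 1) E1 Hx Hx0 ltac:(lia)) as [G1 G2].
        rewrite !minus_IZR in G1, G2. split; split; intros.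
        -- assert (v' x - v' x0 < IZR z - IZR c - 1) by (apply G1; lra). lra.
        -- assert (v x - v x0 < IZR z - IZR c - 1) by (apply G1; lra). lra.
        -- assert (v' x - v' x0 > IZR z - IZR c - 1) by (apply G2; lra). lra.
        -- assert (v x - v x0 > IZR z - IZR c - 1) by (apply G2; lra). lra.
  - intros x Hx. unfold delay. destruct (Rlt_dec (v x) (INR m + 1)) as [Hl|Hl].
    + assert (Hl' : v' x < INR m + 1) by (apply E2; auto).
      destruct (H x Hx) as [_ X1]. destruct (H' x Hx) as [_ X1']. destruct (X1 Hl) as [X2 X3]. destruct (X1' Hl') as [X2' X3'].
      rewrite (sigeq_fl v v' x HS Hv Hx Hl) in X2', X3'.
      pose proof (fl_le_m _ Hl) as Hm. assert (fl (v x) <= INR m) by (rewrite INR_IZR_INZ; apply IZR_le; lia).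
      assert (EQ : v x + d = fl (v x) + 1 <-> v' x + d' = fl (v x) + 1) by tauto.
      split; intros.
      * destruct (Req_dec (v x + d) (fl (v x) + 1)) as [Q|Q]; [apply EQ in Q as Q'; lra|].
        assert (v' x + d' <> fl (v x) + 1) by tauto. lra.
      * destruct (Req_dec (v' x + d') (fl (v x) + 1)) as [Q|Q]; [apply EQ in Q as Q'; lra|].
        assert (v x + d <> fl (v x) + 1) by tauto. lra.
    + assert (~ v' x < INR m + 1) by (rewrite <- E2; auto). split; intros; lra.
Qed.

Lemma mtick_exists v v' Z d : sigeq v v' -> vnonneg k v -> vnonneg k v' -> mtick v Z d -> exists d', mtick v' Z d'.
Proof.
  intros HS Hv Hv' H. pose proof HS as [E1 E2].
  destruct H as [D0 [[x0 [Hx0 Hb0]] H]].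
  destruct (H x0 Hx0) as [A1 A2]. specialize (A1 Hb0). destruct (A2 A1) as [_ A3]. apply A3 in Hb0 as B0.
  pose proof (sigeq_fl v v' x0 HS Hv Hx0 A1) as F0.
  exists (fl (v' x0) + 1 - v' x0). pose proof (fl_bounds (v' x0)). split; [lra|]. split; [eauto|].
  intros x Hx. destruct (H x Hx) as [X1 X2]. split; [intros; apply E2; auto|].
  intros Hl'. assert (Hl : v x < INR m + 1) by (apply E2; auto). destruct (X2 Hl) as [X3 X4].
  rewrite F0, (sigeq_fl v v' x HS Hv Hx Hl), X4.
  destruct (eqv_diff k m v v' x x0 (Int_part (v x) - Int_part (v x0)) E1 Hx Hx0) as [G1 G2].
  { pose proof (fl_le_m _ Hl). pose proof (fl_le_m _ A1). pose proof (fl_nonneg _ (Hv x Hx)).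
    pose proof (fl_nonneg _ (Hv x0 Hx0)). lia. }
  rewrite minus_IZR in G1, G2. split.
  - apply Rnot_lt_le. intros Q. assert (v x - v x0 > fl (v x) - fl (v x0)) by (apply G2; lra). lra.
  - split; intros Q.
    + assert (~ v' x - v' x0 < fl (v x) - fl (v x0)) by (rewrite <- G1; lra).
      assert (~ v' x - v' x0 > fl (v x) - fl (v x0)) by (rewrite <- G2; lra). lra.
    + assert (~ v x - v x0 < fl (v x) - fl (v x0)) by (rewrite G1; lra).
      assert (~ v x - v x0 > fl (v x) - fl (v x0)) by (rewrite G2; lra). lra.
Qed.

(** The number of integers up to [m + 1] that the clock has yet to reach, hence of ticks until its
    timer is switched off. *)
Definition pot (v : valuation) x : nat :=
  if Rlt_dec (v x) (INR m + 1) then Z.to_nat (Z.of_nat m + 1 - Int_part (v x)) else 0%nat.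

Lemma pot_sigeq v v' x : sigeq v v' -> vnonneg k v -> (x < k)%nat -> pot v x = pot v' x.
Proof.
  intros HS Hv Hx. pose proof HS as [_ E2]. specialize (E2 x Hx). unfold pot.
  destruct (Rlt_dec (v x) (INR m + 1)), (Rlt_dec (v' x) (INR m + 1)); try tauto.
  rewrite (sigeq_fl v v' x); auto.
Qed.

Lemma pot_inactive v x : INR m + 1 <= v x -> pot v x = 0%nat.
Proof. intros. unfold pot. destruct Rlt_dec; [lra|auto]. Qed.

Lemma pot_mlet v O d x : mlet v O d -> (x < k)%nat -> pot (delay v d) x = pot v x.
Proof.
  intros [H0 H] Hx. destruct (H x Hx) as [_ H1].
  destruct (Rlt_dec (v x) (INR m + 1)) as [Hl|Hl].
  - destruct (H1 Hl) as [H2 _]. pose proof (fl_bounds (v x)). pose proof (fl_le_m _ Hl).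
    assert (fl (v x) <= INR m) by (rewrite INR_IZR_INZ; apply IZR_le; lia).
    assert (E : Int_part (delay v d x) = Int_part (v x)) by (apply Int_part_unique; unfold delay; lra).
    unfold pot. rewrite E. destruct (Rlt_dec (delay v d x)); [|unfold delay in *; lra].
    destruct (Rlt_dec (v x)); [auto|lra].
  - rewrite !pot_inactive; auto; unfold delay; lra.
Qed.

Lemma pot_mtick v Z d x : vnonneg k v -> mtick v Z d -> (x < k)%nat ->
  (pot (delay v d) x + chi (bit Z x) <= pot v x)%nat.
Proof.
  intros Hv [H0 [_ H]] Hx. destruct (H x Hx) as [HZ H1].
  destruct (Rlt_dec (v x) (INR m + 1)) as [Hl|Hl].
  - destruct (H1 Hl) as [H2 H3]. pose proof (fl_bounds (v x)). pose proof (fl_le_m _ Hl).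
    assert (fl (v x) <= INR m) by (rewrite INR_IZR_INZ; apply IZR_le; lia).
    destruct (classic (bit Z x)) as [B|B].
    + rewrite chi_true by auto. apply H3 in B.
      assert (E : Int_part (delay v d x) = (Int_part (v x) + 1)%Z).
      { apply Int_part_unique. rewrite plus_IZR. unfold delay. lra. }
      unfold pot. rewrite E. destruct (Rlt_dec (v x)); [|lra]. destruct Rlt_dec; lia.
    + rewrite chi_false by auto.
      assert (v x + d <> fl (v x) + 1) by tauto.
      assert (E : Int_part (delay v d x) = Int_part (v x)) by (apply Int_part_unique; unfold delay; lra).
      unfold pot. rewrite E. destruct (Rlt_dec (v x)); [|lra]. destruct Rlt_dec; lia.
  - rewrite (pot_inactive (delay v d)) by (unfold delay; lra). rewrite chi_false; [lia|]. tauto.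
Qed.
End Sig.

Lemma enumerate_infinite (P : nat -> Prop) : (forall N, exists j, (N <= j)%nat /\ P j) ->
  exists phi : nat -> nat, (forall i, (phi i < phi (S i))%nat) /\ (forall i, P (phi i)) /\
    (forall j, P j -> exists i, phi i = j).
Proof.
  intros H.
  assert (H' : forall N, exists j, (N <= j)%nat /\ P j /\ forall l, (N <= l)%nat -> P l -> (j <= l)%nat).
  { intros N. destruct (H N) as [j [H1 H2]]. revert H1 H2.
    induction j as [j IH] using (well_founded_induction lt_wf). intros H1 H2.
    destruct (classic (exists l, (N <= l)%nat /\ P l /\ (l < j)%nat)) as [[l [A1 [A2 A3]]]|A].
    - eauto.
    - exists j. split; auto. split; auto. intros l L1 L2. apply Nat.nlt_ge. intros L3. eauto. }
  pose (nx := fun N => proj1_sig (constructive_indefinite_description _ (H' N))).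
  assert (Hnx : forall N, (N <= nx N)%nat /\ P (nx N) /\ forall l, (N <= l)%nat -> P l -> (nx N <= l)%nat).
  { intros N. exact (proj2_sig (constructive_indefinite_description _ (H' N))). }
  pose (phi := fix phi i := match i with O => nx 0%nat | S i' => nx (S (phi i')) end).
  assert (Hinc : forall i, (phi i < phi (S i))%nat).
  { intros i. change (phi (S i)) with (nx (S (phi i))). destruct (Hnx (S (phi i))). lia. }
  exists phi. split; auto. split.
  - intros [|i]; apply Hnx.
  - intros j Hj. apply NNPP. intros Hno.
    assert (G : forall i, (phi i < j)%nat).
    { induction i as [|i IH].
      - destruct (Hnx 0%nat) as [_ [_ G]]. specialize (G j ltac:(lia) Hj).
        assert (phi 0%nat <> j) by (intros E; apply Hno; eauto). change (phi 0%nat) with (nx 0%nat) in *. lia.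
      - destruct (Hnx (S (phi i))) as [_ [_ G]]. specialize (G j ltac:(lia) Hj).
        assert (phi (S i) <> j) by (intros E; apply Hno; eauto). change (phi (S i)) with (nx (S (phi i))) in *. lia. }
    assert (G2 : forall i, (i <= phi i)%nat) by (induction i; [lia|specialize (Hinc i); lia]).
    specialize (G j). specialize (G2 j). lia.
Qed.

Lemma mono_lt (phi : nat -> nat) : (forall i, (phi i < phi (S i))%nat) ->
  forall i j, (i < j)%nat -> (phi i < phi j)%nat.
Proof. intros H i j. induction 1; [auto|]. specialize (H m). lia. Qed.

Lemma mono_lt_inv (phi : nat -> nat) : (forall i, (phi i < phi (S i))%nat) ->
  forall i j, (phi i < phi j)%nat -> (i < j)%nat.
Proof.
  intros H i j Hl. destruct (Nat.lt_trichotomy i j) as [|[->|G]]; auto; [lia|].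
  apply (mono_lt phi H) in G. lia.
Qed.

Lemma no_infinite_decrease (f : nat -> nat) (P : nat -> Prop) N :
  (forall j, (N <= j)%nat -> (f (S j) <= f j)%nat) ->
  (forall j, (N <= j)%nat -> P j -> (f (S j) < f j)%nat) ->
  (forall M, exists j, (M <= j)%nat /\ P j) -> False.
Proof.
  intros H1 H2 H3.
  assert (G : forall c M, (N <= M)%nat -> (f M <= c)%nat -> False).
  { induction c as [|c IH]; intros M HM Hf; destruct (H3 M) as [j [Hj Pj]];
      (assert (L : (f j <= f M)%nat) by (clear Pj; induction Hj; [auto|specialize (H1 m ltac:(lia)); lia]));
      specialize (H2 j ltac:(lia) Pj); [lia|]. apply (IH (S j)); lia. }
  apply (G (f N) N); auto.
Qed.

(** * The strategy that simulates the controller on representatives *)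

Section Strategy.
Variables (k : nat) (T : TA) (m : nat) (C : controller).
Hypothesis Hval : valid_controller k m (ta_na T) (ta_nb T) C.
Notation w := (enc_TA T).
Notation n := (nC k w).
Notation M := (MM w).
Notation nTw := (nT w).

Definition lc s := if lt_dec (pf s) (c_size C) then pf s else c_init C.
Definition vv s := repr k m (ps s).
Definition isL e := pf e = 0%nat /\ (pf (ps e) < ta_na T)%nat.
Definition dL v O := epsilon (inhabits 0) (fun d => mlet k m v O d).
Definition dT v Z := epsilon (inhabits 0) (fun d => mtick k m v Z d).

Lemma dL_spec v O : (exists d, mlet k m v O d) -> mlet k m v O (dL v O).
Proof. exact (epsilon_spec (inhabits 0) (fun d => mlet k m v O d)). Qed.
Lemma dT_spec v Z : (exists d, mtick k m v Z d) -> mtick k m v Z (dT v Z).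
Proof. exact (epsilon_spec (inhabits 0) (fun d => mtick k m v Z d)). Qed.

(** If the event is possible from the stored class, a delay realising it is chosen; a letter is
    answered as by the controller at the delayed representative, and a tick restarts the timers
    whose clocks are at most [m]. Impossible events leave the memory unchanged, but letters still
    need a legal answer. *)
Definition move s e : nat * nat :=
  if excluded_middle_informative (isL e) then
    if excluded_middle_informative (exists d, mlet k m (vv s) (ps (ps e)) d) then
      let nu := delay (vv s) (dL (vv s) (ps (ps e))) in
      let cd := c_delta C (lc s) (pf (ps e)) nu in
      (npair (fst (fst cd)) (sigc k m (reset (snd cd) nu)),
       npair (snd (fst cd)) (setc (fun x => In x (snd cd)) k))
    else (s, npair (snd (fst (c_delta C (lc s) (pf (ps e)) (vv s)))) 0)
  else if excluded_middle_informative (pf e = 1%nat /\ exists d, mtick k m (vv s) (ps e) d) then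
    let nu := delay (vv s) (dT (vv s) (ps e)) in
    (npair (lc s) (sigc k m nu), npair 0 (setc (fun x => bit (ps e) x /\ nu x <= INR m) k))
  else (s, npair 0 0).

Definition stp s e := fst (move s e).
Definition out s e := snd (move s e).
Definition NS := S (npair (c_size C) (NSig k m)).
Definition s0 := npair (c_init C) (sigc k m zero_val).

Lemma lc_lt s : (lc s < c_size C)%nat.
Proof. unfold lc. destruct lt_dec; auto. apply Hval. Qed.

Lemma NS_lt l c : (l < c_size C)%nat -> (c < NSig k m)%nat -> (npair l c < NS)%nat.
Proof. intros. unfold NS. apply Nat.lt_succ_r, npair_le; lia. Qed.

Lemma NR_lt b Y : (b <= w)%nat -> (Y <= 2 ^ k)%nat -> (npair b Y < NR k w)%nat.
Proof. intros. unfold NR. apply Nat.lt_succ_r, npair_le; lia. Qed.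

Lemma strategy_ok s e : (s < NS)%nat -> (stp s e < NS)%nat /\ (out s e < NR k w)%nat /\ allowP w e (out s e).
Proof.
  intros Hs. pose proof (w_bounds T) as [Wa [Wb _]]. pose proof (lc_lt s) as Hl.
  destruct Hval as [_ [V _]]. unfold stp, out, move, allowP. rewrite wna_enc, wnb_enc.
  destruct (excluded_middle_informative (isL e)) as [HL|HL].
  - destruct HL as [HL1 HL2]. destruct (excluded_middle_informative (exists d, _)) as [He|He].
    + set (nu := delay _ _). set (cd := c_delta C (lc s) (pf (ps e)) nu).
      destruct (V (lc s) (pf (ps e)) nu Hl HL2) as [V1 [V2 V3]]. fold cd in V1, V2, V3. cbn [fst snd].
      split; [apply NS_lt; auto; apply sig_lt|]. split; [|rewrite pf_npair; auto].
      apply NR_lt; [lia|]. apply Nat.lt_le_incl, setc_lt.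
    + destruct (V (lc s) (pf (ps e)) (vv s) Hl HL2) as [V1 [V2 V3]]. cbn [fst snd].
      split; auto. split; [|rewrite pf_npair; auto]. apply NR_lt; lia.
  - destruct (excluded_middle_informative (pf e = 1%nat /\ _)) as [He|He]; cbn [fst snd].
    + split; [apply NS_lt; auto; apply sig_lt|]. split; [apply NR_lt; [lia|apply Nat.lt_le_incl, setc_lt]|].
      intros. exfalso. apply HL. split; auto.
    + split; auto. split; [apply NR_lt; lia|]. intros. exfalso. apply HL. split; auto.
Qed.

Lemma vv_nonneg s : vnonneg k (vv s). Proof. apply rep_nonneg. Qed.

Lemma delay_nonneg p v d : vnonneg p v -> 0 <= d -> vnonneg p (delay v d).
Proof. intros H Hd x Hx. specialize (H x Hx). unfold delay. lra. Qed.
Lemma reset_nonneg p v L : vnonneg p v -> vnonneg p (reset L v).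
Proof. intros H x Hx. unfold reset. destruct in_dec; [lra|auto]. Qed.

(* A restarted timer has passed an integer at most [m], so clock [x] gets closer to [m + 1]. *)
Lemma monitor_potential s e x : (x < k)%nat -> (pf e = 0%nat -> ~ bit (ps (out s e)) x) ->
  (pot m (vv (stp s e)) x + chi (pf e = 1%nat /\ bit (ps e) x /\ bit (ps (out s e)) x) <= pot m (vv s) x)%nat.
Proof.
  intros Hx. unfold stp, out, move. assert (B0 : ~ bit 0 x).
  { unfold bit. rewrite (digit_high 2 0 x 0); simpl; lia. }
  destruct (excluded_middle_informative (isL e)) as [HL|HL].
  - assert (E0 : pf e = 0%nat) by apply HL.
    destruct (excluded_middle_informative (exists d, _)) as [He|He]; cbn [fst snd]; rewrite ?ps_npair; intros Hn.
    + rewrite chi_false by (rewrite E0; intros [? _]; discriminate). rewrite Nat.add_0_r.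
      assert (Hd : mlet k m (vv s) (ps (ps e)) (dL (vv s) (ps (ps e)))) by (apply dL_spec; auto).
      set (d := dL (vv s) (ps (ps e))) in *. set (nu := delay (vv s) d) in *.
      set (cd := c_delta C (lc s) (pf (ps e)) nu) in *.
      assert (Hnu : vnonneg k nu) by (apply delay_nonneg; [apply vv_nonneg|apply Hd]).
      unfold vv at 1. rewrite ps_npair.
      rewrite (pot_sigeq k m _ (reset (snd cd) nu)); auto using rep_nonneg, rep_sig, reset_nonneg.
      specialize (Hn E0). rewrite bit_setc in Hn.
      assert (E : reset (snd cd) nu x = nu x) by (unfold reset; destruct in_dec; tauto).
      unfold pot. rewrite E. fold (pot m nu x). unfold nu. rewrite (pot_mlet k m _ _ _ x Hd Hx). auto.
    + rewrite chi_false by (rewrite E0; intros [? _]; discriminate). lia.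
  - destruct (excluded_middle_informative (pf e = 1%nat /\ _)) as [He|He]; cbn [fst snd]; rewrite ?ps_npair; intros Hn.
    + destruct He as [E1 He].
      assert (Hd : mtick k m (vv s) (ps e) (dT (vv s) (ps e))) by (apply dT_spec; auto).
      set (d := dT (vv s) (ps e)) in *. set (nu := delay (vv s) d) in *.
      assert (Hnu : vnonneg k nu) by (apply delay_nonneg; [apply vv_nonneg|apply Hd]).
      unfold vv at 1. rewrite ps_npair.
      rewrite (pot_sigeq k m _ nu); auto using rep_nonneg, rep_sig.
      pose proof (pot_mtick k m (vv s) (ps e) d x (vv_nonneg s) Hd Hx) as P. fold nu in P.
      unfold chi in *. repeat destruct excluded_middle_informative; try lia; tauto.
    + rewrite chi_false; [lia|]. intros [_ [_ H]]. auto.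
Qed.

Section Run.
Variables (s q : nat -> nat) (lab : nat -> option nat).
Hypothesis Hs0 : s 0%nat = s0.
Hypothesis Hini : iniP k w (q 0%nat).
Hypothesis Hstep : forall j, match lab j with
     | None => s (S j) = s j /\ silP k w (q j) (q (S j))
     | Some e => (e < NE k w)%nat /\ s (S j) = stp (s j) e /\ evP k w e (out (s j) e) (q j) (q (S j)) end.
Hypothesis Hcnt : forall N, exists j, (N <= j)%nat /\ exists e, lab j = Some e /\ cntP k e (out (s j) e) (q j).

(** Each mark lowers the potential of the monitored clock, and nothing raises it while no letter
    resets that clock. *)
Lemma no_monitor_run : ~ (q 0%nat < S k)%nat.
Proof.
  intros H0.
  assert (Hall : forall j, (q j < S k)%nat).
  { induction j as [|j IH]; auto. specialize (Hstep j). destruct (lab j) as [e|].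
    - destruct Hstep as [_ [_ [[_ H]|[[_ [_ [H _]]]|[H _]]]]]; lia.
    - destruct Hstep as [_ [H _]]. lia. }
  assert (Hst : forall j, exists e, lab j = Some e /\ s (S j) = stp (s j) e /\
     (q j = 0%nat \/ ((0 < q j)%nat /\ q (S j) = q j /\ (pf e = 0%nat -> ~ bit (ps (out (s j) e)) (q j - 1))))).
  { intros j. specialize (Hstep j). specialize (Hall j). destruct (lab j) as [e|].
    - exists e. split; auto. destruct Hstep as [_ [H1 [[H _]|[[H [_ [H2 H3]]]|[H _]]]]]; [auto|auto|lia].
    - destruct Hstep as [_ [H _]]. lia. }
  destruct (classic (exists j, (0 < q j)%nat)) as [[j0 Hj0]|Hno].
  - assert (Hconst : forall j, (j0 <= j)%nat -> q j = q j0).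
    { induction 1 as [|j Hj IH]; auto. destruct (Hst j) as [e [_ [_ [H|[_ [H _]]]]]]; lia. }
    set (x := (q j0 - 1)%nat). assert (Hx : (x < k)%nat) by (specialize (Hall j0); unfold x; lia).
    assert (P : forall j, (j0 <= j)%nat -> exists e, lab j = Some e /\
      (pot m (vv (s (S j))) x + chi (pf e = 1%nat /\ bit (ps e) x /\ bit (ps (out (s j) e)) x) <= pot m (vv (s j)) x)%nat).
    { intros j Hj. destruct (Hst j) as [e [E1 [E2 H]]]. exists e. split; auto. rewrite E2.
      apply monitor_potential; auto. destruct H as [H|[_ [_ H]]]; [rewrite Hconst in H by auto; lia|].
      rewrite Hconst in H by auto. exact H. }
    apply (no_infinite_decrease (fun j => pot m (vv (s j)) x)
       (fun j => (j0 <= j)%nat /\ exists e, lab j = Some e /\ cntP k e (out (s j) e) (q j)) j0).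
    + intros j Hj. destruct (P j Hj) as [e [_ H]]. lia.
    + intros j Hj [_ [e [E1 Hc]]]. destruct (P j Hj) as [e' [E2 H]]. rewrite E1 in E2. injection E2 as <-.
      rewrite chi_true in H; [lia|]. rewrite Hconst in Hc by auto. fold x in Hc.
      destruct Hc as [[_ [_ H1]]|[H1 _]]; auto. specialize (Hall j0). lia.
    + intros N. destruct (Hcnt (N + j0)%nat) as [j [Hj He]]. exists j. split; [lia|]. split; [lia|auto].
  - destruct (Hcnt 0%nat) as [j [_ [e [_ Hc]]]].
    assert (q j = 0%nat) by (destruct (Nat.eq_0_gt_0_cases (q j)); auto; exfalso; eauto).
    destruct Hc as [[H1 _]|[H1 _]]; lia.
Qed.

Definition qq j := (q j - S k)%nat.

Lemma main_steps : (forall j, (S k <= q j)%nat) /\ forall j, match lab j with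
     | None => s (S j) = s j /\ silN k w (qq j) (qq (S j))
     | Some e => s (S j) = stp (s j) e /\ evN k w e (out (s j) e) (qq j) (qq (S j)) end.
Proof.
  assert (H0 : (S k <= q 0%nat)%nat) by (pose proof no_monitor_run; lia).
  assert (Hall : forall j, (S k <= q j)%nat).
  { induction j as [|j IH]; auto. specialize (Hstep j). destruct (lab j) as [e|].
    - destruct Hstep as [_ [_ [[H _]|[[_ [H _]]|[_ [H _]]]]]]; lia.
    - destruct Hstep as [_ [_ [H _]]]. lia. }
  split; auto. intros j. specialize (Hstep j). specialize (Hall j). destruct (lab j) as [e|].
  - destruct Hstep as [_ [H1 [[H _]|[[_ [H _]]|[_ [_ H]]]]]]; try lia. auto.
  - destruct Hstep as [H1 [_ [_ H]]]. auto.
Qed.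

(** The real state behind a grid run: controller memory and clock values at the last event, time
    since that event, joint valuation of automaton clocks and timers, absolute time. Silent steps
    leave the memory of the strategy alone, so clock values are those of the last event. *)
Record cfg := mkcfg { c_lm : nat; c_mu : valuation; c_De : R; c_J : valuation; c_tau : R }.

(** By [V_t] an active timer is the fractional part of its clock at the last event plus the time
    since; the representative in memory shares with the real clocks only the class, [V_sig]. *)
Record Inv2 (j : nat) (c : cfg) : Prop := {
  V_lm : pf (s j) = c_lm c /\ (c_lm c < c_size C)%nat;
  V_sig : sigeq k m (vv (s j)) (c_mu c);
  V_mu : vnonneg k (c_mu c);
  V_De : 0 <= c_De c;
  V_J0 : vnonneg n (c_J c);
  V_J : eqv n M (c_J c) (gv k T (qg (qq j)));
  V_A : forall x, (x < k)%nat -> (bit (qA (qq j)) x <-> c_mu c x < INR m + 1);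
  V_t : forall x, (x < k)%nat -> bit (qA (qq j)) x ->
     c_J c (nTw + x)%nat = c_mu c x - fl (c_mu c x) + c_De c }.

Arguments V_lm {j c}.
Arguments V_sig {j c}.
Arguments V_mu {j c}.
Arguments V_De {j c}.
Arguments V_J0 {j c}.
Arguments V_J {j c}.
Arguments V_A {j c}.
Arguments V_t {j c}.

Definition trule j (c c' : cfg) ru lb := In ru (ta_rules T) /\ r_src ru = qloc (qq j) /\ r_lab ru = lb /\
  sat (delay (c_J c) (c_tau c' - c_tau c)) (r_guard ru) /\ qloc (qq (S j)) = r_tgt ru /\
  forall x, (x < nTw)%nat -> c_J c' x = reset (r_reset ru) (delay (c_J c) (c_tau c' - c_tau c)) x.

Definition cnow (c c' : cfg) := delay (c_mu c) (c_De c + (c_tau c' - c_tau c)).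
Definition Fin l := In l (ta_final T).

Definition Rlet j e (c c' : cfg) :=
  let cd := c_delta C (c_lm c) (pf (ps e)) (cnow c c') in
  pf e = 0%nat /\ (pf (ps e) < ta_na T)%nat /\
  (exists ru, trule j c c' ru (Some (pf (ps e), snd (fst cd)))) /\
  c_lm c' = fst (fst cd) /\ c_mu c' = reset (snd cd) (cnow c c') /\ c_De c' = 0 /\
  (Fin (qloc (qq (S j))) \/ qf (qq (S j)) = 0%nat).

Definition Rtick j e (c c' : cfg) :=
  pf e = 1%nat /\ qloc (qq (S j)) = qloc (qq j) /\
  (forall x, (x < nTw)%nat -> c_J c' x = c_J c x + (c_tau c' - c_tau c)) /\
  c_lm c' = c_lm c /\ c_mu c' = cnow c c' /\ c_De c' = 0 /\ qf (qq (S j)) = 0%nat /\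
  mtick k m (c_mu c) (ps e) (c_De c + (c_tau c' - c_tau c)).

Definition Rsil j (c c' : cfg) :=
  (exists ru, trule j c c' ru None) /\ c_lm c' = c_lm c /\ c_mu c' = c_mu c /\
  c_De c' = c_De c + (c_tau c' - c_tau c) /\
  (Fin (qloc (qq (S j))) \/ qf (qq (S j)) = qf (qq j)).

Definition Rel j (c c' : cfg) := c_tau c <= c_tau c' /\
  match lab j with
  | None => Rsil j c c'
  | Some e => Rlet j e c c' \/ Rtick j e c c' end.

Lemma sil_exists j c : Inv2 j c -> lab j = None -> exists c', Inv2 (S j) c' /\ Rel j c c'.
Proof.
  intros I El. destruct main_steps as [_ HS]. specialize (HS j). rewrite El in HS. destruct HS as [Es Hs].
  destruct (sil_bwd k T _ _ (c_J c) (V_J0 I) (V_J I) Hs) as [d [Hd [_ [ru [R1 [R2 [R3 [R4 [R5 [R6 [R7 R8]]]]]]]]]]].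
  exists (mkcfg (c_lm c) (c_mu c) (c_De c + d) (reset (r_reset ru) (delay (c_J c) d)) (c_tau c + d)).
  assert (Ed : c_tau c + d - c_tau c = d) by ring.
  split.
  - constructor; cbn [c_lm c_mu c_De c_J c_tau].
    + rewrite Es. apply (V_lm I).
    + rewrite Es. apply (V_sig I).
    + apply (V_mu I).
    + pose proof (V_De I). lra.
    + apply reset_nonneg, delay_nonneg; auto. apply (V_J0 I).
    + exact R8.
    + rewrite R6. apply (V_A I).
    + rewrite R6. intros x Hx Bx. destruct (rule_bounds T ru R1) as [_ [B2 _]].
      unfold reset. destruct in_dec as [Hi|_]; [apply B2 in Hi; lia|].
      unfold delay. rewrite (V_t I x Hx Bx). lra.
  - split; cbn [c_tau]; [lra|]. rewrite El. unfold Rsil, trule. cbn [c_lm c_mu c_De c_J c_tau]. rewrite Ed.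
    split; [|split; [auto|split; [auto|split; [auto|]]]].
    + exists ru. repeat split; auto.
    + unfold Fin. rewrite R5. destruct R7 as [[R7 _]|[_ R7]]; auto.
Qed.

Lemma lc_lm j c : Inv2 j c -> lc (s j) = c_lm c.
Proof. intros I. destruct (V_lm I) as [E L]. unfold lc. destruct lt_dec; auto. lia. Qed.

Lemma let_exists j c e : Inv2 j c -> lab j = Some e ->
  (exists d, 0 <= d /\ pf e = 0%nat /\ rlet k T (pf (ps e)) (ps (ps e)) (pf (out (s j) e)) (ps (out (s j) e))
     (qloc (qq j)) (qA (qq j)) (delay (c_J c) d)
     (qloc (qq (S j))) (qf (qq (S j))) (qA (qq (S j))) (gv k T (qg (qq (S j))))) ->
  s (S j) = stp (s j) e -> exists c', Inv2 (S j) c' /\ Rel j c c'.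
Proof.
  intros I El [d [Hd [E0 [Na [U1 [U2 [ru [R1 [R2 [R3 [R4 [R5 [R6 [R7 R8]]]]]]]]]]]]]] Es.
  pose proof (V_De I) as HDe. pose proof (V_mu I) as Hmu.
  set (Dt := c_De c + d).
  assert (Ut : forall x, (x < k)%nat -> bit (qA (qq j)) x ->
    delay (c_J c) d (nTw + x)%nat = c_mu c x - fl (c_mu c x) + Dt).
  { intros x Hx Bx. unfold delay, Dt. rewrite (V_t I x Hx Bx). lra. }
  assert (Hm : mlet k m (c_mu c) (ps (ps e)) Dt).
  { split; [unfold Dt; lra|]. intros x Hx. split.
    - intros Bx. apply U2 in Bx; auto. apply (V_A I); tauto.
    - intros Hl. apply (V_A I) in Hl; auto. specialize (U1 x Hx Hl). specialize (U2 x Hx).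
      rewrite Ut in U1, U2 by auto. split; [lra|]. split; intros G.
      + apply U2 in G. lra.
      + apply U2. split; auto. lra. }
  pose proof (V_sig I) as HS. pose proof (vv_nonneg (s j)) as Hv.
  assert (Hex : exists d', mlet k m (vv (s j)) (ps (ps e)) d').
  { apply (mlet_exists k m (c_mu c) (vv (s j)) _ Dt); auto using sigeq_sym. }
  assert (HL : isL e) by (split; auto).
  assert (Hmove : move (s j) e =
      let nu := delay (vv (s j)) (dL (vv (s j)) (ps (ps e))) in
      let cd := c_delta C (lc (s j)) (pf (ps e)) nu in
      (npair (fst (fst cd)) (sigc k m (reset (snd cd) nu)),
       npair (snd (fst cd)) (setc (fun x => In x (snd cd)) k))).
  { unfold move. destruct (excluded_middle_informative (isL e)); [|tauto].
    destruct (excluded_middle_informative (exists d, _)); [auto|tauto]. }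
  set (nu := delay (vv (s j)) (dL (vv (s j)) (ps (ps e)))) in *.
  assert (Hd' : mlet k m (vv (s j)) (ps (ps e)) (dL (vv (s j)) (ps (ps e)))) by (apply dL_spec; auto).
  assert (Hnu : vnonneg k nu) by (apply delay_nonneg; [auto|apply Hd']).
  assert (HSnu : sigeq k m nu (delay (c_mu c) Dt)).
  { apply (mlet_sigeq k m _ _ (ps (ps e))); auto. }
  rewrite (lc_lm j c I) in Hmove.
  destruct (V_lm I) as [_ Hlm].
  (* The delayed representative and the delayed real valuation lie in one region, so the strategy
     answers as the controller does in the timed play. *)
  assert (Ecd : c_delta C (c_lm c) (pf (ps e)) nu = c_delta C (c_lm c) (pf (ps e)) (delay (c_mu c) Dt)).
  { apply Hval; auto. apply eqv_region, HSnu. }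
  cbv zeta in Hmove. rewrite Ecd in Hmove.
  set (cd := c_delta C (c_lm c) (pf (ps e)) (delay (c_mu c) Dt)) in *.
  unfold stp in Es. unfold out in R3, R6, R8. rewrite Hmove in Es, R3, R6, R8. cbn [fst snd] in Es, R3, R6, R8.
  rewrite pf_npair in R3. rewrite ps_npair in R6, R8.
  set (Y := setc (fun x => In x (snd cd)) k) in *.
  assert (HY : forall x, (x < k)%nat -> (bit Y x <-> In x (snd cd))) by (intros; unfold Y; rewrite bit_setc; tauto).
  destruct Hval as [_ [V2 _]]. destruct (V2 (c_lm c) (pf (ps e)) (delay (c_mu c) Dt) Hlm Na) as [W1 [W2 W3]].
  fold cd in W1, W2, W3.
  exists (mkcfg (fst (fst cd)) (reset (snd cd) (delay (c_mu c) Dt)) 0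
     (reset (r_reset ru ++ tmr k T Y Y) (delay (c_J c) d)) (c_tau c + d)).
  assert (Ed : c_tau c + d - c_tau c = d) by ring.
  assert (Hact : forall x, (x < k)%nat -> c_mu c x < INR m + 1 ->
     fl (c_mu c x) <= c_mu c x + Dt < fl (c_mu c x) + 1 /\ c_mu c x + Dt < INR m + 1).
  { intros x Hx Hl. destruct Hm as [_ Hm]. destruct (Hm x Hx) as [_ H1]. destruct (H1 Hl) as [H2 _].
    pose proof (fl_bounds (c_mu c x)). pose proof (fl_le_m m _ Hl).
    assert (fl (c_mu c x) <= INR m) by (rewrite INR_IZR_INZ; apply IZR_le; lia).
    assert (0 <= Dt) by (unfold Dt; lra). lra. }
  split.
  - constructor; cbn [c_lm c_mu c_De c_J c_tau].
    + rewrite Es, pf_npair. auto.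
    + rewrite Es. unfold vv. rewrite ps_npair.
      apply sigeq_trans with (reset (snd cd) nu); [apply rep_sig, reset_nonneg; auto|].
      destruct HSnu as [A1 A2]. split; [apply eqv_reset; auto|].
      intros x Hx. unfold reset. destruct in_dec; [tauto|auto].
    + apply reset_nonneg, delay_nonneg; auto. unfold Dt. lra.
    + lra.
    + apply reset_nonneg, delay_nonneg; auto. apply (V_J0 I).
    + exact R8.
    + intros x Hx. rewrite R6, HY, (V_A I) by auto. unfold reset.
      pose proof (pos_INR m). assert (0 <= Dt) by (unfold Dt; lra).
      destruct in_dec as [Hi|Hi]; [split; [lra|auto]|].
      unfold delay. split; [intros [G|G]; [apply Hact; auto|tauto]|]. intros G. left. lra.
    + intros x Hx Bx. rewrite R6 in Bx by auto.
      assert (Et : In (nTw + x)%nat (r_reset ru ++ tmr k T Y Y) <-> In x (snd cd)).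
      { rewrite in_app_iff, in_tmr_shift, HY by auto. split; [|auto]. intros [G|G]; [|tauto].
        destruct (rule_bounds T ru R1) as [_ [B2 _]]. apply B2 in G. lia. }
      unfold reset. destruct in_dec as [Hi|Hi], in_dec as [Hi'|Hi']; try tauto.
      * replace (Int_part 0) with 0%Z; [lra|]. symmetry. apply Int_part_unique. lra.
      * rewrite HY in Bx by auto. destruct Bx as [Bx|Bx]; [|tauto].
        rewrite Ut by auto. apply (V_A I) in Bx; auto. destruct (Hact x Hx Bx) as [Hb _].
        unfold delay. rewrite (Int_part_unique _ _ Hb). lra.
  - split; cbn [c_tau]; [lra|]. rewrite El. left.
    unfold Rlet, trule, cnow. cbn [c_lm c_mu c_De c_J c_tau]. rewrite Ed. fold Dt. fold cd.
    split; auto. split; auto. split; [|split; [auto|split; [auto|split; [auto|]]]].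
    + exists ru. repeat split; auto. intros x Hx. unfold reset.
      destruct in_dec as [Hi|Hi], in_dec as [Hi'|Hi']; auto.
      * apply in_app_or in Hi. destruct Hi as [Hi|Hi]; [tauto|]. apply in_tmr in Hi. lia.
      * exfalso. apply Hi, in_or_app. auto.
    + unfold Fin. rewrite R5, R7. unfold chi. destruct excluded_middle_informative; auto.
Qed.

Lemma tick_exists j c e : Inv2 j c -> lab j = Some e ->
  (exists d, 0 <= d /\ pf e = 1%nat /\ rtick k T (ps e) (ps (out (s j) e))
     (qloc (qq j)) (qA (qq j)) (delay (c_J c) d)
     (qloc (qq (S j))) (qf (qq (S j))) (qA (qq (S j))) (gv k T (qg (qq (S j))))) ->
  s (S j) = stp (s j) e -> exists c', Inv2 (S j) c' /\ Rel j c c'.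
Proof.
  intros I El [d [Hd [E0 [U0 [U1 [U2 [R1 [R2 [R3 R4]]]]]]]]] Es.
  pose proof (V_De I) as HDe. pose proof (V_mu I) as Hmu.
  set (Dt := c_De c + d).
  assert (Ut : forall x, (x < k)%nat -> bit (qA (qq j)) x ->
    delay (c_J c) d (nTw + x)%nat = c_mu c x - fl (c_mu c x) + Dt).
  { intros x Hx Bx. unfold delay, Dt. rewrite (V_t I x Hx Bx). lra. }
  assert (Hm : mtick k m (c_mu c) (ps e) Dt).
  { split; [unfold Dt; lra|]. split; auto. intros x Hx. split.
    - intros Bx. apply U2 in Bx; auto. apply (V_A I); tauto.
    - intros Hl. apply (V_A I) in Hl; auto. specialize (U1 x Hx Hl). specialize (U2 x Hx).
      rewrite Ut in U1, U2 by auto. split; [lra|]. split; intros G.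
      + apply U2 in G. lra.
      + apply U2. split; auto. lra. }
  pose proof (V_sig I) as HS. pose proof (vv_nonneg (s j)) as Hv.
  assert (Hex : exists d', mtick k m (vv (s j)) (ps e) d').
  { apply (mtick_exists k m (c_mu c) (vv (s j)) _ Dt); auto using sigeq_sym. }
  assert (Hmove : move (s j) e =
    let nu := delay (vv (s j)) (dT (vv (s j)) (ps e)) in
    (npair (lc (s j)) (sigc k m nu), npair 0 (setc (fun x => bit (ps e) x /\ nu x <= INR m) k))).
  { unfold move. destruct (excluded_middle_informative (isL e)) as [HL|]; [destruct HL; lia|].
    destruct (excluded_middle_informative (pf e = 1%nat /\ _)); [auto|tauto]. }
  set (nu := delay (vv (s j)) (dT (vv (s j)) (ps e))) in *.
  assert (Hd' : mtick k m (vv (s j)) (ps e) (dT (vv (s j)) (ps e))) by (apply dT_spec; auto).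
  assert (Hnu : vnonneg k nu) by (apply delay_nonneg; [auto|apply Hd']).
  assert (HSnu : sigeq k m nu (delay (c_mu c) Dt)).
  { apply (mtick_sigeq k m _ _ (ps e)); auto. }
  rewrite (lc_lm j c I) in Hmove. cbv zeta in Hmove.
  unfold stp in Es. unfold out in R2, R4. rewrite Hmove in Es, R2, R4. cbn [fst snd] in Es, R2, R4.
  rewrite ps_npair in R2, R4.
  set (Y := setc (fun x => bit (ps e) x /\ nu x <= INR m) k) in *.
  assert (HY : forall x, (x < k)%nat -> (bit Y x <-> bit (ps e) x /\ c_mu c x + Dt <= INR m)).
  { intros x Hx. unfold Y. rewrite bit_setc. destruct HSnu as [A1 _].
    destruct (eqv_one k m _ _ x (Z.of_nat m) A1 Hx ltac:(lia)) as [B1 B2].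
    pose proof (cmpR_iff CLe _ _ _ _ B1 B2) as B3. simpl in B3. rewrite <- INR_IZR_INZ in B3.
    change (delay (c_mu c) Dt x) with (c_mu c x + Dt) in B3. tauto. }
  exists (mkcfg (c_lm c) (delay (c_mu c) Dt) 0 (reset (tmr k T (ps e) Y) (delay (c_J c) d)) (c_tau c + d)).
  assert (Ed : c_tau c + d - c_tau c = d) by ring.
  assert (Hact : forall x, (x < k)%nat -> c_mu c x < INR m + 1 ->
     (bit (ps e) x /\ c_mu c x + Dt = fl (c_mu c x) + 1) \/
     (~ bit (ps e) x /\ fl (c_mu c x) <= c_mu c x + Dt < fl (c_mu c x) + 1 /\ c_mu c x + Dt < INR m + 1)).
  { intros x Hx Hl. destruct Hm as [_ [_ Hm]]. destruct (Hm x Hx) as [_ H1]. destruct (H1 Hl) as [H2 H3].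
    pose proof (fl_bounds (c_mu c x)). pose proof (fl_le_m m _ Hl).
    assert (fl (c_mu c x) <= INR m) by (rewrite INR_IZR_INZ; apply IZR_le; lia).
    assert (0 <= Dt) by (unfold Dt; lra).
    destruct (classic (bit (ps e) x)) as [B|B]; [left; tauto|right].
    assert (c_mu c x + Dt <> fl (c_mu c x) + 1) by tauto. split; auto. lra. }
  split.
  - constructor; cbn [c_lm c_mu c_De c_J c_tau].
    + rewrite Es, pf_npair. split; auto. apply (V_lm I).
    + rewrite Es. unfold vv. rewrite ps_npair.
      apply sigeq_trans with nu; auto. apply rep_sig; auto.
    + apply delay_nonneg; auto. unfold Dt. lra.
    + lra.
    + apply reset_nonneg, delay_nonneg; auto. apply (V_J0 I).
    + exact R4.
    + intros x Hx. rewrite R2, HY, (V_A I) by auto. unfold delay.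
      assert (0 <= Dt) by (unfold Dt; lra).
      destruct (Rlt_dec (c_mu c x) (INR m + 1)) as [Hl|Hl]; [|split; intros; lra].
      destruct (Hact x Hx Hl) as [[B E]|[B [_ E]]]; [|tauto].
      rewrite E. split.
      * intros [_ G]. specialize (G B). lra.
      * intros G. split; auto. intros _. split; auto.
        rewrite INR_IZR_INZ in *. assert (Int_part (c_mu c x) < Z.of_nat m)%Z by (apply lt_IZR; lra).
        rewrite <- plus_IZR. apply IZR_le. lia.
    + intros x Hx Bx. rewrite R2, HY in Bx by auto. destruct Bx as [Bx BY].
      apply (V_A I) in Bx as Hl; auto.
      unfold reset.
      destruct in_dec as [Hi|Hi]; rewrite in_tmr_shift, HY in Hi by auto.
      * destruct Hi as [Hi _]. destruct (Hact x Hx Hl) as [[_ E]|[B _]]; [|tauto].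
        assert (E' : Int_part (delay (c_mu c) Dt x) = (Int_part (c_mu c x) + 1)%Z).
        { apply Int_part_unique. rewrite plus_IZR. unfold delay. lra. }
        rewrite E', plus_IZR. unfold delay. lra.
      * destruct (Hact x Hx Hl) as [[B E]|[_ [E _]]]; [tauto|].
        rewrite Ut by auto. unfold delay. rewrite (Int_part_unique _ _ E). lra.
  - split; cbn [c_tau]; [lra|]. rewrite El. right. 
    unfold Rtick, cnow. cbn [c_lm c_mu c_De c_J c_tau]. rewrite Ed. fold Dt.
    repeat (split; [auto; fail|]). split; [|repeat (split; [auto; fail|]); auto].
    intros x Hx. unfold reset. destruct in_dec as [Hi|Hi]; [apply in_tmr in Hi; lia|]. reflexivity.
Qed.

Lemma step_exists j c : Inv2 j c -> exists c', Inv2 (S j) c' /\ Rel j c c'.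
Proof.
  intros I. destruct (lab j) as [e|] eqn:El; [|apply sil_exists; auto].
  destruct main_steps as [_ HS]. specialize (HS j). rewrite El in HS. destruct HS as [Es Hev].
  destruct (ev_bwd k T _ _ _ _ (c_J c) (V_J0 I) (V_J I) Hev) as [d [Hd [[E0 H]|[E0 H]]]].
  - apply (let_exists j c e); eauto.
  - apply (tick_exists j c e); eauto.
Qed.

Lemma cfg0 : exists c, Inv2 0 c /\ c_lm c = c_init C /\ c_mu c = zero_val /\ c_De c = 0 /\
  c_J c = zero_val /\ c_tau c = 0 /\ In (qloc (qq 0)) (ta_init T).
Proof.
  assert (H0 : (S k <= q 0%nat)%nat) by (pose proof no_monitor_run; lia).
  destruct Hini as [H|[_ [H1 [H2 [H3 H4]]]]]; [lia|]. fold (qq 0) in *.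
  rewrite wini_enc, inlc_enc in H1. apply eqN_plain in H4.
  exists (mkcfg (c_init C) zero_val 0 zero_val 0). split; [|cbn; auto 10].
  assert (Z0 : forall p, vnonneg p zero_val) by (intros p x _; unfold zero_val; lra).
  constructor; cbn [c_lm c_mu c_De c_J c_tau]; auto.
  - rewrite Hs0. unfold s0. rewrite pf_npair. split; auto. apply Hval.
  - rewrite Hs0. unfold s0, vv. rewrite ps_npair. apply rep_sig; auto.
  - lra.
  - eapply eqv_trans; [|exact H4]. apply eqv_ext. intros x Hx.
    unfold gv, nv, zero_val. rewrite (digit_high _ 0 x 0); try lia; [simpl; unfold Rdiv; lra| |simpl; lia].
    unfold GB. lia.
  - intros x Hx. unfold zero_val. pose proof (pos_INR m). split; [lra|auto].
  - intros x Hx _. unfold zero_val. replace (Int_part 0) with 0%Z; [lra|]. symmetry. apply Int_part_unique. lra.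
Qed.

Lemma cfg_sequence : exists cf : nat -> cfg, (forall j, Inv2 j (cf j)) /\ (forall j, Rel j (cf j) (cf (S j))) /\
  c_lm (cf 0%nat) = c_init C /\ c_mu (cf 0%nat) = zero_val /\ c_De (cf 0%nat) = 0 /\
  c_J (cf 0%nat) = zero_val /\ c_tau (cf 0%nat) = 0 /\ In (qloc (qq 0)) (ta_init T).
Proof.
  destruct cfg0 as [c0 [I0 Hc0]].
  pose (nx := fun j c => epsilon (inhabits c0) (fun c' => Inv2 (S j) c' /\ Rel j c c')).
  pose (cf := fix cf j := match j with O => c0 | S j' => nx j' (cf j') end).
  assert (HI : forall j, Inv2 j (cf j)).
  { induction j as [|j IH]; auto. simpl. unfold nx.
    apply (epsilon_spec (inhabits c0) _ (step_exists j (cf j) IH)). }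
  exists cf. split; auto. split; auto.
  intros j. simpl. unfold nx. apply (epsilon_spec (inhabits c0) _ (step_exists j (cf j) (HI j))).
Qed.

(** * Deleting the ticks to obtain a timed play *)

Section Extract.
Variable cf : nat -> cfg.
Hypothesis cfI : forall j, Inv2 j (cf j).
Hypothesis cfR : forall j, Rel j (cf j) (cf (S j)).
Hypothesis cf_lm0 : c_lm (cf 0%nat) = c_init C.
Hypothesis cf_mu0 : c_mu (cf 0%nat) = zero_val.
Hypothesis cf_De0 : c_De (cf 0%nat) = 0.
Hypothesis cf_J0 : c_J (cf 0%nat) = zero_val.
Hypothesis cf_tau0 : c_tau (cf 0%nat) = 0.
Hypothesis q_ini : In (qloc (qq 0)) (ta_init T).

Notation tau j := (c_tau (cf j)).
Definition ltr j := exists e, lab j = Some e /\ pf e = 0%nat.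
Definition isT j := lab j = None \/ ltr j.
Definition tck j := exists e, lab j = Some e /\ Rtick j e (cf j) (cf (S j)).

Lemma not_isT j : ~ isT j -> tck j.
Proof.
  intros H. specialize (cfR j). destruct cfR as [_ HR]. destruct (lab j) as [e|] eqn:E.
  - destruct HR as [HR|HR].
    + exfalso. apply H. right. exists e. split; auto. apply HR.
    + exists e. auto.
  - exfalso. apply H. left. auto.
Qed.

Lemma tau_mono j j' : (j <= j')%nat -> tau j <= tau j'.
Proof.
  induction 1 as [|j' Hj IH]; [lra|]. destruct (cfR j') as [H _]. lra.
Qed.

(** Marks occur only at events, so there are infinitely many events. If only finitely many were
    letters, ticks alone would lower the total potential of the clocks infinitely often. *)
Lemma inf_letters : forall N, exists j, (N <= j)%nat /\ ltr j.
Proof.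
  intros N. apply NNPP. intros Hno.
  assert (Hn : forall j, (N <= j)%nat -> ~ ltr j) by (intros j Hj Hl; apply Hno; eauto).
  apply (no_infinite_decrease (fun j => bsum k (pot m (c_mu (cf j)))) (fun j => (N <= j)%nat /\ exists e, lab j = Some e) N).
  - intros j Hj. destruct (classic (isT j)) as [[Hs|Hl]|Ht].
    + destruct (cfR j) as [_ HR]. rewrite Hs in HR. destruct HR as [_ [_ [-> _]]]. auto.
    + exfalso. eapply Hn; eauto.
    + apply not_isT in Ht. destruct Ht as [e [_ [_ [_ [_ [_ [-> [_ [_ Hm]]]]]]]]].
      apply bsum_le. intros x Hx.
      pose proof (pot_mtick k m _ _ _ x (V_mu (cfI j)) Hm Hx). unfold cnow. lia.
  - intros j Hj [_ [e He]]. assert (Ht : ~ isT j).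
    { intros [Hs|Hl]; [congruence|]. eapply Hn; eauto. }
    apply not_isT in Ht. destruct Ht as [e' [_ [_ [_ [_ [_ [-> [_ [_ Hm]]]]]]]]].
    pose proof Hm as [_ [[x0 [Hx0 Bx0]] _]].
    apply bsum_lt with x0; auto.
    + intros x Hx. pose proof (pot_mtick k m _ _ _ x (V_mu (cfI j)) Hm Hx). unfold cnow. lia.
    + pose proof (pot_mtick k m _ _ _ x0 (V_mu (cfI j)) Hm Hx0) as P.
      rewrite chi_true in P by auto. unfold cnow. lia.
  - intros M0. destruct (Hcnt (M0 + N)%nat) as [j [Hj [e [He _]]]]. exists j. split; [lia|]. split; [lia|eauto].
Qed.

(** Letters and ticks put the flag down unless a letter enters a final location, and silent steps
    raise it only at a final location. Without these it would stay down, and no mark would be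
    made. *)
Lemma inf_final : forall N, exists j, (N <= j)%nat /\ isT j /\ Fin (qloc (qq (S j))).
Proof.
  intros N. apply NNPP. intros Hno.
  assert (Hn : forall j, (N <= j)%nat -> isT j -> ~ Fin (qloc (qq (S j)))) by (intros j Hj Hl Hf; apply Hno; eauto).
  destruct (inf_letters N) as [j1 [Hj1 [e1 [El1 Ep1]]]].
  assert (H0 : forall j, (S j1 <= j)%nat -> qf (qq j) = 0%nat).
  { induction 1 as [|j Hj IH].
    - destruct (cfR j1) as [_ HR]. rewrite El1 in HR. destruct HR as [HR|HR].
      + destruct HR as [_ [_ [_ [_ [_ [_ [HF|HF]]]]]]]; auto. exfalso. apply (Hn j1); auto. right. exists e1. auto.
      + destruct HR as [HR _]. lia.
    - destruct (classic (isT j)) as [[Hs|Hl]|Ht].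
      + destruct (cfR j) as [_ HR]. rewrite Hs in HR. destruct HR as [_ [_ [_ [_ [HF|HF]]]]]; [|congruence].
        exfalso. apply (Hn j); auto; [lia|]. left. auto.
      + destruct Hl as [e [El Ep]]. destruct (cfR j) as [_ HR]. rewrite El in HR. destruct HR as [HR|HR].
        * destruct HR as [_ [_ [_ [_ [_ [_ [HF|HF]]]]]]]; auto. exfalso. apply (Hn j); auto; [lia|]. right. exists e. auto.
        * destruct HR as [HR _]. lia.
      + apply not_isT in Ht. destruct Ht as [e [_ Ht]]. apply Ht. }
  destruct (Hcnt (S j1)) as [j [Hj [e [_ Hc]]]]. destruct main_steps as [Hall _]. specialize (Hall j).
  destruct Hc as [[_ [H _]]|[_ H]]; [lia|]. fold (qq j) in H. rewrite H0 in H by auto. lia.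
Qed.

Lemma ticks_between j1 j2 : (j1 <= j2)%nat -> (forall j, (j1 <= j < j2)%nat -> ~ isT j) ->
  qloc (qq j2) = qloc (qq j1) /\ forall x, (x < nTw)%nat -> c_J (cf j2) x - tau j2 = c_J (cf j1) x - tau j1.
Proof.
  induction 1 as [|j Hj IH]; intros H; [auto|].
  destruct (IH (fun l Hl => H l ltac:(lia))) as [E1 E2].
  destruct (not_isT j (H j ltac:(lia))) as [e [_ [_ [F1 [F2 _]]]]].
  split; [congruence|]. intros x Hx. rewrite F2 by auto. rewrite <- (E2 x Hx). lra.
Qed.

Lemma nonletters_between j1 j2 : (j1 <= j2)%nat -> (forall j, (j1 <= j < j2)%nat -> ~ ltr j) ->
  c_lm (cf j2) = c_lm (cf j1) /\
  forall x, c_mu (cf j2) x + c_De (cf j2) - tau j2 = c_mu (cf j1) x + c_De (cf j1) - tau j1.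
Proof.
  induction 1 as [|j Hj IH]; intros H; [auto|].
  destruct (IH (fun l Hl => H l ltac:(lia))) as [E1 E2].
  destruct (classic (isT j)) as [[Hs|Hl]|Ht].
  - destruct (cfR j) as [_ HR]. rewrite Hs in HR. destruct HR as [_ [F1 [F2 [F3 _]]]].
    split; [congruence|]. intros x. rewrite F2, F3, <- (E2 x). lra.
  - exfalso. apply (H j); [lia|auto].
  - apply not_isT in Ht. destruct Ht as [e [_ [_ [_ [_ [F1 [F2 [F3 _]]]]]]]].
    split; [congruence|]. intros x. rewrite F2, F3, <- (E2 x). unfold cnow, delay. lra.
Qed.

Definition letter_label j e := Some (pf (ps e),
  snd (fst (c_delta C (c_lm (cf j)) (pf (ps e)) (cnow (cf j) (cf (S j)))))).

Lemma rule_ex j : exists ru, isT j ->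
  (lab j = None /\ trule j (cf j) (cf (S j)) ru None) \/
  (exists e, lab j = Some e /\ trule j (cf j) (cf (S j)) ru (letter_label j e)).
Proof.
  destruct (classic (isT j)) as [[Hs|[e [El Ep]]]|H].
  - destruct (cfR j) as [_ HR]. rewrite Hs in HR. destruct HR as [[ru Hr] _]. exists ru. auto.
  - destruct (cfR j) as [_ HR]. rewrite El in HR. destruct HR as [HR|[HR _]]; [|lia].
    destruct HR as [_ [_ [[ru Hr] _]]]. exists ru. intros _. right. exists e. auto.
  - exists (mkRule 0 None CTrue nil 0). tauto.
Qed.

Theorem losing_play : exists (a : nat -> nat) (t : nat -> R),
  (forall i, (a i < ta_na T)%nat) /\ 0 <= t 0%nat /\ (forall i, t i <= t (S i)) /\
  in_lang T (fun i => ((a i, canswer C a t i), t i)).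
Proof.
  (* [phi] lists the steps that are transitions of the automaton, and [psi] the places of the
     letters in that list. *)
  destruct (enumerate_infinite isT) as [phi [P1 [P2 P3]]].
  { intros N. destruct (inf_letters N) as [j [Hj Hl]]. exists j. split; auto. right. auto. }
  destruct (enumerate_infinite (fun i => ltr (phi i))) as [psi [S1 [S2 S3]]].
  { intros N. destruct (inf_letters (phi N)) as [j [Hj Hl]]. destruct (P3 j (or_intror Hl)) as [i <-].
    exists i. split; auto. destruct (Nat.lt_ge_cases i N) as [G|G]; auto. apply (mono_lt phi P1) in G. lia. }
  pose (chi_ := fun i => phi (psi i)).
  assert (Cinc : forall i, (chi_ i < chi_ (S i))%nat) by (intros i; apply (mono_lt phi P1), S1).
  assert (Call : forall j, ltr j -> exists i, chi_ i = j).
  { intros j Hl. destruct (P3 j (or_intror Hl)) as [i Hi]. rewrite <- Hi in Hl. destruct (S3 i Hl) as [l Hl'].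
    exists l. unfold chi_. congruence. }
  pose (a := fun i => match lab (chi_ i) with Some e => pf (ps e) | None => 0%nat end).
  pose (t := fun i => tau (S (chi_ i))).
  assert (Et : forall i, t i = tau (S (chi_ i))) by reflexivity.
  pose (ru := fun j => proj1_sig (constructive_indefinite_description _ (rule_ex j))).
  assert (Hru : forall j, isT j -> (lab j = None /\ trule j (cf j) (cf (S j)) (ru j) None) \/
    (exists e, lab j = Some e /\ trule j (cf j) (cf (S j)) (ru j) (letter_label j e))).
  { intros j. exact (proj2_sig (constructive_indefinite_description _ (rule_ex j))). }
  assert (HL : forall i, exists e, lab (chi_ i) = Some e /\ a i = pf (ps e) /\
    Rlet (chi_ i) e (cf (chi_ i)) (cf (S (chi_ i)))).
  { intros i. destruct (S2 i) as [e [El Ep]]. fold (chi_ i) in El. exists e. split; auto. unfold a. rewrite El.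
    split; auto. destruct (cfR (chi_ i)) as [_ HR]. rewrite El in HR. destruct HR as [HR|[HR _]]; [auto|lia]. }
  assert (Ha : forall i, (a i < ta_na T)%nat).
  { intros i. destruct (HL i) as [e [_ [-> [_ [H _]]]]]. auto. }
  assert (Hcs : forall i, fst (cstate C a t i) = c_lm (cf (chi_ i)) /\
     forall x, snd (cstate C a t i) x + (tau (chi_ i) - prev t i) = c_mu (cf (chi_ i)) x + c_De (cf (chi_ i))).
  { induction i as [|i [IH1 IH2]].
    - destruct (nonletters_between 0 (chi_ 0%nat)) as [E1 E2]; [lia| |].
      + intros j Hj Hl. destruct (Call j Hl) as [i Hi]. destruct i as [|i]; [lia|].
        pose proof (mono_lt chi_ Cinc 0 (S i) ltac:(lia)). lia.
      + simpl. rewrite E1, cf_lm0. split; auto. intros x. specialize (E2 x).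
        rewrite cf_mu0, cf_De0, cf_tau0 in E2. unfold zero_val in *. lra.
    - destruct (HL i) as [e [El [Ea [_ [Hna [_ [F1 [F2 [F3 _]]]]]]]]].
      destruct (nonletters_between (S (chi_ i)) (chi_ (S i))) as [E1 E2]; [apply Cinc| |].
      + intros j Hj Hl. destruct (Call j Hl) as [l Hl']. subst j.
        assert (i < l)%nat by (apply (mono_lt_inv chi_ Cinc); lia).
        assert (l < S i)%nat by (apply (mono_lt_inv chi_ Cinc); lia). lia.
      + assert (Ed : c_delta C (fst (cstate C a t i)) (a i) (delay (snd (cstate C a t i)) (t i - prev t i)) =
            c_delta C (c_lm (cf (chi_ i))) (pf (ps e)) (cnow (cf (chi_ i)) (cf (S (chi_ i))))).
        { rewrite IH1, <- Ea. apply Hval; auto; [apply (V_lm (cfI _))|].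
          apply eqv_region, eqv_ext. intros x Hx. unfold cnow, delay. rewrite (Et i). specialize (IH2 x). lra. }
        cbn [cstate fst snd]. rewrite Ed, E1, F1. split; auto. intros x.
        specialize (E2 x). rewrite F2, F3 in E2.
        assert (Er : forall L, reset L (delay (snd (cstate C a t i)) (t i - prev t i)) x =
          reset L (cnow (cf (chi_ i)) (cf (S (chi_ i)))) x).
        { intros L. unfold reset. destruct in_dec; auto. unfold cnow, delay. rewrite (Et i). specialize (IH2 x). lra. }
        rewrite Er. simpl prev. rewrite (Et i). lra. }
  assert (Hans : forall i e, lab (chi_ i) = Some e -> canswer C a t i =
     snd (fst (c_delta C (c_lm (cf (chi_ i))) (pf (ps e)) (cnow (cf (chi_ i)) (cf (S (chi_ i))))))).
  { intros i e El. unfold canswer. destruct (Hcs i) as [IH1 IH2].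
    assert (Ea : a i = pf (ps e)) by (unfold a; rewrite El; auto).
    do 2 f_equal. rewrite IH1, <- Ea. apply Hval; auto; [apply (V_lm (cfI _))|].
    apply eqv_region, eqv_ext. intros x Hx. unfold cnow, delay. rewrite (Et i). specialize (IH2 x). lra. }
  exists a, t. split; auto. split; [rewrite <- cf_tau0; apply tau_mono; lia|].
  split; [intros i; apply tau_mono; specialize (Cinc i); lia|].
  pose (r := fun i => ru (phi i)). pose (tm := fun i => tau (S (phi i))).
  assert (Etm : forall i, tm i = tau (S (phi i))) by reflexivity.
  pose (loc := fun i => qloc (qq (phi i))).
  (* [is_run] asks for all clock indices, so the valuation is built anew; it agrees with the joint
     valuation below [nT w], which is all that guards inspect. *)
  pose (val := fix val i := match i with O => zero_val
     | S i' => reset (r_reset (r i')) (delay (val i') (tm i' - prev tm i')) end).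
  assert (Hrule : forall i, exists lb, trule (phi i) (cf (phi i)) (cf (S (phi i))) (r i) lb /\ (lb = None <-> lab (phi i) = None)).
  { intros i. destruct (Hru (phi i) (P2 i)) as [[H1 H2]|[e [H1 H2]]].
    - exists None. tauto.
    - exists (letter_label (phi i) e). split; auto. unfold letter_label. split; intros; congruence. }
  assert (Hgap : forall i j, (S (phi i) <= j < phi (S i))%nat -> ~ isT j).
  { intros i j Hj Hl. destruct (P3 j Hl) as [l Hl']. subst j.
    assert (i < l)%nat by (apply (mono_lt_inv phi P1); lia).
    assert (l < S i)%nat by (apply (mono_lt_inv phi P1); lia). lia. }
  assert (Hval0 : forall i x, (x < nTw)%nat -> val i x + (tau (phi i) - prev tm i) = c_J (cf (phi i)) x).
  { induction i as [|i IH]; intros x Hx.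
    - destruct (ticks_between 0 (phi 0%nat)) as [_ E]; [lia| |].
      + intros j Hj Hl. destruct (P3 j Hl) as [[|l] Hl']; [lia|].
        pose proof (mono_lt phi P1 0 (S l) ltac:(lia)). lia.
      + specialize (E x Hx). rewrite cf_J0, cf_tau0 in E. simpl. unfold zero_val in *. lra.
    - destruct (ticks_between (S (phi i)) (phi (S i)) (P1 i) (Hgap i)) as [_ E]. specialize (E x Hx).
      destruct (Hrule i) as [lb [[_ [_ [_ [_ [_ F]]]]] _]]. rewrite F in E by auto.
      simpl. rewrite (Etm i).
      assert (Er : reset (r_reset (r i)) (delay (val i) (tau (S (phi i)) - prev tm i)) x =
        reset (r_reset (r i)) (delay (c_J (cf (phi i))) (tau (S (phi i)) - tau (phi i))) x).
      { unfold reset. destruct in_dec; auto. unfold delay. rewrite <- (IH x Hx). lra. }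
      rewrite Er. lra. }
  exists r, tm, loc, val, psi. split; [|split; [|split; [|split]]].
  - split; [|split; [|split; [|split]]].
    + unfold loc. destruct (ticks_between 0 (phi 0%nat)) as [E _]; [lia| |rewrite E; auto].
      intros j Hj Hl. destruct (P3 j Hl) as [[|l] Hl']; [lia|].
      pose proof (mono_lt phi P1 0 (S l) ltac:(lia)). lia.
    + reflexivity.
    + unfold tm. rewrite <- cf_tau0. apply tau_mono. lia.
    + intros i. unfold tm. apply tau_mono. specialize (P1 i). lia.
    + intros i. destruct (Hrule i) as [lb [[F1 [F2 [F3 [F4 [F5 F6]]]]] _]].
      split; auto. split; auto. split; [|split; [|reflexivity]].
      * apply (sat_agree T _ (delay (c_J (cf (phi i))) (tau (S (phi i)) - tau (phi i)))); auto.
        intros x Hx. unfold delay. rewrite (Etm i), <- (Hval0 i x Hx). lra.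
      * unfold loc. destruct (ticks_between (S (phi i)) (phi (S i)) (P1 i) (Hgap i)) as [E _].
        rewrite E. auto.
  - intros N. destruct (inf_final (phi N)) as [j [Hj [Hl HF]]]. destruct (P3 j Hl) as [i Hi]. subst j.
    exists (S i). split.
    + destruct (Nat.lt_ge_cases i N) as [G|G]; [|lia]. apply (mono_lt phi P1) in G. lia.
    + unfold loc. destruct (ticks_between (S (phi i)) (phi (S i)) (P1 i) (Hgap i)) as [E _].
      rewrite E. exact HF.
  - auto.
  - intros i. split; [|reflexivity]. cbn [fst].
    destruct (HL i) as [e [El [Ea _]]]. rewrite (Hans i e El), Ea.
    destruct (Hru (chi_ i) (P2 (psi i))) as [[H1 _]|[e' [H1 H2]]]; [congruence|].
    rewrite El in H1. injection H1 as <-. apply H2.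
  - intros i Hi. apply S3. destruct (P2 i) as [Hs|Hl]; auto. exfalso. apply Hi.
    destruct (Hrule i) as [lb [[_ [_ [F _]]] E]]. rewrite F. apply E. auto.
Qed.
End Extract.
End Run.
End Strategy.

Theorem ranks_of_controller k T : has_km_controller k T -> Solv k (enc_TA T).
Proof.
  intros [m [C [Hval Hwin]]]. set (w := enc_TA T).
  destruct (@Synthesis.bounded_ranks_nat (NQ k w) (NE k w) (NR k w) (NS k m C) (silP k w) (evP k w)
    (fun e r p => if excluded_middle_informative (cntP k e r p) then true else false)
    (iniP k w) (allowP w) (stp k T m C) (out k T m C) (s0 k m C)) as [X [[b0 [Xb0 Hb0]] HX]].
  - unfold NE. lia.
  - apply NS_lt; [apply Hval|apply sig_lt].
  - intros s e Hs _. apply strategy_ok; auto.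
  - intros [s [q [lab [H1 [H2 [H3 [H4 H5]]]]]]].
    assert (H5' : forall N, exists j, (N <= j)%nat /\ exists e, lab j = Some e /\ cntP k e (out k T m C (s j) e) (q j)).
    { intros N. destruct (H5 N) as [j [Hj [e [E1 E2]]]]. exists j. split; auto. exists e. split; auto.
      destruct (excluded_middle_informative _) in E2; [auto|discriminate]. }
    destruct (cfg_sequence k T m C Hval s q lab H1 H2 H4 H5') as [cf [C1 [C2 [C3 [C4 [C5 [C6 [C7 C8]]]]]]]].
    destruct (losing_play k T m C Hval s q lab H1 H4 H5' cf C1 C2 C3 C4 C5 C6 C7 C8) as [a [t [A1 [A2 [A3 A4]]]]].
    exact (Hwin a t A1 A2 A3 A4).
  - change (Kb (NQ k w)) with (KK k w) in *.
    (* Only the values below [NQ k w] of a function in [X] matter. They are at most [KK k w + 1], so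
       they fit into the digits of one number. *)
    pose (P := fun b => exists f, X f /\ forall p, (p < NQ k w)%nat -> rkd k w b p = f p).
    assert (code : forall f, X f -> exists b, (b < NB k w)%nat /\ forall p, (p < NQ k w)%nat -> rkd k w b p = f p).
    { intros f Xf. exists (vec f (NQ k w) (KK k w + 2)). split; [apply vec_lt; lia|].
      intros p Hp. unfold rkd. rewrite digit_vec by lia. apply Nat.mod_small.
      destruct (HX f Xf) as [H _]. specialize (H p Hp). lia. }
    exists (setc P (NB k w)). split; [apply setc_lt|]. split.
    + destruct (code b0 Xb0) as [b [Hb Eb]]. exists b. split; auto. split.
      * apply bit_setc. split; auto. exists b0. auto.
      * intros p Hp Hi. rewrite Eb by auto. auto.
    + intros b Hb Hbit. apply bit_setc in Hbit. destruct Hbit as [_ [f [Xf Ef]]].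
      destruct (HX f Xf) as [G1 [G2 G3]]. split.
      * intros p Hp p' Hp' Hs. rewrite !Ef by auto. apply G2; auto.
      * intros e He. destruct (G3 e He) as [r [f' [R1 [R2 [R3 R4]]]]].
        exists r. split; auto. split; auto. destruct (code f' R3) as [b' [Hb' Eb']].
        exists b'. split; auto. split; [apply bit_setc; split; auto; exists f'; auto|].
        intros p Hp p' Hp' Hev. rewrite Ef, Eb' by auto. intros Hk.
        specialize (R4 p p' Hp Hp' Hev Hk). unfold chi.
        destruct (excluded_middle_informative (cntP k e r p)); exact R4.
Qed.

Theorem theorem3 : forall k : nat, decidable_pred enc_TA (has_km_controller k).
Proof.
  intros k. destruct (decidable_Solv k enc_TA) as [c Hc]. exists c. intros T. destruct (Hc T) as [H1 H2].
  split; intros H.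
  - apply H1, ranks_of_controller, H.
  - apply H2. intros HS. apply H, controller_of_ranks, HS.
Qed.
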